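(* For $c\in\mathbb{C}$ with $\operatorname{Re} c>0$ let $\zeta_c(z)=\sum_{n,\ell=1}^\infty(c\ell+n)^{-z}$ (for $\operatorname{Re} z>2$, and extended by meromorphic continuation to a neighborhood of $z=0$). Define $$b_{-2}=\frac1c,\qquad b_{-1}=-\frac12-\frac1{2c},\qquad b_0=\frac14+\frac c{12}+\frac1{12c}.$$ Then $$\zeta_c'(0)=\int_1^\infty\frac1t\,\frac1{e^{ct}-1}\,\frac1{e^t-1}\,dt+\int_0^1\frac1t\left(\frac1{e^{ct}-1}\,\frac1{e^t-1}-\frac{b_{-2}}{t^2}-\frac{b_{-1}}t-b_0\right)dt-\frac12b_{-2}-b_{-1}+b_0\gamma_e.$$
   Context: $\gamma_e$ is the Euler–Mascheroni constant. $\zeta_c'(0)$ is the derivative with respect to $z$ at $z=0$ of the meromorphic continuation of $\zeta_c(z)$. *)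

(* Defs.v *)
(* Stdlib reals and Coquelicot. *)
From Stdlib Require Export Reals.
From Coquelicot Require Export Coquelicot.
Open Scope R_scope.

Definition Cexp (z : C) : C :=
  (exp (Re z) * cos (Im z), exp (Re z) * sin (Im z)).

(* Principal argument, with values in (-PI, PI]; it is meaningless at w = 0. *)
Definition Carg (w : C) : R :=
  if Rle_dec 0 (Im w) then acos (Re w / Cmod w) else - acos (Re w / Cmod w).

Definition Clog (w : C) : C := (ln (Cmod w), Carg w).

Definition Cpower (w s : C) : C := Cexp (s * Clog w)%C.

(* The paper's indices l, n >= 1 are S l and S n. *)
Definition zeta_term (c z : C) (l n : nat) : C :=
  Cpower (c * INR (S l) + INR (S n))%C (- z)%C.

(* Rectangular partial sums, both bounds tending independently to infinity;
   for 0 < Re c and 2 < Re z the double series converges absolutely, so the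
   mode of summation is immaterial. *)
Definition is_zeta (c z s : C) : Prop :=
  filterlim
    (fun N : nat * nat =>
       sum_n (fun l => sum_n (fun n => zeta_term c z l n) (snd N)) (fst N))
    (filter_prod eventually eventually) (locally s).

Definition C_derivable (f : C -> C) (z : C) : Prop :=
  @ex_derive C_AbsRing C_NormedModule f z.

Definition is_C_derive (f : C -> C) (z d : C) : Prop :=
  @is_derive C_AbsRing C_NormedModule f z d.

Definition connected_set (U : C -> Prop) : Prop :=
  forall A B : C -> Prop, open A -> open B ->
    (forall z, U z -> A z \/ B z) ->
    (forall z, U z -> ~ (A z /\ B z)) ->
    (exists z, U z /\ A z) -> (exists z, U z /\ B z) -> False.

(* f has a pole at p, of some order S m >= 1. *)
Definition has_pole (f : C -> C) (p : C) : Prop :=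
  exists (m : nat) (h : C -> C),
    locally p (fun z => C_derivable h z) /\ h p <> 0 /\
    locally' p (fun z => f z = (h z / (z - p) ^ S m)%C).

(* P is the set of poles; f is a total function, with unspecified values
   on P. *)
Definition meromorphic_on (U : C -> Prop) (f : C -> C) : Prop :=
  exists P : C -> Prop,
    (forall z, U z -> locally' z (fun w => ~ P w)) /\
    (forall z, U z -> ~ P z -> C_derivable f z) /\
    (forall z, U z -> P z -> has_pole f z).

Definition zeta_continuation (c : C) (U : C -> Prop) (F : C -> C) : Prop :=
  open U /\ connected_set U /\
  (forall z : C, 2 < Re z -> U z) /\ U 0 /\
  meromorphic_on U F /\
  (forall z : C, 2 < Re z -> is_zeta c z (F z)).

Definition bm2 (c : C) : C := (/ c)%C.
Definition bm1 (c : C) : C := (- (1 / 2) - 1 / (2 * c))%C.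
Definition b0 (c : C) : C := (1 / 4 + c / 12 + 1 / (12 * c))%C.

(* (H_(n+1) - ln (n+1)) tends to the Euler-Mascheroni constant. *)
Definition gamma_e : R :=
  real (Lim_seq (fun n => sum_n (fun k => / INR (S k)) n - ln (INR (S n)))).

Definition kernel (c : C) (t : R) : C :=
  (/ t * / (Cexp (c * t) - 1) * / (Cexp t - 1))%C.

Definition kernel_reg (c : C) (t : R) : C :=
  (/ t * (/ (Cexp (c * t) - 1) * / (Cexp t - 1)
          - bm2 c / t ^ 2 - bm1 c / t - b0 c))%C.

(* Main.v *)
(* Write W = c + 1 and let DD be the double difference of steps c and 1, so that sums of DD A over the
   lattice points w = c l + n telescope.  With b_j the coefficients of D^2 / ((e^{cD} - 1) (e^D - 1)) and
   phi_j the j-th derivative of w^(2-z), Taylor's formula gives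
   (z - 1) (z - 2) w^(-z) = DD (sum_{j < M} b_j phi_j) + O(|w|^(-Re z - M)).
   Summing over the lattice, the first part telescopes to sum_j b_j phi_j(W) and the second converges for
   Re z > 2 - M; as M is arbitrary, (z - 1) (z - 2) zeta_c(z) extends to an entire function H, and only the
   poles 1 and 2 remain.  Uniqueness of the continuation is the identity theorem, which together with
   Weierstrass' convergence theorem is derived from Goursat's lemma and Cauchy's formula.

   For M = 3, the derivative at z = 0 of each term is expressed through powers and log w, and Frullani's
   integral turns these into integrals of e^{-wt} t^{-k} over [eps, T], up to divergent polynomial parts in w
   of degree at most 2, which DD-telescoping sees only through W.  The geometric series in e^{-wt} then sums to
   the kernel 1 / (t (e^{ct} - 1) (e^t - 1)), and no Gamma function is needed: the constant gamma_e enters via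
   the limit of the integral of e^{-t} / t over [eps, oo) plus ln eps, which is - gamma_e. *)
Require Import Defs.
From Stdlib Require Import Lra Lia Factorial Classical Wf_nat IndefiniteDescription ClassicalEpsilon.

(** * Derivatives and continuity of complex-valued functions *)

(** Two differentiations of w^(2-z) produce exactly the factor (z - 1) (z - 2); starting from
    w^(2-z) rather than from antiderivatives of w^(-z) avoids every division by a quantity that
    vanishes at 1 or 2. At z = 0, 1, 2 the functions involved are polynomials in w and all
    remainders vanish, so H(0), H(1), H(2) can be read off. Since H(0) = 2 b_0, one gets zeta_c'(0)
    = H'(0) / 2 + 3 b_0 / 2, and the last term cancels a - 3 b_0 in H'(0) that goes back to the
    derivative - 3 of (z - 1) (z - 2) at 0. The delicate point is to exchange the lattice limit with
    that of the bounds eps and T, for integrands of size t^(-3) near 0. Instead of dominated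
    convergence, a finite rectangle of lattice points is kept to the end. The integrands summed over
    it are known in closed form: they differ from twice the kernel by 2 D(-t) / t times boundary
    exponentials whose decay rate is at least a fixed multiple of n, where D(t) / t is the
    regularized kernel. As D(-t) / t is bounded on (0, oo), the error is O(1/n) uniformly in eps and
    T. *)

Notation Rder g t d := (@is_derive R_AbsRing C_R_NormedModule g t (d : C)%C).
Definition CInt (f : R -> C) (a b : R) : C := @RInt C_R_CompleteNormedModule f a b.
Notation Ccont := (@continuous _ C_UniformSpace).

Lemma is_C_derive_eps (f : C -> C) (z d : C) :
  is_C_derive f z d <->
  forall eps : R, 0 < eps -> exists del : R, 0 < del /\ forall w : C,
    Cmod (w - z) < del -> Cmod (f w - f z - d * (w - z)) <= eps * Cmod (w - z).
Proof.
  split.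
  - intros [_ H] eps Heps.
    destruct (H z (fun P HP => HP) (mkposreal eps Heps)) as [del Hdel].
    exists del. split; [apply cond_pos|]. intros w Hw.
    generalize (Hdel w Hw). unfold norm, minus, plus, opp, scal; simpl.
    unfold mult; simpl. intros H1. rewrite (Cmult_comm d). exact H1.
  - intros H. split; [apply is_linear_scal_l|].
    intros x Hx eps.
    assert (E : z = x) by exact (is_filter_lim_locally_unique (V:=AbsRing_NormedModule C_AbsRing) z x Hx).
    subst x.
    destruct (H eps (cond_pos eps)) as [del [Hd H1]].
    exists (mkposreal del Hd). intros w Hw.
    generalize (H1 w Hw). unfold norm, minus, plus, opp, scal; simpl.
    unfold mult; simpl. intros H2. rewrite (Cmult_comm d) in H2. exact H2.
Qed.

Lemma Cmod_le_Re_Im (z : C) : Cmod z <= Rabs (Re z) + Rabs (Im z).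
Proof.
  replace z with (RtoC (Re z) + RtoC (Im z) * Ci)%C at 1.
  - eapply Rle_trans; [apply Cmod_triangle|]. rewrite Cmod_mult, Cmod_Ci, !Cmod_R. lra.
  - destruct z; unfold Ci, RtoC, Cplus, Cmult; simpl. f_equal; ring.
Qed.

Lemma im_le_Cmod (z : C) : Rabs (Im z) <= Cmod z.
Proof. eapply Rle_trans; [|apply Rmax_Cmod]. apply Rmax_r. Qed.

Lemma norm_Cmod (z : C) : @norm R_AbsRing C_R_NormedModule z = Cmod z.
Proof. symmetry. exact (Cmod_norm z). Qed.

Lemma Rder_eps (g : R -> C) (t : R) (d : C) :
  Rder g t d <->
  forall eps : R, 0 < eps -> exists del : R, 0 < del /\ forall s : R,
    Rabs (s - t) < del -> Cmod (g s - g t - (s - t)%R * d) <= eps * Rabs (s - t).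
Proof.
  split.
  - intros [_ H] eps Heps.
    destruct (H t (fun P HP => HP) (mkposreal eps Heps)) as [del Hdel].
    exists del. split; [apply cond_pos|]. intros w Hw.
    generalize (Hdel w Hw).
    rewrite norm_Cmod, scal_R_Cmult. exact (fun h => h).
  - intros H. split; [apply is_linear_scal_l|].
    intros x Hx eps.
    assert (E : t = x) by exact (is_filter_lim_locally_unique t x Hx).
    subst x.
    destruct (H eps (cond_pos eps)) as [del [Hd H1]].
    exists (mkposreal del Hd). intros w Hw.
    generalize (H1 w Hw).
    rewrite norm_Cmod, scal_R_Cmult. exact (fun h => h).
Qed.

Lemma Rder_pair (g : R -> C) (t : R) (d : C) :
  is_derive (fun s => Re (g s)) t (Re d) -> is_derive (fun s => Im (g s)) t (Im d) ->
  Rder g t d.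
Proof.
  intros H1 H2. apply Rder_eps. intros eps Heps.
  assert (He : 0 < eps / 2) by lra.
  destruct H1 as [_ H1], H2 as [_ H2].
  destruct (H1 t (fun P HP => HP) (mkposreal _ He)) as [d1 K1].
  destruct (H2 t (fun P HP => HP) (mkposreal _ He)) as [d2 K2].
  exists (Rmin d1 d2). split; [apply Rmin_pos; apply cond_pos|].
  intros s Hs.
  specialize (K1 s (Rlt_le_trans _ _ _ Hs (Rmin_l _ _))).
  specialize (K2 s (Rlt_le_trans _ _ _ Hs (Rmin_r _ _))).
  eapply Rle_trans; [apply Cmod_le_Re_Im|].
  replace (eps * Rabs (s - t)) with (eps / 2 * Rabs (s - t) + eps / 2 * Rabs (s - t)) by field.
  unfold norm, minus, plus, opp, scal in K1, K2; simpl in K1, K2.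
  unfold abs, mult in K1, K2; simpl in K1, K2.
  apply Rplus_le_compat.
  - unfold Cminus. rewrite !re_plus, !re_opp, re_scal_l. exact K1.
  - unfold Cminus. rewrite !im_plus, !im_opp, im_scal_l. exact K2.
Qed.

Lemma Rder_Re (g : R -> C) (t : R) (d : C) :
  Rder g t d -> is_derive (fun s => Re (g s)) t (Re d).
Proof.
  intros H. unfold Re.
  apply (filterdiff_comp' (U:=R_NormedModule) (V:=C_R_NormedModule) (W:=R_NormedModule) g (fun p : C => fst p) t (fun y => scal y d) (fun p : C => fst p)) in H.
  - exact H.
  - apply filterdiff_linear. apply (is_linear_fst (U:=R_NormedModule) (V:=R_NormedModule)).
Qed.

Lemma Rder_Im (g : R -> C) (t : R) (d : C) :
  Rder g t d -> is_derive (fun s => Im (g s)) t (Im d).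
Proof.
  intros H. unfold Im.
  apply (filterdiff_comp' (U:=R_NormedModule) (V:=C_R_NormedModule) (W:=R_NormedModule) g (fun p : C => snd p) t (fun y => scal y d) (fun p : C => snd p)) in H.
  - exact H.
  - apply filterdiff_linear. apply (is_linear_snd (U:=R_NormedModule) (V:=R_NormedModule)).
Qed.

Lemma Rder_eq (g : R -> C) (t : R) (d d' : C) : Rder g t d -> d = d' -> Rder g t d'.
Proof. intros H <-; exact H. Qed.

Lemma Rder_const (k : C) (t : R) : Rder (fun _ => k) t 0.
Proof. exact (@is_derive_const R_AbsRing C_R_NormedModule k t). Qed.

Lemma Rder_plus (f g : R -> C) (t : R) (d e : C) :
  Rder f t d -> Rder g t e -> Rder (fun s => f s + g s)%C t (d + e)%C.
Proof. exact (is_derive_plus (V:=C_R_NormedModule) f g t d e). Qed.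

Lemma Rder_opp (f : R -> C) (t : R) (d : C) :
  Rder f t d -> Rder (fun s => - f s)%C t (- d)%C.
Proof. exact (is_derive_opp (V:=C_R_NormedModule) f t d). Qed.

Lemma Rder_minus (f g : R -> C) (t : R) (d e : C) :
  Rder f t d -> Rder g t e -> Rder (fun s => f s - g s)%C t (d - e)%C.
Proof. exact (is_derive_minus (V:=C_R_NormedModule) f g t d e). Qed.

Lemma is_derive_eq_R (f : R -> R) (x a b : R) : is_derive f x a -> a = b -> is_derive f x b.
Proof. intros H <-; exact H. Qed.

Lemma Rder_mult (f g : R -> C) (t : R) (d e : C) :
  Rder f t d -> Rder g t e -> Rder (fun s => f s * g s)%C t (d * g t + f t * e)%C.
Proof.
  intros Hf Hg.
  assert (A := Rder_Re _ _ _ Hf). assert (B := Rder_Im _ _ _ Hf).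
  assert (A' := Rder_Re _ _ _ Hg). assert (B' := Rder_Im _ _ _ Hg).
  apply Rder_pair.
  - apply (is_derive_ext (fun s => minus (mult (Re (f s)) (Re (g s))) (mult (Im (f s)) (Im (g s))))).
    { intros s. rewrite re_mult. reflexivity. }
    eapply is_derive_eq_R.
    + apply (is_derive_minus (V:=R_NormedModule));
      apply (is_derive_mult (K:=R_AbsRing)); eauto; exact Rmult_comm.
    + rewrite re_plus, !re_mult. unfold minus, plus, opp, mult; simpl. ring.
  - apply (is_derive_ext (fun s => plus (mult (Re (f s)) (Im (g s))) (mult (Im (f s)) (Re (g s))))).
    { intros s. rewrite im_mult. reflexivity. }
    eapply is_derive_eq_R.
    + apply (is_derive_plus (V:=R_NormedModule));
      apply (is_derive_mult (K:=R_AbsRing)); eauto; exact Rmult_comm.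
    + rewrite im_plus, !im_mult. unfold minus, plus, opp, mult; simpl. ring.
Qed.

Lemma Rder_RtoC (f : R -> R) (t d : R) : is_derive f t d -> Rder (fun s => RtoC (f s)) t d.
Proof.
  intros H. apply Rder_pair; [exact H|]. exact (is_derive_const 0 t).
Qed.

Lemma Rder_id (t : R) : Rder (fun s => RtoC s) t 1.
Proof. apply Rder_RtoC. apply @is_derive_id. Qed.

Lemma Rder_line (a h : C) (t : R) : Rder (fun s => a + s * h)%C t h.
Proof.
  eapply Rder_eq.
  - apply Rder_plus; [apply Rder_const|]. apply Rder_mult; [apply Rder_id|apply Rder_const].
  - cbv beta; ring.
Qed.

Lemma Cmod_minus_le (a b : C) : Cmod (a - b) <= Cmod a + Cmod b.
Proof. unfold Cminus. rewrite <- (Cmod_opp b). apply Cmod_triangle. Qed.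

Lemma Cmod_minus_sym (a b : C) : Cmod (a - b) = Cmod (b - a).
Proof. rewrite <- Cmod_opp. f_equal. ring. Qed.

Lemma Cmod_le_add (a b : C) : Cmod a <= Cmod (a - b) + Cmod b.
Proof. replace a with ((a - b) + b)%C at 1 by ring. apply Cmod_triangle. Qed.

(** The outer derivative is complex linear and the inner one only real linear, so the chain rule is
    proved from the two epsilon forms. [k] is a local Lipschitz constant of [g], and [eps] is shared
    equally between the errors of [f] and of [g]. *)
Lemma Rder_comp (f : C -> C) (g : R -> C) (t : R) (d v : C) :
  is_C_derive f (g t) d -> Rder g t v -> Rder (fun s => f (g s)) t (d * v)%C.
Proof.
  rewrite is_C_derive_eps, !Rder_eps. intros Hf Hg eps Heps.
  pose (k := Cmod v + 1). assert (Hk : 0 < k) by (unfold k; generalize (Cmod_ge_0 v); lra).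
  pose (q := Cmod d + 1). assert (Hq : 0 < q) by (unfold q; generalize (Cmod_ge_0 d); lra).
  destruct (Hf (eps / (2 * k))) as [d1 [Hd1 K1]].
  { apply Rdiv_lt_0_compat; lra. }
  destruct (Hg (Rmin 1 (eps / (2 * q)))) as [d2 [Hd2 K2]].
  { apply Rmin_pos; [lra|]. apply Rdiv_lt_0_compat; lra. }
  exists (Rmin d2 (d1 / k)). split.
  { apply Rmin_pos; [lra|]. apply Rdiv_lt_0_compat; lra. }
  intros s Hs.
  assert (Hs2 := Rlt_le_trans _ _ _ Hs (Rmin_l _ _)).
  assert (Hs1 := Rlt_le_trans _ _ _ Hs (Rmin_r _ _)).
  specialize (K2 s Hs2).
  assert (P := Rabs_pos (s - t)).
  assert (L : Cmod (g s - g t) <= k * Rabs (s - t)).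
  { eapply Rle_trans; [apply (Cmod_le_add _ ((s - t)%R * v))|].
    rewrite Cmod_mult, Cmod_R. unfold k.
    assert (Rmin 1 (eps / (2 * q)) * Rabs (s - t) <= 1 * Rabs (s - t))
      by (apply Rmult_le_compat_r; [exact P|apply Rmin_l]). lra. }
  assert (L1 : Cmod (g s - g t) < d1).
  { eapply Rle_lt_trans; [exact L|]. apply (Rmult_lt_reg_l (/ k)); [now apply Rinv_0_lt_compat|].
    replace (/ k * (k * Rabs (s - t))) with (Rabs (s - t)) by (field; lra).
    replace (/ k * d1) with (d1 / k) by (field; lra). exact Hs1. }
  specialize (K1 (g s) L1).
  replace (f (g s) - f (g t) - (s - t)%R * (d * v))%C with
    ((f (g s) - f (g t) - d * (g s - g t)) + d * (g s - g t - (s - t)%R * v))%C by ring.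
  eapply Rle_trans; [apply Cmod_triangle|]. rewrite Cmod_mult.
  assert (A1 : eps / (2 * k) * Cmod (g s - g t) <= eps / 2 * Rabs (s - t)).
  { replace (eps / 2 * Rabs (s - t)) with (eps / (2 * k) * (k * Rabs (s - t))) by (field; lra).
    apply Rmult_le_compat_l; [|exact L]. apply Rlt_le, Rdiv_lt_0_compat; lra. }
  assert (A2 : Cmod d * Cmod (g s - g t - (s - t)%R * v) <= eps / 2 * Rabs (s - t)).
  { replace (eps / 2 * Rabs (s - t)) with (q * (eps / (2 * q) * Rabs (s - t))) by (field; lra).
    apply Rmult_le_compat; try apply Cmod_ge_0. { unfold q; lra. }
    eapply Rle_trans; [exact K2|]. apply Rmult_le_compat_r; [exact P|apply Rmin_r]. }
  lra.
Qed.

(* Apply the real mean value theorem to the component of [g] along [g b - g a]; [g'] need not be continuous. *)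
Lemma mean_value_C (g g' : R -> C) (a b M : R) : a <= b ->
  (forall t, a <= t <= b -> Rder g t (g' t)) ->
  (forall t, a <= t <= b -> Cmod (g' t) <= M) ->
  Cmod (g b - g a) <= M * (b - a).
Proof.
  intros Hab Hg HM.
  set (v := (g b - g a)%C).
  destruct (Req_dec (Cmod v) 0) as [E|E].
  { rewrite E. apply Rmult_le_pos; [|lra].
    eapply Rle_trans; [apply Cmod_ge_0|apply (HM a); lra]. }
  assert (Hv : 0 < Cmod v) by (generalize (Cmod_ge_0 v); lra).
  destruct (MVT_gen (fun t => Re (Cconj v * g t)) a b (fun t => Re (Cconj v * g' t))) as [c [Hc K]].
  - rewrite Rmin_left, Rmax_right by lra. intros t Ht. apply Rder_Re.
    eapply Rder_eq; [apply Rder_mult; [apply Rder_const|apply Hg; lra]|]. cbv beta; ring.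
  - rewrite Rmin_left, Rmax_right by lra. intros t Ht.
    apply continuity_pt_filterlim.
    apply (ex_derive_continuous (K:=R_AbsRing) (V:=R_NormedModule)). eexists. apply Rder_Re.
    apply Rder_mult; [apply Rder_const|apply Hg; lra].
  - rewrite Rmin_left, Rmax_right in Hc by lra.
    assert (E1 : Re (Cconj v * g b) - Re (Cconj v * g a) = Cmod v ^ 2).
    { replace (Re (Cconj v * g b) - Re (Cconj v * g a)) with (Re (Cconj v * v)).
      - rewrite Cmult_comm, <- Cmod2_conj. 
        apply re_RtoC.
      - unfold v at 2. replace (Cconj v * (g b - g a))%C with (Cconj v * g b - Cconj v * g a)%C by ring.
        unfold Cminus. now rewrite re_plus, re_opp. }
    rewrite E1 in K.
    assert (E2 : Re (Cconj v * g' c) <= Cmod v * M).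
    { eapply Rle_trans; [apply Rle_abs|]. eapply Rle_trans; [apply re_le_Cmod|].
      rewrite Cmod_mult, Cmod_conj. apply Rmult_le_compat_l; [lra|]. now apply HM. }
    assert (E3 : Cmod v ^ 2 <= Cmod v * (M * (b - a))).
    { rewrite K. rewrite <- Rmult_assoc. apply Rmult_le_compat_r; lra. }
    simpl in E3. rewrite Rmult_1_r in E3. now apply Rmult_le_reg_l in E3.
Qed.

Lemma cont_pair {U : UniformSpace} (f : U -> C) (x : U) :
  continuous (fun u => Re (f u)) x -> continuous (fun u => Im (f u)) x -> Ccont f x.
Proof.
  intros H1 H2. apply filterlim_locally. intros eps.
  generalize (filter_and _ _ (proj1 (filterlim_locally _ _) H1 eps) (proj1 (filterlim_locally _ _) H2 eps)).
  apply filter_imp. intros y [A B]. split; [exact A|exact B].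
Qed.

Lemma cont_Re {U : UniformSpace} (f : U -> C) (x : U) :
  Ccont f x -> continuous (fun u => Re (f u)) x.
Proof.
  intros H. apply filterlim_locally. intros eps.
  generalize (proj1 (filterlim_locally _ _) H eps). apply filter_imp. intros y [A B]. exact A.
Qed.

Lemma cont_Im {U : UniformSpace} (f : U -> C) (x : U) :
  Ccont f x -> continuous (fun u => Im (f u)) x.
Proof.
  intros H. apply filterlim_locally. intros eps.
  generalize (proj1 (filterlim_locally _ _) H eps). apply filter_imp. intros y [A B]. exact B.
Qed.

Lemma cont_plus {U : UniformSpace} (f g : U -> C) (x : U) :
  Ccont f x -> Ccont g x -> Ccont (fun u => f u + g u)%C x.
Proof.
  intros Hf Hg. apply cont_pair; apply (continuous_plus (V:=R_NormedModule));
    auto using cont_Re, cont_Im.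
Qed.

Lemma cont_opp {U : UniformSpace} (f : U -> C) (x : U) :
  Ccont f x -> Ccont (fun u => - f u)%C x.
Proof.
  intros Hf. apply cont_pair; apply (continuous_opp (V:=R_NormedModule));
    auto using cont_Re, cont_Im.
Qed.

Lemma cont_minus {U : UniformSpace} (f g : U -> C) (x : U) :
  Ccont f x -> Ccont g x -> Ccont (fun u => f u - g u)%C x.
Proof. intros Hf Hg. apply cont_plus; [exact Hf|now apply cont_opp]. Qed.

Lemma cont_mult {U : UniformSpace} (f g : U -> C) (x : U) :
  Ccont f x -> Ccont g x -> Ccont (fun u => f u * g u)%C x.
Proof.
  intros Hf Hg. apply cont_pair.
  - apply (continuous_minus (V:=R_NormedModule)); apply (continuous_mult (K:=R_AbsRing));
    auto using cont_Re, cont_Im.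
  - apply (continuous_plus (V:=R_NormedModule)); apply (continuous_mult (K:=R_AbsRing));
    auto using cont_Re, cont_Im.
Qed.

Lemma cont_const {U : UniformSpace} (k : C) (x : U) : Ccont (fun _ : U => k) x.
Proof. apply continuous_const. Qed.

Lemma cont_RtoC {U : UniformSpace} (f : U -> R) (x : U) :
  continuous f x -> Ccont (fun u => RtoC (f u)) x.
Proof. intros H. apply cont_pair; [exact H|apply continuous_const]. Qed.

Lemma continuous_Rinv {U : UniformSpace} (f : U -> R) (x : U) :
  continuous f x -> f x <> 0 -> continuous (fun u => / f u) x.
Proof.
  intros Hf Hx. apply (continuous_comp f Rinv); [exact Hf|].
  apply continuity_pt_filterlim. apply continuity_pt_inv; [apply continuity_pt_id|exact Hx].
Qed.

Lemma Cmod_sqr_pos (z : C) : z <> 0%C -> fst z ^ 2 + snd z ^ 2 <> 0.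
Proof.
  intros H E. apply H. destruct z as [x y]; simpl in *.
  assert (x = 0) by nra. assert (y = 0) by nra. subst. reflexivity.
Qed.

Lemma cont_inv {U : UniformSpace} (f : U -> C) (x : U) :
  Ccont f x -> f x <> 0%C -> Ccont (fun u => / f u)%C x.
Proof.
  intros Hf Hx. assert (H := Cmod_sqr_pos _ Hx).
  assert (A := cont_Re _ _ Hf). assert (B := cont_Im _ _ Hf).
  assert (D : continuous (fun u => / (fst (f u) ^ 2 + snd (f u) ^ 2)) x).
  { apply (continuous_Rinv (fun u => fst (f u) ^ 2 + snd (f u) ^ 2)); [|exact H]. simpl.
    apply (continuous_plus (V:=R_NormedModule));
     (apply (continuous_mult (K:=R_AbsRing)); [|apply (continuous_mult (K:=R_AbsRing))]);
     try exact A; try exact B; apply continuous_const. }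
  apply cont_pair; unfold Re, Im, Cinv; simpl; apply (continuous_mult (K:=R_AbsRing)).
  - exact A.
  - exact D.
  - apply (continuous_opp (V:=R_NormedModule)). exact B.
  - exact D.
Qed.

Lemma cont_eps (f : C -> C) (z : C) :
  (forall eps, 0 < eps -> exists del, 0 < del /\ forall w, Cmod (w - z) < del -> Cmod (f w - f z) < eps)
  -> Ccont f z.
Proof.
  intros H. apply filterlim_locally. intros eps.
  destruct (H eps (cond_pos eps)) as [del [Hd K]].
  apply locally_C. exists (mkposreal del Hd). intros w Hw.
  apply C_NormedModule_mixin_compat1. apply K. exact Hw.
Qed.

Lemma locally_Cmod (z : C) (P : C -> Prop) :
  @locally C_UniformSpace z P <-> exists del, 0 < del /\ forall w, Cmod (w - z) < del -> P w.
Proof.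
  split.
  - intros H. apply locally_C in H. destruct H as [d Hd]. exists d. split; [apply cond_pos|exact Hd].
  - intros [d [Hd H]]. apply locally_C. exists (mkposreal d Hd). exact H.
Qed.

Lemma cont_eps_iff (f : C -> C) (z : C) :
  Ccont f z <->
  (forall eps, 0 < eps -> exists del, 0 < del /\ forall w, Cmod (w - z) < del -> Cmod (f w - f z) < eps).
Proof.
  split; [|apply cont_eps].
  intros H eps He.
  assert (K : @locally C_UniformSpace (f z) (fun w => Cmod (w - f z) < eps)).
  { apply locally_Cmod. exists eps. auto. }
  apply H in K. apply locally_Cmod in K. exact K.
Qed.

Lemma is_C_derive_cont (f : C -> C) (z d : C) : is_C_derive f z d -> Ccont f z.
Proof.
  intros H. apply cont_eps. intros eps He. rewrite is_C_derive_eps in H.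
  destruct (H 1 Rlt_0_1) as [del [Hd K]].
  assert (Hk : 0 < Cmod d + 1) by (generalize (Cmod_ge_0 d); lra).
  exists (Rmin del (eps / (Cmod d + 1))). split.
  { apply Rmin_pos; [exact Hd|]. now apply Rdiv_lt_0_compat. }
  intros w Hw.
  assert (H1 := Rlt_le_trans _ _ _ Hw (Rmin_l _ _)).
  assert (H2 := Rlt_le_trans _ _ _ Hw (Rmin_r _ _)).
  specialize (K w H1).
  assert (L := Cmod_le_add (f w - f z) (d * (w - z))). rewrite Cmod_mult in L.
  assert (eps = (eps / (Cmod d + 1)) * (Cmod d + 1)) by (field; lra).
  assert (Cmod (w - z) * (Cmod d + 1) < eps / (Cmod d + 1) * (Cmod d + 1)) by now apply Rmult_lt_compat_r.
  lra.
Qed.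

Lemma Rder_cont (g : R -> C) (t : R) (d : C) : Rder g t d -> Ccont g t.
Proof.
  intros H. apply cont_pair.
  - apply (ex_derive_continuous (K:=R_AbsRing) (V:=R_NormedModule)). eexists. apply Rder_Re, H.
  - apply (ex_derive_continuous (K:=R_AbsRing) (V:=R_NormedModule)). eexists. apply Rder_Im, H.
Qed.

Lemma cont_comp {U : UniformSpace} (f : C -> C) (g : U -> C) (x : U) :
  Ccont g x -> Ccont f (g x) -> Ccont (fun u => f (g u)) x.
Proof. intros Hg Hf. exact (continuous_comp g f x Hg Hf). Qed.

(** * Complex derivatives, Taylor's formula and the exponential *)

Lemma is_C_derive_eq (f : C -> C) (z d e : C) : is_C_derive f z d -> d = e -> is_C_derive f z e.
Proof. intros H <-; exact H. Qed.

Lemma is_C_derive_const (k z : C) : is_C_derive (fun _ => k) z 0.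
Proof. exact (@is_derive_const C_AbsRing C_NormedModule k z). Qed.

Lemma is_C_derive_plus (f g : C -> C) (z d e : C) :
  is_C_derive f z d -> is_C_derive g z e -> is_C_derive (fun w => f w + g w)%C z (d + e)%C.
Proof. exact (@is_derive_plus C_AbsRing C_NormedModule f g z d e). Qed.

Lemma is_C_derive_minus (f g : C -> C) (z d e : C) :
  is_C_derive f z d -> is_C_derive g z e -> is_C_derive (fun w => f w - g w)%C z (d - e)%C.
Proof. exact (@is_derive_minus C_AbsRing C_NormedModule f g z d e). Qed.

(** Two normed-module structures on C over itself carry the same derivative; this bridge makes the
    general rules for identity, product and composition applicable. *)
Lemma is_C_derive_abs (f : C -> C) (z d : C) :
  @is_derive C_AbsRing (AbsRing_NormedModule C_AbsRing) f z d <-> is_C_derive f z d.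
Proof.
  split; intros [_ H]; (split; [apply is_linear_scal_l|exact H]).
Qed.

Lemma is_C_derive_id (z : C) : is_C_derive (fun w => w) z 1.
Proof. apply is_C_derive_abs. exact (@is_derive_id C_AbsRing z). Qed.

Lemma is_C_derive_mult (f g : C -> C) (z d e : C) :
  is_C_derive f z d -> is_C_derive g z e ->
  is_C_derive (fun w => f w * g w)%C z (d * g z + f z * e)%C.
Proof.
  rewrite <- !is_C_derive_abs. intros Hf Hg.
  exact (@is_derive_mult C_AbsRing f g z d e Hf Hg Cmult_comm).
Qed.

Lemma is_C_derive_comp (f g : C -> C) (z d e : C) :
  is_C_derive f (g z) d -> is_C_derive g z e -> is_C_derive (fun w => f (g w)) z (d * e)%C.
Proof.
  rewrite <- (is_C_derive_abs g). intros Hf Hg.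
  eapply is_C_derive_eq; [exact (@is_derive_comp C_AbsRing C_NormedModule f g z d e Hf Hg)|].
  apply Cmult_comm.
Qed.

Lemma is_C_derive_ext_loc (f g : C -> C) (z d : C) :
  (exists del, 0 < del /\ forall w, Cmod (w - z) < del -> f w = g w) ->
  is_C_derive f z d -> is_C_derive g z d.
Proof.
  intros [del [Hd H]] Hf.
  apply (is_derive_ext_loc (K:=C_AbsRing) (V:=C_NormedModule) f g z d); [|exact Hf].
  exists (mkposreal del Hd). exact H.
Qed.

Lemma is_C_derive_ext (f g : C -> C) (z d : C) :
  (forall w, f w = g w) -> is_C_derive f z d -> is_C_derive g z d.
Proof. intros H. apply is_C_derive_ext_loc. exists 1. split; [lra|auto]. Qed.

Lemma is_C_derive_unique' (f : C -> C) (z d e : C) :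
  is_C_derive f z d -> is_C_derive f z e -> d = e.
Proof.
  intros H1 H2. rewrite <- (is_C_derive_unique f z d), <- (is_C_derive_unique f z e); auto.
Qed.

Global Opaque is_C_derive.

Lemma Cmod_lt_neq0 (a b : C) : Cmod (a - b) < Cmod b -> a <> 0%C.
Proof.
  intros H E. subst a. revert H. replace (0 - b)%C with (- b)%C by ring. rewrite Cmod_opp. lra.
Qed.

Lemma is_C_derive_Cinv (z : C) : z <> 0%C -> is_C_derive Cinv z (- / (z * z))%C.
Proof.
  intros Hz. apply is_C_derive_eps. intros eps He.
  assert (P := proj1 (Cmod_gt_0 z) Hz).
  set (m := Cmod z) in *.
  (* The remainder is exactly [(w - z)^2 / (z^2 w)], and the first bound gives [m / 2 < Cmod w]. *)
  exists (Rmin (m / 2) (eps * m ^ 3 / 2)). split.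
  { apply Rmin_pos; [lra|]. apply Rmult_lt_0_compat; [|lra]. apply Rmult_lt_0_compat; [lra|]. now apply pow_lt. }
  intros w Hw.
  assert (H1 := Rlt_le_trans _ _ _ Hw (Rmin_l _ _)).
  assert (H2 := Rlt_le_trans _ _ _ Hw (Rmin_r _ _)).
  assert (W : w <> 0%C) by (apply (Cmod_lt_neq0 w z); fold m; lra).
  assert (Q : m / 2 < Cmod w).
  { assert (T := Cmod_le_add z w). rewrite Cmod_minus_sym in T. fold m in T. lra. }
  replace (/ w - / z - - / (z * z) * (w - z))%C with ((w - z) * (w - z) * / (z * z * w))%C
    by (field; auto).
  rewrite !Cmod_mult, Cmod_inv, !Cmod_mult by (repeat apply Cmult_neq_0; auto). fold m.
  rewrite (Rmult_comm eps), Rmult_assoc. apply Rmult_le_compat_l; [apply Cmod_ge_0|].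
  apply (Rmult_le_reg_r (m * m * Cmod w)). { repeat apply Rmult_lt_0_compat; lra. }
  rewrite Rmult_assoc, Rinv_l, Rmult_1_r by (repeat apply Rmult_integral_contrapositive_currified; lra).
  assert (eps * (m * m * (m / 2)) <= eps * (m * m * Cmod w)).
  { apply Rmult_le_compat_l; [lra|]. apply Rmult_le_compat_l; [nra|lra]. }
  nra.
Qed.

Lemma is_C_derive_inv (f : C -> C) (z d : C) : f z <> 0%C ->
  is_C_derive f z d -> is_C_derive (fun w => / f w)%C z (- d / (f z * f z))%C.
Proof.
  intros Hz Hf. eapply is_C_derive_eq.
  - apply is_C_derive_comp; [apply is_C_derive_Cinv; exact Hz|exact Hf].
  - field. exact Hz.
Qed.

Lemma is_C_derive_pow (n : nat) (a z : C) :
  is_C_derive (fun w => (w - a) ^ n)%C z (INR n * (z - a) ^ pred n)%C.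
Proof.
  induction n as [|n IH].
  - eapply is_C_derive_eq; [apply (is_C_derive_const 1)|]. simpl. ring.
  - eapply is_C_derive_eq.
    + apply (is_C_derive_mult (fun w => w - a)%C (fun w => (w - a)^n)%C).
      * apply is_C_derive_minus; [apply is_C_derive_id|apply is_C_derive_const].
      * exact IH.
    + rewrite S_INR, RtoC_plus. destruct n; simpl; ring.
Qed.

(** * Finite complex sums and Taylor's formula on the unit interval *)

Fixpoint Csum (f : nat -> C) (n : nat) : C :=
  match n with O => RtoC 0 | S m => Csum f m + f m end%C.

Lemma Csum_ext (f g : nat -> C) (n : nat) :
  (forall k, (k < n)%nat -> f k = g k) -> Csum f n = Csum g n.
Proof.
  induction n as [|n IH]; intros H; [reflexivity|]. simpl.
  rewrite IH, H; [reflexivity|lia|intros; apply H; lia].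
Qed.

Lemma Csum_plus (f g : nat -> C) (n : nat) :
  Csum (fun k => f k + g k)%C n = (Csum f n + Csum g n)%C.
Proof. induction n as [|n IH]; simpl; [|rewrite IH]; ring. Qed.

Lemma Csum_minus (f g : nat -> C) (n : nat) :
  Csum (fun k => f k - g k)%C n = (Csum f n - Csum g n)%C.
Proof. induction n as [|n IH]; simpl; [|rewrite IH]; ring. Qed.

Lemma Csum_scal (a : C) (f : nat -> C) (n : nat) :
  Csum (fun k => a * f k)%C n = (a * Csum f n)%C.
Proof. induction n as [|n IH]; simpl; [|rewrite IH]; ring. Qed.

Lemma Csum_shift (f : nat -> C) (n : nat) :
  Csum f (S n) = (f 0%nat + Csum (fun k => f (S k)) n)%C.
Proof.
  induction n as [|n IH]; [simpl; ring|].
  change (Csum f (S (S n))) with (Csum f (S n) + f (S n))%C. rewrite IH. simpl. ring.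
Qed.

Lemma Csum_swap (f : nat -> nat -> C) (n m : nat) :
  Csum (fun i => Csum (fun j => f i j) m) n = Csum (fun j => Csum (fun i => f i j) n) m.
Proof.
  induction n as [|n IH]; simpl.
  - induction m as [|m IH]; simpl; [reflexivity|]. rewrite <- IH. ring.
  - rewrite IH, <- Csum_plus. reflexivity.
Qed.

Lemma Csum_0 (n : nat) : Csum (fun _ => RtoC 0) n = RtoC 0.
Proof. induction n as [|n IH]; simpl; [reflexivity|]. rewrite IH. ring. Qed.

Lemma sum_n_Csum (f : nat -> C) (n : nat) : @sum_n C_AbelianMonoid f n = Csum f (S n).
Proof.
  induction n as [|n IH].
  - rewrite sum_O. simpl. ring.
  - rewrite sum_Sn, IH. reflexivity.
Qed.

Fixpoint Rsum (f : nat -> R) (n : nat) : R :=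
  match n with O => 0 | S m => Rsum f m + f m end.

Lemma Cmod_Csum_le (f : nat -> C) (b : nat -> R) (n : nat) :
  (forall k, (k < n)%nat -> Cmod (f k) <= b k) -> Cmod (Csum f n) <= Rsum b n.
Proof.
  induction n as [|n IH]; intros H; simpl.
  - rewrite Cmod_0. lra.
  - eapply Rle_trans; [apply Cmod_triangle|]. apply Rplus_le_compat; [apply IH; intros|]; apply H; lia.
Qed.

Lemma is_C_derive_Csum (f : nat -> C -> C) (d : nat -> C) (z : C) (n : nat) :
  (forall k, (k < n)%nat -> is_C_derive (f k) z (d k)) ->
  is_C_derive (fun w => Csum (fun k => f k w) n) z (Csum d n).
Proof.
  induction n as [|n IH]; intros H; simpl.
  - apply is_C_derive_const.
  - apply is_C_derive_plus; [apply IH; intros|]; apply H; lia.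
Qed.

Lemma Rder_Csum (f : nat -> R -> C) (d : nat -> C) (t : R) (n : nat) :
  (forall k, (k < n)%nat -> Rder (f k) t (d k)) ->
  Rder (fun s => Csum (fun k => f k s) n) t (Csum d n).
Proof.
  induction n as [|n IH]; intros H; simpl.
  - apply Rder_const.
  - apply Rder_plus; [apply IH; intros|]; apply H; lia.
Qed.

(** Induction on the order: [g 0] minus its Taylor polynomial vanishes at 0, and its derivative is
    the same difference for the shifted family, hence at most [M]. The factor [1 / n!] is given
    away, because only the order of the remainder matters later. *)
Lemma taylor_aux (n : nat) : forall (g : nat -> R -> C) (M : R),
  (forall k t, 0 <= t <= 1 -> Rder (g k) t (g (S k) t)) ->
  (forall t, 0 <= t <= 1 -> Cmod (g n t) <= M) ->
  forall t, 0 <= t <= 1 ->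
    Cmod (g 0%nat t - Csum (fun k => RtoC (t ^ k / INR (fact k)) * g k 0%R) n)%C <= M.
Proof.
  induction n as [|n IH]; intros g M Hg HM t Ht.
  - simpl. replace (g 0%nat t - 0)%C with (g 0%nat t) by ring. now apply HM.
  - specialize (IH (fun k => g (S k)) M (fun k => Hg (S k)) HM).
    assert (M0 : 0 <= M) by (eapply Rle_trans; [apply Cmod_ge_0|apply (HM 0); lra]).
    pose (D := fun s => (g 0%nat s - Csum (fun k => RtoC (s ^ k / INR (fact k)) * g k 0%R) (S n))%C).
    assert (D0 : D 0 = 0%C).
    { unfold D. rewrite Csum_shift. rewrite (Csum_ext _ (fun _ => RtoC 0)).
      - rewrite Csum_0. simpl. replace (1 / 1) with 1 by field. ring.
      - intros k _. rewrite pow_ne_zero by lia. unfold Rdiv. rewrite Rmult_0_l. ring. }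
    change (Cmod (D t) <= M). replace (D t) with (D t - D 0)%C by (rewrite D0; ring).
    eapply Rle_trans.
    + apply (mean_value_C D (fun s => g 1%nat s - Csum (fun k => RtoC (s ^ k / INR (fact k)) * g (S k) 0%R) n)%C 0 t M); [lra| |].
      * intros s Hs. unfold D. apply Rder_minus; [apply Hg; lra|].
        eapply Rder_eq.
        (* The derivatives of the terms are written with the index shifted by one, so that
           [Csum_shift] removes the constant term and leaves the shifted polynomial. *)
        { apply (Rder_Csum _ (fun k => match k with O => RtoC 0 | S k => RtoC (s ^ k / INR (fact k)) * g (S k) 0%R end)%C).
          intros k _. eapply Rder_eq.
          - apply Rder_mult; [|apply Rder_const]. apply (Rder_RtoC _ s (match k with O => 0 | S k => s ^ k / INR (fact k) end)).
            destruct k as [|k]; auto_derive; auto.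
            + ring.
            + change (fact k + k * fact k)%nat with (S k * fact k)%nat.
              rewrite mult_INR. change (match k with O => 1 | S _ => INR k + 1 end) with (INR (S k)).
              field. split; [apply INR_fact_neq_0|apply not_0_INR; lia].
          - destruct k; cbv beta; ring. }
        rewrite Csum_shift. ring.
      * intros s Hs. apply IH. lra.
    + nra.
Qed.

Lemma taylor_C (n : nat) (g : nat -> R -> C) (M : R) :
  (forall k t, 0 <= t <= 1 -> Rder (g k) t (g (S k) t)) ->
  (forall t, 0 <= t <= 1 -> Cmod (g n t) <= M) ->
  Cmod (g 0%nat 1%R - Csum (fun k => RtoC (/ INR (fact k)) * g k 0%R) n)%C <= M.
Proof.
  intros Hg HM.
  rewrite (Csum_ext _ (fun k => RtoC (1 ^ k / INR (fact k)) * g k 0%R)%C).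
  - apply taylor_aux; auto; lra.
  - intros k _. rewrite pow1. unfold Rdiv. now rewrite Rmult_1_l.
Qed.

(** * The complex exponential *)

Lemma Cexp_add (a b : C) : Cexp (a + b) = (Cexp a * Cexp b)%C.
Proof.
  unfold Cexp, Cmult. rewrite re_plus, im_plus, exp_plus, cos_plus, sin_plus. simpl.
  f_equal; ring.
Qed.

Lemma Cexp_0 : Cexp 0 = 1%C.
Proof. unfold Cexp. simpl. rewrite exp_0, cos_0, sin_0. unfold RtoC. f_equal; ring. Qed.

Lemma Cmod_Cexp (a : C) : Cmod (Cexp a) = exp (Re a).
Proof.
  unfold Cmod, Cexp. simpl.
  replace (exp (Re a) * cos (Im a) * (exp (Re a) * cos (Im a) * 1) +
    exp (Re a) * sin (Im a) * (exp (Re a) * sin (Im a) * 1)) with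
    (exp (Re a) * exp (Re a) * (sin (Im a) * sin (Im a) + cos (Im a) * cos (Im a))) by ring.
  assert (E := sin2_cos2 (Im a)). unfold Rsqr in E. rewrite E, Rmult_1_r.
  apply sqrt_square. apply Rlt_le, exp_pos.
Qed.

Lemma Cexp_neq_0 (a : C) : Cexp a <> 0%C.
Proof. apply Cmod_gt_0. rewrite Cmod_Cexp. apply exp_pos. Qed.

Lemma Cexp_opp (a : C) : Cexp (- a) = (/ Cexp a)%C.
Proof.
  assert (H := Cexp_neq_0 a).
  assert (E : (Cexp a * Cexp (- a))%C = 1%C).
  { rewrite <- Cexp_add, <- Cexp_0. f_equal. ring. }
  replace (Cexp (- a)) with (/ Cexp a * (Cexp a * Cexp (- a)))%C by (field; exact H).
  rewrite E. ring.
Qed.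

Lemma Cexp_RtoC (t : R) : Cexp t = RtoC (exp t).
Proof. unfold Cexp. simpl. rewrite cos_0, sin_0. unfold RtoC. f_equal; ring. Qed.

Lemma Rder_Cexp (g : R -> C) (t : R) (v : C) :
  Rder g t v -> Rder (fun s => Cexp (g s)) t (v * Cexp (g t))%C.
Proof.
  intros H. assert (A := Rder_Re _ _ _ H). assert (B := Rder_Im _ _ _ H).
  apply Rder_pair.
  - unfold Cexp at 1. simpl. eapply is_derive_eq_R.
    + apply (is_derive_mult (K:=R_AbsRing) (fun s => exp (Re (g s))) (fun s => cos (Im (g s)))); 
        [| |exact Rmult_comm].
      * apply (is_derive_comp (K:=R_AbsRing) (V:=R_NormedModule) exp); [apply is_derive_exp|exact A].
      * apply (is_derive_comp (K:=R_AbsRing) (V:=R_NormedModule) cos); [apply is_derive_cos|exact B].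
    + unfold Cexp, Cmult, Re, Im, plus, mult, scal; simpl. unfold mult; simpl. ring.
  - unfold Cexp at 1. simpl. eapply is_derive_eq_R.
    + apply (is_derive_mult (K:=R_AbsRing) (fun s => exp (Re (g s))) (fun s => sin (Im (g s)))); 
        [| |exact Rmult_comm].
      * apply (is_derive_comp (K:=R_AbsRing) (V:=R_NormedModule) exp); [apply is_derive_exp|exact A].
      * apply (is_derive_comp (K:=R_AbsRing) (V:=R_NormedModule) sin); [apply is_derive_sin|exact B].
    + unfold Cexp, Cmult, Re, Im, plus, mult, scal; simpl. unfold mult; simpl. ring.
Qed.

Lemma Rder_Cexp_line (a h : C) (t : R) :
  Rder (fun s => Cexp (a + s * h))%C t (h * Cexp (a + t * h))%C.
Proof. apply (Rder_Cexp (fun s => a + s * h)%C). apply Rder_line. Qed.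

(** Taylor's formula along the segment from 0 to [h], on which every derivative of [Cexp (s h)] is a
    power of [h] times an exponential of modulus at most [exp (Cmod h)]. *)
Lemma Cexp_taylor (n : nat) (h : C) :
  Cmod (Cexp h - Csum (fun k => RtoC (/ INR (fact k)) * h ^ k) n)%C <= Cmod h ^ n * exp (Cmod h).
Proof.
  assert (H := taylor_C n (fun k t => h ^ k * Cexp (0 + t * h))%C (Cmod h ^ n * exp (Cmod h))).
  cbv beta in H. replace (0 + 1%R * h)%C with h in H by (unfold RtoC, Cplus, Cmult; destruct h; simpl; f_equal; ring).
  rewrite (Csum_ext _ (fun k => RtoC (/ INR (fact k)) * h ^ k)%C) in H.
  - replace (h ^ 0 * Cexp h)%C with (Cexp h) in H by (simpl; ring). apply H.
    + intros k t Ht. eapply Rder_eq.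
      * apply Rder_mult; [apply Rder_const|apply Rder_Cexp_line].
      * simpl. ring.
    + intros t Ht. rewrite Cmod_mult, Cmod_pow, Cmod_Cexp.
      apply Rmult_le_compat_l; [apply pow_le, Cmod_ge_0|].
      replace (0 + t * h)%C with (t * h)%C by ring. rewrite re_scal_l.
      destruct (Req_dec t 1) as [->|]; [rewrite Rmult_1_l|].
      * destruct (Rle_lt_or_eq_dec _ _ (Rle_trans _ _ _ (Rle_abs _) (re_le_Cmod h))) as [L| ->];
        [left; now apply exp_increasing|lra].
      * assert (t * Re h <= Cmod h).
        { assert (X := re_le_Cmod h). assert (Y := Rle_abs (Re h)).
          assert (Z := Cmod_ge_0 h). nra. }
        destruct (Rle_lt_or_eq_dec _ _ H1) as [L| ->]; [left; now apply exp_increasing|lra].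
  - intros k _. replace (0 + 0%R * h)%C with (RtoC 0) by ring. rewrite Cexp_0. ring.
Qed.

Lemma exp_le (x y : R) : x <= y -> exp x <= exp y.
Proof. intros [H| ->]; [left; now apply exp_increasing|lra]. Qed.

Lemma Cexp_taylor2 (h : C) : Cmod (Cexp h - 1 - h) <= Cmod h ^ 2 * exp (Cmod h).
Proof.
  replace (Cexp h - 1 - h)%C with (Cexp h - Csum (fun k => RtoC (/ INR (fact k)) * h ^ k) 2)%C.
  - apply Cexp_taylor.
  - simpl. rewrite Rinv_1. ring.
Qed.

Lemma Cexp_taylor1 (h : C) : Cmod (Cexp h - 1) <= Cmod h * exp (Cmod h).
Proof.
  replace (Cexp h - 1)%C with (Cexp h - Csum (fun k => RtoC (/ INR (fact k)) * h ^ k) 1)%C.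
  - eapply Rle_trans; [apply Cexp_taylor|]. simpl. lra.
  - simpl. rewrite Rinv_1. ring.
Qed.

Lemma is_C_derive_Cexp (z : C) : is_C_derive Cexp z (Cexp z).
Proof.
  apply is_C_derive_eps. intros eps He.
  assert (P : 0 < Cmod (Cexp z)) by (rewrite Cmod_Cexp; apply exp_pos).
  assert (Q : 0 < Cmod (Cexp z) * exp 1) by (apply Rmult_lt_0_compat; [exact P|apply exp_pos]).
  exists (Rmin 1 (eps / (Cmod (Cexp z) * exp 1))). split.
  { apply Rmin_pos; [lra|]. now apply Rdiv_lt_0_compat. }
  intros w Hw.
  assert (H1 := Rlt_le_trans _ _ _ Hw (Rmin_l _ _)).
  assert (H2 := Rlt_le_trans _ _ _ Hw (Rmin_r _ _)).
  set (h := (w - z)%C) in *.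
  replace (Cexp w - Cexp z - Cexp z * h)%C with (Cexp z * (Cexp h - 1 - h))%C.
  2:{ replace w with (z + h)%C by (unfold h; ring). rewrite Cexp_add. ring. }
  rewrite Cmod_mult.
  assert (H3 := Cexp_taylor2 h). assert (H4 := exp_le (Cmod h) 1 (Rlt_le _ _ H1)).
  assert (H5 := Cmod_ge_0 h). assert (H6 := pow2_ge_0 (Cmod h)).
  assert (H7 : Cmod (Cexp z) * Cmod (Cexp h - 1 - h) <= Cmod h * (Cmod h * (Cmod (Cexp z) * exp 1))).
  { replace (Cmod h * (Cmod h * (Cmod (Cexp z) * exp 1))) with (Cmod (Cexp z) * (Cmod h ^ 2 * exp 1)) by ring.
    apply Rmult_le_compat_l; [lra|]. eapply Rle_trans; [exact H3|]. now apply Rmult_le_compat_l. }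
  assert (H8 : Cmod h * (Cmod (Cexp z) * exp 1) <= eps).
  { apply Rlt_le. apply (Rmult_lt_compat_r _ _ _ Q) in H2.
    replace (eps / (Cmod (Cexp z) * exp 1) * (Cmod (Cexp z) * exp 1)) with eps in H2 by (field; split; [apply Rgt_not_eq, exp_pos|lra]).
    exact H2. }
  nra.
Qed.

(** * Limits along filters and integrals of complex-valued functions *)

(** Convergence along an arbitrary filter in epsilon form, so that the same rules serve sequences,
    rectangular double sequences and pairs of integration bounds. *)
Definition tends {T : Type} (F : (T -> Prop) -> Prop) (u : T -> C) (l : C) : Prop :=
  forall eps : R, 0 < eps -> F (fun x => Cmod (u x - l) < eps).

Lemma tends_filterlim {T : Type} (F : (T -> Prop) -> Prop) {FF : Filter F} (u : T -> C) (l : C) :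
  tends F u l <-> filterlim u F (@locally C_UniformSpace l).
Proof.
  split.
  - intros H P HP. apply locally_Cmod in HP. destruct HP as [d [Hd HP]].
    generalize (H d Hd). unfold filtermap. apply filter_imp. auto.
  - intros H eps He. apply (H (fun w => Cmod (w - l) < eps)).
    apply locally_Cmod. exists eps. auto.
Qed.

Lemma tends_ext {T : Type} (F : (T -> Prop) -> Prop) {FF : Filter F} (u v : T -> C) (l : C) :
  F (fun x => u x = v x) -> tends F u l -> tends F v l.
Proof.
  intros H Hu eps He. generalize (filter_and _ _ H (Hu eps He)). apply filter_imp.
  intros x [<- K]. exact K.
Qed.

Lemma tends_const {T : Type} (F : (T -> Prop) -> Prop) {FF : Filter F} (l : C) :
  tends F (fun _ => l) l.
Proof.
  intros eps He. apply filter_forall. intros x. replace (l - l)%C with (RtoC 0) by ring.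
  now rewrite Cmod_0.
Qed.

Lemma tends_plus {T : Type} (F : (T -> Prop) -> Prop) {FF : Filter F} (u v : T -> C) (k l : C) :
  tends F u k -> tends F v l -> tends F (fun x => u x + v x)%C (k + l)%C.
Proof.
  intros Hu Hv eps He.
  assert (He2 : 0 < eps / 2) by lra.
  generalize (filter_and _ _ (Hu _ He2) (Hv _ He2)).
  apply filter_imp. intros x [A B].
  replace (u x + v x - (k + l))%C with ((u x - k) + (v x - l))%C by ring.
  eapply Rle_lt_trans; [apply Cmod_triangle|]. lra.
Qed.

Lemma tends_scal {T : Type} (F : (T -> Prop) -> Prop) {FF : Filter F} (a : C) (u : T -> C) (l : C) :
  tends F u l -> tends F (fun x => a * u x)%C (a * l)%C.
Proof.
  intros Hu eps He. assert (K : 0 < Cmod a + 1) by (generalize (Cmod_ge_0 a); lra).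
  generalize (Hu (eps / (Cmod a + 1)) (Rdiv_lt_0_compat _ _ He K)). apply filter_imp. intros x A.
  replace (a * u x - a * l)%C with (a * (u x - l))%C by ring. rewrite Cmod_mult.
  assert (B := Cmod_ge_0 (u x - l)).
  apply (Rmult_lt_compat_r _ _ _ K) in A.
  replace (eps / (Cmod a + 1) * (Cmod a + 1)) with eps in A by (field; lra). nra.
Qed.

Lemma tends_opp {T : Type} (F : (T -> Prop) -> Prop) {FF : Filter F} (u : T -> C) (l : C) :
  tends F u l -> tends F (fun x => - u x)%C (- l)%C.
Proof.
  intros Hu eps He. generalize (Hu eps He). apply filter_imp. intros x A.
  replace (- u x - - l)%C with (- (u x - l))%C by ring. now rewrite Cmod_opp.
Qed.

Lemma tends_minus {T : Type} (F : (T -> Prop) -> Prop) {FF : Filter F} (u v : T -> C) (k l : C) :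
  tends F u k -> tends F v l -> tends F (fun x => u x - v x)%C (k - l)%C.
Proof. intros Hu Hv. unfold Cminus. apply (tends_plus F); [exact Hu|]. now apply tends_opp. Qed.

Lemma tends_Csum {T : Type} (F : (T -> Prop) -> Prop) {FF : Filter F} (u : nat -> T -> C) (l : nat -> C) (n : nat) :
  (forall k, (k < n)%nat -> tends F (u k) (l k)) ->
  tends F (fun x => Csum (fun k => u k x) n) (Csum l n).
Proof.
  induction n as [|n IH]; intros H; simpl.
  - now apply (tends_const F).
  - apply (tends_plus F); [apply IH; intros; apply H; lia|apply H; lia].
Qed.

Lemma tends_le {T : Type} (F : (T -> Prop) -> Prop) {FF : Filter F} (u : T -> C) (l : C) (b : T -> R) :
  F (fun x => Cmod (u x - l) <= b x) -> (forall eps, 0 < eps -> F (fun x => b x < eps)) ->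
  tends F u l.
Proof.
  intros H Hb eps He. generalize (filter_and _ _ H (Hb eps He)). apply filter_imp.
  intros x [A B]. lra.
Qed.

Lemma tends_bound {T : Type} (F : (T -> Prop) -> Prop) {FF : ProperFilter F} (u : T -> C) (l m : C) (b : R) :
  tends F u l -> F (fun x => Cmod (u x - m) <= b) -> Cmod (l - m) <= b.
Proof.
  intros Hu Hb. apply Rnot_lt_le. intros H.
  assert (He : 0 < Cmod (l - m) - b) by lra.
  destruct (filter_ex _ (filter_and _ _ (Hu _ He) Hb)) as [x [A B]].
  assert (K := Cmod_triangle (l - u x) (u x - m)).
  replace (l - u x + (u x - m))%C with (l - m)%C in K by ring.
  rewrite (Cmod_minus_sym l (u x)) in K. lra.
Qed.

Lemma tends_unique {T : Type} (F : (T -> Prop) -> Prop) {FF : ProperFilter F} (u : T -> C) (k l : C) :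
  tends F u k -> tends F u l -> k = l.
Proof.
  intros Hk Hl. apply Ceq_minus. apply Cmod_eq_0.
  apply Rle_antisym; [|apply Cmod_ge_0].
  apply le_epsilon. intros eps He. rewrite Rplus_0_l.
  apply (tends_bound F u k l eps Hk). generalize (Hl eps He). apply filter_imp. intros; lra.
Qed.

Lemma tends_comp {S T : Type} (F : (T -> Prop) -> Prop) (G : (S -> Prop) -> Prop)
  (g : S -> T) (u : T -> C) (l : C) :
  filterlim g G F -> tends F u l -> tends G (fun s => u (g s)) l.
Proof. intros Hg Hu eps He. exact (Hg _ (Hu eps He)). Qed.

(** Completeness with a rate: the limit inherits the Cauchy bound, and it is this bound rather than
    mere convergence that later estimates consume. *)
Lemma cauchy_C (u : nat -> C) (e : nat -> R) :
  (forall n m, (n <= m)%nat -> Cmod (u m - u n) <= e n) ->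
  (forall eps, 0 < eps -> eventually (fun n => e n < eps)) ->
  exists l, forall n, Cmod (l - u n) <= e n.
Proof.
  intros Hu He.
  assert (A : forall p : C -> R, (forall a b, Rabs (p a - p b) <= Cmod (a - b)) ->
    Cauchy_crit (fun n => p (u n))).
  { intros p Hp eps Heps. destruct (He (eps / 2) ltac:(lra)) as [N HN].
    exists N. intros n m Hn Hm. unfold Rdist.
    eapply Rle_lt_trans; [apply Hp|].
    assert (T := Cmod_triangle (u n - u N) (- (u m - u N))). rewrite Cmod_opp in T.
    replace (u n - u N + - (u m - u N))%C with (u n - u m)%C in T by ring.
    assert (Q1 := Hu N n Hn). assert (Q2 := Hu N m Hm). assert (Q3 := HN N (le_n N)). lra. }
  assert (AR : Cauchy_crit (fun n => Re (u n))).
  { apply A. intros a b. replace (Re a - Re b) with (Re (a - b)); [apply re_le_Cmod|].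
    unfold Cminus. rewrite re_plus, re_opp. ring. }
  assert (AI : Cauchy_crit (fun n => Im (u n))).
  { apply A. intros a b. replace (Im a - Im b) with (Im (a - b)); [apply im_le_Cmod|].
    unfold Cminus. rewrite im_plus, im_opp. ring. }
  destruct (Rcomplete.R_complete _ AR) as [x Hx].
  destruct (Rcomplete.R_complete _ AI) as [y Hy].
  exists ((x, y) : C). intros n. apply le_epsilon. intros eps Heps.
  assert (Heps2 : 0 < eps / 2) by lra.
  destruct (Hx _ Heps2) as [N1 H1]. destruct (Hy _ Heps2) as [N2 H2].
  pose (m := Nat.max n (Nat.max N1 N2)).
  specialize (H1 m ltac:(unfold m; lia)). specialize (H2 m ltac:(unfold m; lia)).
  assert (T := Cmod_le_add ((x, y) - u n) (u m - u n)).
  replace ((x, y) - u n - (u m - u n))%C with ((x,y) - u m)%C in T by ring.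
  assert (T2 := Cmod_le_Re_Im ((x, y) - u m)).
  unfold Cminus in T2. rewrite re_plus, im_plus, re_opp, im_opp in T2. simpl in T2.
  unfold Rdist in H1, H2. rewrite <- Rabs_Ropp in H1, H2.
  replace (- (Re (u m) - x)) with (x + - Re (u m)) in H1 by ring.
  replace (- (Im (u m) - y)) with (y + - Im (u m)) in H2 by ring.
  assert (T3 := Hu n m ltac:(unfold m; lia)). change ((x, y) + - u m)%C with ((x, y) - u m)%C in T2. lra.
Qed.

Definition Ccont_on (f : R -> C) (a b : R) : Prop := forall t, a <= t <= b -> Ccont f t.

Lemma CInt_correct (f : R -> C) (a b : R) : a <= b -> Ccont_on f a b ->
  @is_RInt C_R_NormedModule f a b (CInt f a b).
Proof.
  intros Hab H. apply (@RInt_correct C_R_CompleteNormedModule).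
  apply (@ex_RInt_continuous C_R_CompleteNormedModule).
  rewrite Rmin_left, Rmax_right by exact Hab. intros t Ht. exact (H t Ht).
Qed.

Lemma CInt_unique (f : R -> C) (a b : R) (l : C) : @is_RInt C_R_NormedModule f a b l -> CInt f a b = l.
Proof. exact (@is_RInt_unique C_R_CompleteNormedModule f a b l). Qed.

Lemma CInt_ext (f g : R -> C) (a b : R) : a <= b ->
  (forall t, a < t < b -> f t = g t) -> CInt f a b = CInt g a b.
Proof.
  intros Hab H. apply (@RInt_ext C_R_CompleteNormedModule).
  rewrite Rmin_left, Rmax_right by exact Hab. exact H.
Qed.

Lemma CInt_plus (f g : R -> C) (a b : R) : a <= b -> Ccont_on f a b -> Ccont_on g a b ->
  CInt (fun t => f t + g t)%C a b = (CInt f a b + CInt g a b)%C.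
Proof.
  intros Hab Hf Hg. apply CInt_unique.
  exact (@is_RInt_plus C_R_NormedModule f g a b _ _ (CInt_correct f a b Hab Hf) (CInt_correct g a b Hab Hg)).
Qed.

Lemma CInt_opp (f : R -> C) (a b : R) : a <= b -> Ccont_on f a b ->
  CInt (fun t => - f t)%C a b = (- CInt f a b)%C.
Proof.
  intros Hab Hf. apply CInt_unique.
  exact (@is_RInt_opp C_R_NormedModule f a b _ (CInt_correct f a b Hab Hf)).
Qed.

Lemma cont_on_opp (f : R -> C) (a b : R) : Ccont_on f a b -> Ccont_on (fun t => - f t)%C a b.
Proof. intros H t Ht. apply cont_opp. now apply H. Qed.

Lemma cont_on_plus (f g : R -> C) (a b : R) : Ccont_on f a b -> Ccont_on g a b ->
  Ccont_on (fun t => f t + g t)%C a b.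
Proof. intros H K t Ht. apply cont_plus; [now apply H|now apply K]. Qed.

Lemma cont_on_minus (f g : R -> C) (a b : R) : Ccont_on f a b -> Ccont_on g a b ->
  Ccont_on (fun t => f t - g t)%C a b.
Proof. intros H K t Ht. apply cont_minus; [now apply H|now apply K]. Qed.

Lemma cont_on_mult (f g : R -> C) (a b : R) : Ccont_on f a b -> Ccont_on g a b ->
  Ccont_on (fun t => f t * g t)%C a b.
Proof. intros H K t Ht. apply cont_mult; [now apply H|now apply K]. Qed.

Lemma cont_on_const (k : C) (a b : R) : Ccont_on (fun _ => k) a b.
Proof. intros t _. apply cont_const. Qed.

Lemma CInt_minus (f g : R -> C) (a b : R) : a <= b -> Ccont_on f a b -> Ccont_on g a b ->
  CInt (fun t => f t - g t)%C a b = (CInt f a b - CInt g a b)%C.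
Proof.
  intros Hab Hf Hg. unfold Cminus. rewrite CInt_plus, CInt_opp; auto using cont_on_opp.
Qed.

(** Multiplication by a complex constant is not the scalar multiplication of the real module in
    which the integral is taken, hence the passage to components. *)
Lemma is_RInt_scal_C (k : C) (f : R -> C) (a b : R) (l : C) :
  @is_RInt C_R_NormedModule f a b l -> @is_RInt C_R_NormedModule (fun t => k * f t)%C a b (k * l)%C.
Proof.
  intros H.
  assert (A := @is_RInt_fct_extend_fst R_NormedModule R_NormedModule f a b l H).
  assert (B := @is_RInt_fct_extend_snd R_NormedModule R_NormedModule f a b l H).
  apply (@is_RInt_fct_extend_pair R_NormedModule R_NormedModule (fun t => k * f t)%C a b (fst (k * l)%C) (snd (k * l)%C)).
  - apply (is_RInt_ext (V:=R_NormedModule) (fun t => minus (scal (fst k) (fst (f t))) (scal (snd k) (snd (f t))))).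
    { intros t _. reflexivity. }
    apply (is_RInt_minus (V:=R_NormedModule)); apply (is_RInt_scal (V:=R_NormedModule)); assumption.
  - apply (is_RInt_ext (V:=R_NormedModule) (fun t => plus (scal (fst k) (snd (f t))) (scal (snd k) (fst (f t))))).
    { intros t _. reflexivity. }
    apply (is_RInt_plus (V:=R_NormedModule)); apply (is_RInt_scal (V:=R_NormedModule)); assumption.
Qed.

Lemma CInt_scal (k : C) (f : R -> C) (a b : R) : a <= b -> Ccont_on f a b ->
  CInt (fun t => k * f t)%C a b = (k * CInt f a b)%C.
Proof. intros Hab Hf. apply CInt_unique. apply is_RInt_scal_C. now apply CInt_correct. Qed.

Lemma CInt_const (k : C) (a b : R) : CInt (fun _ => k) a b = ((b - a)%R * k)%C.
Proof.
  apply CInt_unique. rewrite <- scal_R_Cmult. exact (@is_RInt_const C_R_NormedModule a b k).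
Qed.

Lemma CInt_le (f : R -> C) (g : R -> R) (a b l : R) : a <= b -> Ccont_on f a b ->
  (forall t, a <= t <= b -> Cmod (f t) <= g t) -> is_RInt g a b l -> Cmod (CInt f a b) <= l.
Proof.
  intros Hab Hf H Hg. rewrite <- norm_Cmod.
  apply (@norm_RInt_le C_R_NormedModule f g a b _ _ Hab); [|now apply CInt_correct|exact Hg].
  intros t Ht. rewrite norm_Cmod. now apply H.
Qed.

Lemma CInt_bound (f : R -> C) (a b M : R) : a <= b -> Ccont_on f a b ->
  (forall t, a <= t <= b -> Cmod (f t) <= M) -> Cmod (CInt f a b) <= M * (b - a).
Proof.
  intros Hab Hf H. apply (CInt_le f (fun _ => M) a b _ Hab Hf H).
  rewrite Rmult_comm. exact (@is_RInt_const R_NormedModule a b M).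
Qed.

Lemma CInt_derive (g g' : R -> C) (a b : R) : a <= b ->
  (forall t, a <= t <= b -> Rder g t (g' t)) -> Ccont_on g' a b ->
  CInt g' a b = (g b - g a)%C.
Proof.
  intros Hab Hg Hc. apply CInt_unique.
  apply (@is_RInt_derive C_R_CompleteNormedModule g g' a b);
  rewrite Rmin_left, Rmax_right by exact Hab; assumption.
Qed.

Lemma CInt_Chasles (f : R -> C) (a b c : R) : a <= b <= c -> Ccont_on f a c ->
  (CInt f a b + CInt f b c)%C = CInt f a c.
Proof.
  intros H Hf. symmetry. apply CInt_unique.
  apply (@is_RInt_Chasles C_R_NormedModule f a b c); apply CInt_correct; try lra;
  intros t Ht; apply Hf; lra.
Qed.

Lemma cont_on_Csum (f : nat -> R -> C) (a b : R) (n : nat) :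
  (forall k, (k < n)%nat -> Ccont_on (f k) a b) -> Ccont_on (fun t => Csum (fun k => f k t) n) a b.
Proof.
  induction n as [|n IH]; intros H; simpl.
  - apply cont_on_const.
  - apply cont_on_plus; [apply IH; intros|]; apply H; lia.
Qed.

Lemma CInt_Csum (f : nat -> R -> C) (a b : R) (n : nat) : a <= b ->
  (forall k, (k < n)%nat -> Ccont_on (f k) a b) ->
  CInt (fun t => Csum (fun k => f k t) n) a b = Csum (fun k => CInt (f k) a b) n.
Proof.
  intros Hab. induction n as [|n IH]; intros H; simpl.
  - rewrite CInt_const. ring.
  - rewrite CInt_plus; [|exact Hab| |].
    + rewrite IH; [reflexivity|]. intros; apply H; lia.
    + apply cont_on_Csum. intros; apply H; lia.
    + apply H; lia.
Qed.

Lemma CInt_comp_lin (f : R -> C) (u v a b : R) : a <= b -> u * a + v <= u * b + v ->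
  Ccont_on f (u * a + v) (u * b + v) ->
  CInt (fun t => u * f (u * t + v)%R)%C a b = CInt f (u * a + v) (u * b + v).
Proof.
  intros Hab Huv Hf. apply CInt_unique.
  apply (is_RInt_ext (V:=C_R_NormedModule) (fun t => @scal _ C_R_NormedModule u (f (u * t + v)))).
  { intros t _. apply scal_R_Cmult. }
  apply (@is_RInt_comp_lin C_R_NormedModule f u v a b). now apply CInt_correct.
Qed.

(** * Goursat's lemma and primitives on discs *)

Definition convex_set (D : C -> Prop) : Prop :=
  forall a b t, D a -> D b -> 0 <= t <= 1 -> D (a + t * (b - a))%C.

Definition seg (f : C -> C) (a b : C) : C :=
  ((b - a) * CInt (fun t => f (a + t * (b - a))%C) 0 1)%C.

Definition tri (f : C -> C) (x : C * C * C) : C :=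
  let '(a, b, c) := x in (seg f a b + seg f b c + seg f c a)%C.

Definition perim (x : C * C * C) : R :=
  let '(a, b, c) := x in Cmod (b - a) + Cmod (c - b) + Cmod (a - c).

Lemma seg_cont_on (f : C -> C) (D : C -> Prop) (a b : C) :
  convex_set D -> (forall z, D z -> Ccont f z) -> D a -> D b ->
  Ccont_on (fun t => f (a + t * (b - a))%C) 0 1.
Proof.
  intros HD Hf Ha Hb t Ht. apply (cont_comp f).
  - eapply Rder_cont. apply Rder_line.
  - apply Hf. now apply HD.
Qed.

Lemma seg_bound (f : C -> C) (D : C -> Prop) (a b : C) (M : R) :
  convex_set D -> (forall z, D z -> Ccont f z) -> D a -> D b ->
  (forall t, 0 <= t <= 1 -> Cmod (f (a + t * (b - a))%C) <= M) ->
  Cmod (seg f a b) <= M * Cmod (b - a).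
Proof.
  intros HD Hf Ha Hb HM. unfold seg. rewrite Cmod_mult, Rmult_comm.
  apply Rmult_le_compat_r; [apply Cmod_ge_0|].
  replace M with (M * (1 - 0)) by ring. apply CInt_bound; [lra| |exact HM].
  now apply (seg_cont_on f D).
Qed.

Lemma seg_derive (F f : C -> C) (D : C -> Prop) (a b : C) :
  convex_set D -> (forall z, D z -> is_C_derive F z (f z)) -> (forall z, D z -> Ccont f z) ->
  D a -> D b -> seg f a b = (F b - F a)%C.
Proof.
  intros HD HF Hf Ha Hb. unfold seg. assert (Hc := seg_cont_on f D a b HD Hf Ha Hb).
  rewrite <- CInt_scal; [|lra|exact Hc].
  rewrite (CInt_derive (fun t => F (a + t * (b - a))%C)); [|lra| |].
  - replace (a + 1%R * (b - a))%C with b by ring. replace (a + 0%R * (b - a))%C with a by ring. reflexivity.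
  - intros t Ht. eapply Rder_eq.
    + apply (Rder_comp F); [apply HF, HD; auto|]. apply Rder_line.
    + cbv beta; ring.
  - apply cont_on_mult; [apply cont_on_const|exact Hc].
Qed.

Lemma seg_minus (f g : C -> C) (D : C -> Prop) (a b : C) :
  convex_set D -> (forall z, D z -> Ccont f z) -> (forall z, D z -> Ccont g z) -> D a -> D b ->
  seg (fun z => f z - g z)%C a b = (seg f a b - seg g a b)%C.
Proof.
  intros HD Hf Hg Ha Hb. unfold seg.
  rewrite (CInt_minus (fun t => f (a + t * (b - a))%C) (fun t => g (a + t * (b - a))%C));
    [ring|lra| |]; now apply (seg_cont_on _ D).
Qed.

Lemma seg_mid (f : C -> C) (D : C -> Prop) (a b : C) :
  convex_set D -> (forall z, D z -> Ccont f z) -> D a -> D b ->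
  seg f a b = (seg f a ((a + b) / 2) + seg f ((a + b) / 2) b)%C.
Proof.
  intros HD Hf Ha Hb. assert (Hc := seg_cont_on f D a b HD Hf Ha Hb). unfold seg.
  set (h := fun t : R => f (a + t * (b - a))%C) in *.
  rewrite <- (CInt_Chasles h 0 (1/2) 1); [|lra|exact Hc].
  assert (E1 := CInt_comp_lin h (1/2) 0 0 1).
  replace (1 / 2 * 0 + 0) with 0 in E1 by field. replace (1 / 2 * 1 + 0) with (1/2) in E1 by field.
  assert (E2 := CInt_comp_lin h (1/2) (1/2) 0 1).
  replace (1 / 2 * 0 + 1 / 2) with (1/2) in E2 by field. replace (1 / 2 * 1 + 1/2) with 1 in E2 by field.
  rewrite <- E1, <- E2; try lra; try (intros t Ht; apply Hc; lra).
  rewrite !CInt_scal; try lra.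
  - rewrite (CInt_ext (fun t => h (1/2 * t + 0)) (fun t => f (a + t * ((a + b) / 2 - a))%C)); [|lra|].
    + rewrite (CInt_ext (fun t => h (1/2 * t + 1/2)) (fun t => f ((a + b)/2 + t * (b - (a + b) / 2))%C)); [|lra|].
      * rewrite RtoC_div by lra. field.
      * intros t _. unfold h. f_equal. rewrite RtoC_plus, RtoC_mult, RtoC_div by lra. field.
    + intros t _. unfold h. f_equal. rewrite RtoC_plus, RtoC_mult, RtoC_div by lra. field.
  - intros t Ht. apply (continuous_comp (fun t => 1/2 * t + 1/2) h).
    + apply (continuous_plus (V:=R_NormedModule)); [|apply continuous_const].
      apply (continuous_mult (K:=R_AbsRing)); [apply continuous_const|apply continuous_id].
    + apply Hc. lra.
  - intros t Ht. apply (continuous_comp (fun t => 1/2 * t + 0) h).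
    + apply (continuous_plus (V:=R_NormedModule)); [|apply continuous_const].
      apply (continuous_mult (K:=R_AbsRing)); [apply continuous_const|apply continuous_id].
    + apply Hc. lra.
Qed.

Lemma seg_rev (f : C -> C) (D : C -> Prop) (a b : C) :
  convex_set D -> (forall z, D z -> Ccont f z) -> D a -> D b ->
  seg f b a = (- seg f a b)%C.
Proof.
  intros HD Hf Ha Hb. assert (Hc := seg_cont_on f D a b HD Hf Ha Hb). unfold seg.
  set (h := fun t : R => f (a + t * (b - a))%C) in *.
  replace (CInt (fun t => f (b + t * (a - b))%C) 0 1) with (CInt h 0 1); [ring|].
  symmetry. apply CInt_unique.
  assert (E := CInt_correct h 0 1 ltac:(lra) Hc).
  apply is_RInt_swap in E.
  replace 1 with (-1 * 0 + 1) in E at 1 by ring. replace 0 with (-1 * 1 + 1) in E at 2 by ring.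
  apply is_RInt_comp_lin in E.
  apply (@is_RInt_opp C_R_NormedModule) in E.
  replace (CInt h 0 1) with (@opp C_R_NormedModule (opp (CInt h 0 1))).
  - eapply (is_RInt_ext (V:=C_R_NormedModule)); [|exact E].
    intros t _. cbv beta. rewrite scal_R_Cmult. unfold h. simpl.
    replace (a + (-1 * t + 1)%R * (b - a))%C with (b + t * (a - b))%C.
    + change (- (RtoC (-1) * f (b + t * (a - b))) = f (b + t * (a - b)))%C.
      replace (RtoC (-1)) with (- (1))%C by (rewrite <- RtoC_opp; f_equal; ring). ring.
    + rewrite RtoC_plus, RtoC_mult. replace (RtoC (-1)) with (- (1))%C by (rewrite <- RtoC_opp; f_equal; ring). ring.
  - exact (@opp_opp C_R_NormedModule (CInt h 0 1)).
Qed.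

(** Goursat's subdivision: all four half-size triangles are oriented like the original, so that the
    inner edges cancel in [tri_split]. *)
Definition subtri (k : nat) (x : C * C * C) : C * C * C :=
  let '(a, b, c) := x in
  let m1 := ((a + b) / 2)%C in let m2 := ((b + c) / 2)%C in let m3 := ((c + a) / 2)%C in
  match k with 0 => (a, m1, m3) | 1 => (m1, b, m2) | 2 => (m3, m2, c) | _ => (m1, m2, m3) end%nat.

Definition tri_in (D : C -> Prop) (x : C * C * C) : Prop :=
  let '(a, b, c) := x in D a /\ D b /\ D c.

Lemma convex_mid (D : C -> Prop) (a b : C) : convex_set D -> D a -> D b -> D ((a + b) / 2)%C.
Proof.
  intros HD Ha Hb. replace ((a + b) / 2)%C with (a + (1/2)%R * (b - a))%C.
  - apply HD; auto; lra.
  - rewrite RtoC_div by lra. field.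
Qed.

Lemma subtri_in (D : C -> Prop) (k : nat) (x : C * C * C) :
  convex_set D -> tri_in D x -> tri_in D (subtri k x).
Proof.
  intros HD. destruct x as [[a b] c]. intros [Ha [Hb Hc]].
  destruct k as [|[|[|k]]]; simpl; (split; [|split]); try assumption; apply convex_mid; assumption.
Qed.

Lemma tri_split (f : C -> C) (D : C -> Prop) (x : C * C * C) :
  convex_set D -> (forall z, D z -> Ccont f z) -> tri_in D x ->
  tri f x = (tri f (subtri 0 x) + tri f (subtri 1 x) + tri f (subtri 2 x) + tri f (subtri 3 x))%C.
Proof.
  intros HD Hf. destruct x as [[a b] c]. intros [Ha [Hb Hc]]. simpl.
  assert (H1 := convex_mid D a b HD Ha Hb). assert (H2 := convex_mid D b c HD Hb Hc).
  assert (H3 := convex_mid D c a HD Hc Ha).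
  rewrite (seg_mid f D a b), (seg_mid f D b c), (seg_mid f D c a) by auto.
  rewrite (seg_rev f D ((a + b) / 2) ((b + c) / 2)), (seg_rev f D ((b + c) / 2) ((c + a) / 2)),
   (seg_rev f D ((c + a) / 2) ((a + b) / 2)) by auto.
  ring.
Qed.

Lemma Cmod_half (a : C) : Cmod (a / 2) = Cmod a / 2.
Proof. rewrite Cmod_div by (intros E; apply RtoC_inj in E; lra). rewrite Cmod_R, Rabs_pos_eq by lra. reflexivity. Qed.

Lemma subtri_perim (k : nat) (x : C * C * C) : perim (subtri k x) = perim x / 2.
Proof.
  destruct x as [[a b] c].
  destruct k as [|[|[|k]]]; simpl.
  - replace ((a + b) / 2 - a)%C with ((b - a) / 2)%C by field.
    replace ((c + a) / 2 - (a + b) / 2)%C with ((c - b) / 2)%C by field.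
    replace (a - (c + a) / 2)%C with ((a - c) / 2)%C by field.
    rewrite !Cmod_half. field.
  - replace (b - (a + b) / 2)%C with ((b - a) / 2)%C by field.
    replace ((b + c) / 2 - b)%C with ((c - b) / 2)%C by field.
    replace ((a + b) / 2 - (b + c) / 2)%C with ((a - c) / 2)%C by field.
    rewrite !Cmod_half. field.
  - replace ((b + c) / 2 - (c + a) / 2)%C with ((b - a) / 2)%C by field.
    replace (c - (b + c) / 2)%C with ((c - b) / 2)%C by field.
    replace ((c + a) / 2 - c)%C with ((a - c) / 2)%C by field.
    rewrite !Cmod_half. field.
  - replace ((b + c) / 2 - (a + b) / 2)%C with ((c - a) / 2)%C by field.
    replace ((c + a) / 2 - (b + c) / 2)%C with ((a - b) / 2)%C by field.
    replace ((a + b) / 2 - (c + a) / 2)%C with ((b - c) / 2)%C by field.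
    rewrite !Cmod_half, (Cmod_minus_sym c a), (Cmod_minus_sym a b), (Cmod_minus_sym b c). field.
Qed.

Definition vtx (x : C * C * C) : C := fst (fst x).

Lemma subtri_vtx (k : nat) (x : C * C * C) : Cmod (vtx (subtri k x) - vtx x) <= perim x / 2.
Proof.
  destruct x as [[a b] c].
  assert (A := Cmod_ge_0 (b - a)). assert (B := Cmod_ge_0 (c - b)). assert (G := Cmod_ge_0 (a - c)).
  destruct k as [|[|[|k]]]; unfold vtx; simpl.
  - replace (a - a)%C with (RtoC 0) by ring. rewrite Cmod_0. lra.
  - replace ((a + b) / 2 - a)%C with ((b - a) / 2)%C by field. rewrite Cmod_half. lra.
  - replace ((c + a) / 2 - a)%C with ((c - a) / 2)%C by field.
    rewrite Cmod_half, (Cmod_minus_sym c a). lra.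
  - replace ((a + b) / 2 - a)%C with ((b - a) / 2)%C by field. rewrite Cmod_half. lra.
Qed.

Definition pick (f : C -> C) (x : C * C * C) : nat :=
  if Rle_dec (Cmod (tri f x)) (4 * Cmod (tri f (subtri 0 x))) then 0%nat else
  if Rle_dec (Cmod (tri f x)) (4 * Cmod (tri f (subtri 1 x))) then 1%nat else
  if Rle_dec (Cmod (tri f x)) (4 * Cmod (tri f (subtri 2 x))) then 2%nat else 3%nat.

Lemma pick_le (f : C -> C) (D : C -> Prop) (x : C * C * C) :
  convex_set D -> (forall z, D z -> Ccont f z) -> tri_in D x ->
  Cmod (tri f x) <= 4 * Cmod (tri f (subtri (pick f x) x)).
Proof.
  intros HD Hf Hx. unfold pick. repeat destruct Rle_dec; auto.
  assert (E := tri_split f D x HD Hf Hx).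
  assert (T1 := Cmod_triangle (tri f (subtri 0 x) + tri f (subtri 1 x) + tri f (subtri 2 x)) (tri f (subtri 3 x))).
  assert (T2 := Cmod_triangle (tri f (subtri 0 x) + tri f (subtri 1 x)) (tri f (subtri 2 x))).
  assert (T3 := Cmod_triangle (tri f (subtri 0 x)) (tri f (subtri 1 x))).
  rewrite <- E in T1. lra.
Qed.

Fixpoint nested (f : C -> C) (x : C * C * C) (n : nat) : C * C * C :=
  match n with O => x | S m => subtri (pick f (nested f x m)) (nested f x m) end.

Lemma pow_half_small (K eps : R) : 0 < eps -> eventually (fun n => K * (/ 2) ^ n < eps).
Proof.
  intros He. destruct (pow_lt_1_zero (/ 2)) with (y := eps / (Rabs K + 1)) as [N HN].
  - rewrite Rabs_pos_eq; lra.
  - apply Rdiv_lt_0_compat; [lra|]. generalize (Rabs_pos K); lra.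
  - exists N. intros n Hn. specialize (HN n Hn).
    assert (P : 0 < (/ 2) ^ n) by (apply pow_lt; lra).
    rewrite Rabs_pos_eq in HN by lra.
    assert (A := Rle_abs K). assert (B := Rabs_pos K).
    assert (HN' : (/ 2) ^ n * (Rabs K + 1) < eps / (Rabs K + 1) * (Rabs K + 1)) by (apply Rmult_lt_compat_r; lra).
    replace (eps / (Rabs K + 1) * (Rabs K + 1)) with eps in HN' by (field; lra). nra.
Qed.

Definition disc (p : C) (r : R) (z : C) : Prop := Cmod (z - p) < r.

Lemma segment_ball (p a b : C) (t r : R) : Cmod (a - p) <= r -> Cmod (b - p) <= r -> 0 <= t <= 1 ->
  Cmod (a + t * (b - a) - p) <= r.
Proof.
  intros Ha Hb Ht.
  replace (a + t * (b - a) - p)%C with ((1 - t)%R * (a - p) + t * (b - p))%C by (rewrite RtoC_minus; ring).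
  eapply Rle_trans; [apply Cmod_triangle|]. rewrite !Cmod_mult, !Cmod_R, !Rabs_pos_eq by lra. nra.
Qed.

Lemma disc_convex (p : C) (r : R) : convex_set (disc p r).
Proof.
  intros a b t Ha Hb Ht. unfold disc in *.
  apply Rle_lt_trans with (Rmax (Cmod (a - p)) (Cmod (b - p))).
  - apply segment_ball; [apply Rmax_l|apply Rmax_r|exact Ht].
  - now apply Rmax_lub_lt.
Qed.

Lemma cball_convex (p : C) (r : R) : convex_set (fun z => Cmod (z - p) <= r).
Proof. intros a b t Ha Hb Ht. now apply segment_ball. Qed.

Lemma goursat (f : C -> C) (p : C) (r : R) (x : C * C * C) :
  (forall z, disc p r z -> C_derivable f z) -> tri_in (disc p r) x -> tri f x = 0%C.
Proof.
  intros Hf Hx.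
  assert (Hc : forall z, disc p r z -> Ccont f z).
  { intros z Hz. destruct (Hf z Hz) as [d Hd]. exact (is_C_derive_cont f z d Hd). }
  (* The nested triangles will shrink to a limit point, which must lie in the open disc; keeping all
     vertices in a smaller closed ball ensures it. *)
  assert (Hr : exists r', r' < r /\ tri_in (fun z => Cmod (z - p) <= r') x).
  { destruct x as [[a b] c]. destruct Hx as [Ha [Hb Hc']].
    exists (Rmax (Cmod (a - p)) (Rmax (Cmod (b - p)) (Cmod (c - p)))). split.
    - repeat apply Rmax_lub_lt; assumption.
    - repeat split.
      + apply Rmax_l.
      + eapply Rle_trans; [|apply Rmax_r]. apply Rmax_l.
      + eapply Rle_trans; [|apply Rmax_r]. apply Rmax_r. }
  destruct Hr as [r' [Hr' Hx']].
  pose (X := nested f x).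
  assert (P0 : 0 <= perim x).
  { destruct x as [[a b] c]. simpl. generalize (Cmod_ge_0 (b - a)) (Cmod_ge_0 (c - b)) (Cmod_ge_0 (a - c)). lra. }
  assert (X1 : forall n, tri_in (disc p r) (X n)).
  { induction n as [|n IH]; [exact Hx|]. apply subtri_in; [apply disc_convex|exact IH]. }
  assert (X2 : forall n, tri_in (fun z => Cmod (z - p) <= r') (X n)).
  { induction n as [|n IH]; [exact Hx'|]. apply subtri_in; [apply cball_convex|exact IH]. }
  assert (X3 : forall n, perim (X n) = perim x * (/ 2) ^ n).
  { induction n as [|n IH].
    - change (X 0%nat) with x. rewrite pow_O. ring.
    - change (X (S n)) with (subtri (pick f (X n)) (X n)). rewrite subtri_perim, IH, <- tech_pow_Rmult. field. }
  assert (X4 : forall n, Cmod (tri f x) <= 4 ^ n * Cmod (tri f (X n))).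
  { induction n as [|n IH]; [change (X 0%nat) with x; rewrite pow_O; lra|].
    change (X (S n)) with (subtri (pick f (X n)) (X n)).
    eapply Rle_trans; [exact IH|]. rewrite <- tech_pow_Rmult, (Rmult_comm 4), Rmult_assoc.
    apply Rmult_le_compat_l; [apply pow_le; lra|]. apply (pick_le f (disc p r)); auto using disc_convex. }
  (* The factor [1 - (/ 2) ^ k] is the partial geometric sum of the displacements of the first
     vertex; a bound without it would not be inductive. *)
  assert (X5 : forall n k, Cmod (vtx (X (n + k)%nat) - vtx (X n)) <= perim x * (/ 2) ^ n * (1 - (/ 2) ^ k)).
  { intros n k. induction k as [|k IH].
    - rewrite Nat.add_0_r. replace (vtx (X n) - vtx (X n))%C with (RtoC 0) by ring. rewrite Cmod_0. simpl. lra.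
    - rewrite Nat.add_succ_r.
      replace (vtx (X (S (n + k))) - vtx (X n))%C with
        ((vtx (X (S (n + k))) - vtx (X (n + k)%nat)) + (vtx (X (n + k)%nat) - vtx (X n)))%C by ring.
      eapply Rle_trans; [apply Cmod_triangle|].
      assert (S1 : Cmod (vtx (X (S (n + k))) - vtx (X (n + k)%nat)) <= perim (X (n + k)%nat) / 2) by apply subtri_vtx.
      rewrite X3, pow_add in S1. simpl. lra. }
  destruct (cauchy_C (fun n => vtx (X n)) (fun n => perim x * (/ 2) ^ n)) as [q Hq].
  { intros n m Hnm. replace m with (n + (m - n))%nat by lia.
    eapply Rle_trans; [apply X5|].
    assert (0 < (/ 2) ^ (m - n)) by (apply pow_lt; lra).
    assert (0 < (/ 2) ^ n) by (apply pow_lt; lra).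
    assert (0 <= perim x * (/ 2) ^ n) by (apply Rmult_le_pos; lra). nra. }
  { intros eps He. now apply pow_half_small. }
  assert (Hqp : disc p r q).
  { unfold disc. apply Rle_lt_trans with r'; [|exact Hr'].
    apply le_epsilon. intros eps He. destruct (pow_half_small (perim x) eps He) as [N HN].
    specialize (HN N (le_n N)). specialize (Hq N).
    assert (A : Cmod (vtx (X N) - p) <= r').
    { specialize (X2 N). destruct (X N) as [[a b] c]. apply X2. }
    replace (q - p)%C with ((q - vtx (X N)) + (vtx (X N) - p))%C by ring.
    eapply Rle_trans; [apply Cmod_triangle|]. lra. }
  destruct (Hf q Hqp) as [d Hd]. change (is_C_derive f q d) in Hd.
  apply Cmod_eq_0. apply Rle_antisym; [|apply Cmod_ge_0].
  apply le_epsilon. intros eps0 He0. rewrite Rplus_0_l.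
  (* The factor [4 ^ n] lost by subdividing is regained from two factors [(/ 2) ^ n], the diameter
     and the perimeter; what is left is [2 eps] times the squared perimeter. The [+ 1] covers a
     triangle degenerated to a point. *)
  pose (eps := eps0 / (2 * (perim x * perim x) + 1)).
  assert (Hpp : 0 <= perim x * perim x) by (apply Rmult_le_pos; lra).
  assert (He : 0 < eps) by (apply Rdiv_lt_0_compat; lra).
  destruct (proj1 (is_C_derive_eps f q d) Hd eps He) as [del [Hdel K]].
  destruct (pow_half_small (2 * perim x) del Hdel) as [n Hn].
  specialize (Hn n (le_n n)). specialize (Hq n).
  (* The affine part of [f] at [q] has a primitive and integrates to 0 over every triangle; only the
     remainder, of size [eps] times the distance to [q], is left. *)
  pose (g := fun z => (f q + d * (z - q))%C).
  assert (Hg : forall z : C, is_C_derive g z d).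
  { intros z. unfold g. eapply is_C_derive_eq.
    - apply is_C_derive_plus; [apply is_C_derive_const|].
      apply (is_C_derive_mult (fun _ => d) (fun z => z - q)%C); [apply is_C_derive_const|].
      apply is_C_derive_minus; [apply is_C_derive_id|apply is_C_derive_const].
    - cbv beta; ring. }
  assert (Hgc : forall z, disc p r z -> Ccont g z).
  { intros z _. exact (is_C_derive_cont g z d (Hg z)). }
  assert (G0 : tri g (X n) = 0%C).
  { specialize (X1 n). destruct (X n) as [[a b] c]. destruct X1 as [Ha [Hb Hc']]. simpl.
    pose (G := fun z => (f q * z + d * ((z - q) ^ 2 / 2))%C).
    assert (HG : forall z, disc p r z -> is_C_derive G z (g z)).
    { intros z _. unfold G, g. eapply is_C_derive_eq.
      - apply is_C_derive_plus.
        + apply (is_C_derive_mult (fun _ => f q) (fun z => z)); [apply is_C_derive_const|apply is_C_derive_id].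
        + apply (is_C_derive_mult (fun _ => d) (fun z => (z - q)^2 / 2)%C); [apply is_C_derive_const|].
          apply (is_C_derive_mult (fun z => (z - q)^2)%C (fun _ => / 2)%C); [apply is_C_derive_pow|apply is_C_derive_const].
      - simpl. rewrite RtoC_plus. field. }
    rewrite !(seg_derive G g (disc p r)) by auto using disc_convex. ring. }
  assert (B : Cmod (tri f (X n)) <= eps * (2 * perim x * (/ 2) ^ n) * perim (X n)).
  { assert (Pn : perim (X n) = perim x * (/ 2) ^ n) by apply X3.
    specialize (X1 n). revert G0 X1 Hq Pn. destruct (X n) as [[a b] c].
    intros G0 [Ha [Hb Hc']] Hq Pn. unfold vtx in Hq. simpl in Hq, Pn, G0.
    assert (CV := disc_convex p r).
    assert (Hd' : forall z, disc p r z -> Ccont (fun w => f w - g w)%C z).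
    { intros z Hz. apply cont_minus; auto. }
    assert (E : tri f (a, b, c) = (seg (fun z => f z - g z) a b + seg (fun z => f z - g z) b c + seg (fun z => f z - g z) c a)%C).
    { simpl. rewrite !(seg_minus f g (disc p r)) by auto.
      replace (seg f a b - seg g a b + (seg f b c - seg g b c) + (seg f c a - seg g c a))%C
       with (seg f a b + seg f b c + seg f c a - (seg g a b + seg g b c + seg g c a))%C by ring.
      rewrite G0. ring. }
    rewrite E. clear E.
    assert (S1 := Cmod_ge_0 (b - a)). assert (S2 := Cmod_ge_0 (c - b)). assert (S3 := Cmod_ge_0 (a - c)).
    assert (Va : Cmod (a - q) <= 2 * perim x * (/ 2) ^ n) by (rewrite (Cmod_minus_sym a q); lra).
    assert (Vb : Cmod (b - q) <= 2 * perim x * (/ 2) ^ n).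
    { replace (b - q)%C with ((b - a) + (a - q))%C by ring. eapply Rle_trans; [apply Cmod_triangle|].
      rewrite (Cmod_minus_sym a q). lra. }
    assert (Vc : Cmod (c - q) <= 2 * perim x * (/ 2) ^ n).
    { replace (c - q)%C with ((c - a) + (a - q))%C by ring. eapply Rle_trans; [apply Cmod_triangle|].
      rewrite (Cmod_minus_sym a q), (Cmod_minus_sym c a). lra. }
    assert (Kb : forall u v t, Cmod (u - q) <= 2 * perim x * (/ 2) ^ n -> Cmod (v - q) <= 2 * perim x * (/ 2) ^ n ->
       0 <= t <= 1 -> Cmod (f (u + t * (v - u)) - g (u + t * (v - u)))%C <= eps * (2 * perim x * (/ 2) ^ n)).
    { intros u v t Hu Hv Ht. assert (L := segment_ball q u v t _ Hu Hv Ht).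
      unfold g.
      replace (f (u + t * (v - u)) - (f q + d * (u + t * (v - u) - q)))%C with
        (f (u + t * (v - u)) - f q - d * (u + t * (v - u) - q))%C by ring.
      eapply Rle_trans; [apply K; lra|]. apply Rmult_le_compat_l; lra. }
    change (perim (a, b, c)) with (Cmod (b - a) + Cmod (c - b) + Cmod (a - c)).
    rewrite !Rmult_plus_distr_l.
    eapply Rle_trans; [apply Cmod_triangle|]. apply Rplus_le_compat.
    - eapply Rle_trans; [apply Cmod_triangle|]. apply Rplus_le_compat;
      apply (seg_bound _ (disc p r)); auto.
    - apply (seg_bound _ (disc p r)); auto. }
  eapply Rle_trans; [apply (X4 n)|].
  eapply Rle_trans; [apply Rmult_le_compat_l; [apply pow_le; lra|exact B]|].
  rewrite X3.
  replace (4 ^ n * (eps * (2 * perim x * (/ 2) ^ n) * (perim x * (/ 2) ^ n)))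
    with (eps * (2 * (perim x * perim x)) * (4 * (/ 2 * / 2)) ^ n) by (rewrite !Rpow_mult_distr; ring).
  replace (4 * (/ 2 * / 2)) with 1 by field. rewrite pow1, Rmult_1_r.
  replace eps0 with (eps * (2 * (perim x * perim x) + 1)) by (unfold eps; field; lra).
  apply Rmult_le_compat_l; lra.
Qed.

(** The integral from the centre is a primitive: by Goursat on the triangle [p], [z], [w] its
    increment is the integral over the segment from [z] to [w], which continuity compares with
    [f z * (w - z)]. *)
Lemma primitive_disc (f : C -> C) (p : C) (r : R) :
  (forall z, disc p r z -> C_derivable f z) ->
  exists F, forall z, disc p r z -> is_C_derive F z (f z).
Proof.
  intros Hf. exists (seg f p). intros z Hz.
  assert (Hc : forall z, disc p r z -> Ccont f z).
  { intros w Hw. destruct (Hf w Hw) as [d Hd]. exact (is_C_derive_cont f w d Hd). }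
  assert (CV := disc_convex p r).
  assert (Hp : disc p r p).
  { unfold disc in *. replace (p - p)%C with (RtoC 0) by ring. rewrite Cmod_0.
    eapply Rle_lt_trans; [apply Cmod_ge_0|exact Hz]. }
  apply is_C_derive_eps. intros eps He.
  destruct (proj1 (cont_eps_iff f z) (Hc z Hz) eps He) as [del [Hdel K]].
  exists (Rmin del (r - Cmod (z - p))). split; [apply Rmin_pos; [exact Hdel|unfold disc in Hz; lra]|].
  intros w Hw.
  assert (H1 := Rlt_le_trans _ _ _ Hw (Rmin_l _ _)).
  assert (H2 := Rlt_le_trans _ _ _ Hw (Rmin_r _ _)).
  assert (Hw' : disc p r w).
  { unfold disc. replace (w - p)%C with ((w - z) + (z - p))%C by ring.
    eapply Rle_lt_trans; [apply Cmod_triangle|]. lra. }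
  assert (G := goursat f p r (p, z, w) Hf (conj Hp (conj Hz Hw'))). simpl in G.
  rewrite (seg_rev f (disc p r) p w) in G by auto.
  assert (E : (seg f p w - seg f p z)%C = seg f z w).
  { apply Ceq_minus. replace (seg f p w - seg f p z - seg f z w)%C with
     (- (seg f p z + seg f z w + - seg f p w))%C by ring. rewrite G. ring. }
  rewrite E.
  assert (E2 : (f z * (w - z))%C = seg (fun _ => f z) z w).
  { unfold seg. rewrite CInt_const. rewrite Rminus_0_r. ring. }
  rewrite E2, <- (seg_minus f (fun _ => f z) (disc p r)); auto; [|intros; apply cont_const].
  apply (seg_bound _ (disc p r)); auto.
  - intros u Hu. apply cont_minus; [now apply Hc|apply cont_const].
  - intros t Ht. apply Rlt_le, K. eapply Rle_lt_trans; [|exact H1].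
    replace (z + t * (w - z) - z)%C with (t * (w - z))%C by ring.
    rewrite Cmod_mult, Cmod_R, Rabs_pos_eq by lra. assert (T := Cmod_ge_0 (w - z)). nra.
Qed.

(** * Cauchy's formula on circles *)

Definition slope (F f : C -> C) (z w : C) : C :=
  if Ceq_dec w z then f z else ((F w - F z) / (w - z))%C.

(* A primitive [F] of a derivable [f] has a second-order expansion at [z], so its slope at [z] is derivable at [z]
   too, and Goursat's lemma applies to it without an exceptional point. *)
Lemma slope_derivable (F f : C -> C) (p : C) (R0 : R) (z w : C) :
  (forall v, disc p R0 v -> is_C_derive F v (f v)) -> (forall v, disc p R0 v -> C_derivable f v) ->
  disc p R0 z -> disc p R0 w -> C_derivable (slope F f z) w.
Proof.
  intros HF Hf Hz Hw.
  destruct (Ceq_dec w z) as [->|Hne].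
  - destruct (Hf z Hz) as [d Hd]. change (is_C_derive f z d) in Hd.
    exists (d / 2)%C. change (is_C_derive (slope F f z) z (d / 2)).
    apply is_C_derive_eps. intros eps He.
    destruct (proj1 (is_C_derive_eps f z d) Hd eps He) as [del [Hdel K]].
    exists (Rmin del (R0 - Cmod (z - p))). split; [apply Rmin_pos; [exact Hdel|unfold disc in Hz; lra]|].
    intros v Hv.
    assert (H1 := Rlt_le_trans _ _ _ Hv (Rmin_l _ _)).
    assert (H2 := Rlt_le_trans _ _ _ Hv (Rmin_r _ _)).
    unfold slope at 2. destruct (Ceq_dec z z) as [_|N]; [|now contradiction N].
    unfold slope. destruct (Ceq_dec v z) as [->|Hv0].
    { replace (f z - f z - d / 2 * (z - z))%C with (RtoC 0) by (field).
      rewrite Cmod_0. apply Rmult_le_pos; [lra|apply Cmod_ge_0]. }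
    set (h := (v - z)%C) in *.
    assert (Hh : h <> 0%C) by (now apply Cminus_eq_contra).
    (* [D] is [F] along the segment without its first and second order terms, so its derivative
       [(f (z + t h) - f z - d t h) h] is at most [eps * Cmod h ^ 2]. Dividing by [h] gives the
       first-order expansion of the slope, with derivative [d / 2]. *)
    pose (D := fun t : R => (F (z + t * h) - t * (f z * h) - RtoC (t * t / 2) * (d * (h * h)))%C).
    assert (B : Cmod (D 1 - D 0) <= eps * Cmod h * Cmod h).
    { replace (eps * Cmod h * Cmod h) with (eps * Cmod h * Cmod h * (1 - 0)) by ring.
      apply (mean_value_C D (fun t => (f (z + t * h) - f z - d * (z + t * h - z)) * h)%C); [lra| |].
      - intros t Ht. unfold D. eapply Rder_eq.
        + apply Rder_minus; [apply Rder_minus|].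
          * apply (Rder_comp F); [|apply Rder_line]. apply HF. unfold disc.
            replace (z + t * h - p)%C with (t * h + (z - p))%C by ring.
            eapply Rle_lt_trans; [apply Cmod_triangle|]. rewrite Cmod_mult, Cmod_R, Rabs_pos_eq by lra.
            assert (G := Cmod_ge_0 h). nra.
          * apply Rder_mult; [apply Rder_id|apply Rder_const].
          * apply Rder_mult; [|apply Rder_const]. apply (Rder_RtoC _ _ t). auto_derive; [auto|field].
        + cbv beta. ring.
      - intros t Ht. rewrite Cmod_mult. apply Rmult_le_compat_r; [apply Cmod_ge_0|].
        assert (E : Cmod (z + t * h - z) = t * Cmod h).
        { replace (z + t * h - z)%C with (t * h)%C by ring. rewrite Cmod_mult, Cmod_R, Rabs_pos_eq by lra. reflexivity. }
        assert (G := Cmod_ge_0 h).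
        assert (G2 : t * Cmod h <= Cmod h) by nra.
        eapply Rle_trans; [apply K|]; rewrite E; [lra|]. apply Rmult_le_compat_l; lra. }
    apply (Rmult_le_reg_r (Cmod h)); [now apply Cmod_gt_0|].
    rewrite <- Cmod_mult.
    replace (((F v - F z) / h - f z - d / 2 * h) * h)%C with (D 1 - D 0)%C; [exact B|].
    unfold D. replace (z + 1%R * h)%C with v by (unfold h; ring). replace (z + 0%R * h)%C with z by ring.
    replace (1 * 1 / 2) with (/ 2) by field. replace (0 * 0 / 2) with 0 by field.
    rewrite RtoC_inv by lra. field. exact Hh.
  - destruct (Hf z Hz) as [d Hd].
    exists ((f w * (w - z) - (F w - F z)) / ((w - z) * (w - z)))%C. change (is_C_derive (slope F f z) w ((f w * (w - z) - (F w - F z)) / ((w - z) * (w - z)))).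
    apply (is_C_derive_ext_loc (fun v => (F v - F z) * / (v - z))%C).
    + exists (Cmod (w - z)). split; [apply Cmod_gt_0, Cminus_eq_contra, Hne|].
      intros v Hv. unfold slope. destruct (Ceq_dec v z) as [->|_]; [|reflexivity].
      rewrite Cmod_minus_sym in Hv. lra.
    + assert (Hwz : (w - z <> 0)%C) by now apply Cminus_eq_contra.
      eapply is_C_derive_eq.
      * apply (is_C_derive_mult (fun v => F v - F z)%C (fun v => / (v - z))%C).
        -- apply is_C_derive_minus; [apply HF, Hw|apply is_C_derive_const].
        -- apply (is_C_derive_inv (fun v => v - z)%C); [exact Hwz|].
           apply is_C_derive_minus; [apply is_C_derive_id|apply is_C_derive_const].
      * cbv beta. field. exact Hwz.
Qed.

Definition circ (r t : R) : C := (r * Cexp (Ci * t))%C.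

(* On [circ r], d(zeta) / (2 pi i) is [zeta] times the normalized angle, so that the contour integral
   of [g] divided by [2 pi i] is [Av] of [g] times [circ r]. *)
Definition Av (phi : R -> C) : C := (/ (2 * PI)%R * CInt phi 0 (2 * PI))%C.

Lemma two_PI_pos : 0 < 2 * PI.
Proof. generalize PI_RGT_0. lra. Qed.

Lemma Cmod_circ (r t : R) : 0 < r -> Cmod (circ r t) = r.
Proof.
  intros Hr. unfold circ. rewrite Cmod_mult, Cmod_R, Cmod_Cexp, Rabs_pos_eq by lra.
  replace (Re (Ci * t)) with 0; [rewrite exp_0; ring|]. rewrite re_scal_r. simpl. ring.
Qed.

Lemma circ_period (r : R) : circ r (2 * PI) = circ r 0.
Proof.
  unfold circ, Cexp. rewrite !im_scal_r, !re_scal_r. simpl Re. simpl Im.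
  rewrite !Rmult_1_l, !Rmult_0_l, cos_2PI, sin_2PI, cos_0, sin_0. reflexivity.
Qed.

Lemma Rder_circ (r t : R) : Rder (circ r) t (Ci * circ r t).
Proof.
  unfold circ at 1. eapply Rder_eq.
  - apply Rder_mult; [apply Rder_const|]. apply (Rder_Cexp (fun t => Ci * t)%C).
    apply Rder_mult; [apply Rder_const|apply Rder_id].
  - unfold circ. cbv beta. ring.
Qed.

Lemma cont_circ (r t : R) : Ccont (circ r) t.
Proof. eapply Rder_cont, Rder_circ. Qed.

Notation oncirc phi := (Ccont_on phi 0 (2 * PI)).

Lemma Av_ext (f g : R -> C) : (forall t, f t = g t) -> Av f = Av g.
Proof. intros H. unfold Av. rewrite (CInt_ext f g); auto. generalize two_PI_pos; lra. Qed.

Lemma Av_plus (f g : R -> C) : oncirc f -> oncirc g -> Av (fun t => f t + g t)%C = (Av f + Av g)%C.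
Proof. intros Hf Hg. unfold Av. rewrite CInt_plus; auto; [ring|]. generalize two_PI_pos; lra. Qed.

Lemma Av_minus (f g : R -> C) : oncirc f -> oncirc g -> Av (fun t => f t - g t)%C = (Av f - Av g)%C.
Proof. intros Hf Hg. unfold Av. rewrite CInt_minus; auto; [ring|]. generalize two_PI_pos; lra. Qed.

Lemma Av_scal (k : C) (f : R -> C) : oncirc f -> Av (fun t => k * f t)%C = (k * Av f)%C.
Proof. intros Hf. unfold Av. rewrite CInt_scal; auto; [ring|]. generalize two_PI_pos; lra. Qed.

Lemma Av_const (k : C) : Av (fun _ => k) = k.
Proof.
  unfold Av. rewrite CInt_const, Rminus_0_r.
  field. intros E. apply RtoC_inj in E. generalize two_PI_pos; lra.
Qed.

Lemma Av_bound (f : R -> C) (M : R) : oncirc f -> (forall t, 0 <= t <= 2 * PI -> Cmod (f t) <= M) -> Cmod (Av f) <= M.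
Proof.
  intros Hf HM. assert (P := two_PI_pos). unfold Av.
  assert (N : RtoC (2 * PI) <> 0%C) by (intros E; apply RtoC_inj in E; lra).
  rewrite Cmod_mult, Cmod_inv, Cmod_R, Rabs_pos_eq by (exact N || lra).
  apply (Rmult_le_reg_l (2 * PI)); [exact P|]. rewrite <- Rmult_assoc, Rinv_r, Rmult_1_l by lra.
  rewrite (Rmult_comm (2 * PI)). replace (M * (2 * PI)) with (M * (2 * PI - 0)) by ring.
  apply CInt_bound; [lra|exact Hf|auto].
Qed.

Lemma Av_derive (g g' : R -> C) : (forall t, Rder g t (g' t)) -> oncirc g' -> g (2 * PI) = g 0 -> Av g' = 0%C.
Proof.
  intros Hg Hc E. unfold Av. rewrite (CInt_derive g); auto.
  - rewrite E. ring.
  - generalize two_PI_pos; lra.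
Qed.

Lemma circ_neq_0 (r t : R) : 0 < r -> circ r t <> 0%C.
Proof. intros Hr. apply Cmod_gt_0. now rewrite Cmod_circ. Qed.

Lemma circ_sub_lower (r t : R) (y : C) : 0 < r -> r - Cmod y <= Cmod (circ r t - y).
Proof.
  intros Hr. assert (T := Cmod_le_add (circ r t) y). rewrite Cmod_circ in T by exact Hr. lra.
Qed.

Lemma circ_sub_neq_0 (r t : R) (y : C) : Cmod y < r -> (circ r t - y)%C <> 0%C.
Proof.
  intros Hy. apply Cmod_gt_0. assert (G := Cmod_ge_0 y).
  assert (T := circ_sub_lower r t y). lra.
Qed.

(** Up to the nonzero factor [- Ci * k] this power of [circ] is its own derivative in the angle, and
    the derivative of a periodic function has average 0. *)
Lemma Av_circ_inv_pow (r : R) (k : nat) : 0 < r -> (0 < k)%nat -> Av (fun t => (/ circ r t) ^ k)%C = 0%C.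
Proof.
  intros Hr Hk.
  assert (D : forall t, Rder (fun t => (/ circ r t) ^ k)%C t ((- (Ci * INR k)) * (/ circ r t) ^ k)%C).
  { intros t. assert (N := circ_neq_0 r t Hr).
    eapply Rder_eq.
    - apply (Rder_comp (fun w => (/ w) ^ k)%C (circ r)); [|apply Rder_circ].
      apply (is_C_derive_ext (fun w => (/ w - 0) ^ k)%C).
      { intros w. f_equal. ring. }
      apply (is_C_derive_comp (fun w => (w - 0) ^ k)%C Cinv); [apply is_C_derive_pow|].
      apply is_C_derive_Cinv. exact N.
    - destruct k as [|k]; [lia|]. simpl pred. rewrite Cpow_S.
      replace (/ circ r t - 0)%C with (/ circ r t)%C by ring. field. exact N. }
  assert (Hc : oncirc (fun t => (/ circ r t) ^ k)%C).
  { intros t _. eapply Rder_cont. apply D. }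
  assert (E := Av_derive _ _ D). rewrite Av_scal in E by exact Hc.
  assert (Hk' : (- (Ci * INR k))%C <> 0%C).
  { intros E0. assert (Hk0 : (Ci * INR k)%C = 0%C).
    { replace (Ci * INR k)%C with (- - (Ci * INR k))%C by ring. rewrite E0. ring. }
    revert Hk0. apply Cmult_neq_0; [exact Ci_nz|].
    intros E1. apply RtoC_inj in E1. apply not_0_INR in E1; auto; lia. }
  assert (E' : (- (Ci * INR k) * Av (fun t => (/ circ r t) ^ k))%C = 0%C).
  { apply E; [apply cont_on_mult; [apply cont_on_const|exact Hc]|]. now rewrite circ_period. }
  destruct (Ceq_dec (Av (fun t => (/ circ r t) ^ k)%C) 0%C) as [H0|H0]; [exact H0|].
  exfalso. revert E'. now apply Cmult_neq_0.
Qed.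

Lemma oncirc_inv_pow (r : R) (k : nat) : 0 < r -> oncirc (fun t => (/ circ r t) ^ k)%C.
Proof.
  intros Hr t Ht. induction k as [|k IH].
  - apply (cont_const (1)%C).
  - apply (cont_mult (fun t => / circ r t)%C (fun t => (/ circ r t) ^ k)%C); [|exact IH].
    apply cont_inv; [apply cont_circ|now apply circ_neq_0].
Qed.

Lemma oncirc_kernel (r : R) (y : C) : Cmod y < r -> oncirc (fun t => circ r t / (circ r t - y))%C.
Proof.
  intros Hy t _. apply cont_mult; [apply cont_circ|].
  apply cont_inv; [apply cont_minus; [apply cont_circ|apply cont_const]|now apply circ_sub_neq_0].
Qed.

(** The geometric series with its exact remainder; it yields both the average of the Cauchy kernel
    and the Taylor expansion of a holomorphic function. *)
Lemma kernel_expand (n : nat) (u y : C) : u <> 0%C -> (u - y)%C <> 0%C ->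
  (u / (u - y))%C = (Csum (fun k => y ^ k * (/ u) ^ k) n + y ^ n * ((/ u) ^ n * (u / (u - y))))%C.
Proof.
  intros Hu Hy. induction n as [|n IH]; simpl.
  - field. exact Hy.
  - rewrite IH at 1.
    replace (u / (u - y))%C with (1 + y * (/ u * (u / (u - y))))%C at 1 by (field; auto).
    ring.
Qed.

(** The winding number without arguments or logarithms: in the expansion of the kernel only the
    constant term has a nonzero average, and the remainder decays like [(Cmod y / r) ^ n]. *)
Lemma Av_kernel (r : R) (y : C) : Cmod y < r -> Av (fun t => circ r t / (circ r t - y))%C = 1%C.
Proof.
  intros Hy. assert (G := Cmod_ge_0 y). assert (Hr : 0 < r) by lra.
  apply Ceq_minus. apply Cmod_eq_0. apply Rle_antisym; [|apply Cmod_ge_0].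
  apply le_epsilon. intros eps He. rewrite Rplus_0_l.
  assert (Hq : Rabs (Cmod y / r) < 1).
  { rewrite Rabs_pos_eq; [|apply Rdiv_le_0_compat; lra].
    apply (Rmult_lt_reg_r r); [lra|]. replace (Cmod y / r * r) with (Cmod y) by (field; lra). lra. }
  assert (Hd : 0 < eps * (r - Cmod y) / r).
  { apply Rdiv_lt_0_compat; [|lra]. apply Rmult_lt_0_compat; lra. }
  destruct (pow_lt_1_zero _ Hq _ Hd) as [n Hn]. specialize (Hn (S n) ltac:(lia)).
  assert (C1 := oncirc_kernel r y Hy).
  assert (C2 : oncirc (fun t => Csum (fun k => y ^ k * (/ circ r t) ^ k) (S n))%C).
  { apply (cont_on_Csum (fun k t => y ^ k * (/ circ r t) ^ k)%C). intros k _.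
    apply cont_on_mult; [apply cont_on_const|now apply oncirc_inv_pow]. }
  assert (E : Av (fun t => Csum (fun k => y ^ k * (/ circ r t) ^ k) (S n))%C = 1%C).
  { transitivity (Csum (fun k => Av (fun t => y ^ k * (/ circ r t) ^ k)%C) (S n)).
    - unfold Av. rewrite (CInt_Csum (fun k t => y ^ k * (/ circ r t) ^ k)%C).
      + rewrite <- Csum_scal. reflexivity.
      + generalize two_PI_pos; lra.
      + intros k _. apply cont_on_mult; [apply cont_on_const|now apply oncirc_inv_pow].
    - rewrite Csum_shift. rewrite (Csum_ext _ (fun _ => RtoC 0)).
      + rewrite Csum_0. rewrite (Av_ext _ (fun _ => 1%C)); [rewrite Av_const; ring|]. intros t; simpl; ring.
      + intros k _. rewrite Av_scal by now apply oncirc_inv_pow. rewrite Av_circ_inv_pow; [ring|exact Hr|lia]. }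
  rewrite <- E. rewrite <- Av_minus by assumption.
  apply Av_bound; [now apply cont_on_minus|]. intros t _.
  assert (N1 := circ_neq_0 r t Hr). assert (N2 := circ_sub_neq_0 r t y Hy).
  rewrite (kernel_expand (S n) (circ r t) y) at 1 by assumption.
  replace (Csum (fun k => y ^ k * (/ circ r t) ^ k) (S n) +
    y ^ S n * ((/ circ r t) ^ S n * (circ r t / (circ r t - y))) -
    Csum (fun k => y ^ k * (/ circ r t) ^ k) (S n))%C with
    ((y * / circ r t) ^ S n * (circ r t / (circ r t - y)))%C by (rewrite Cpow_mult_l; ring).
  rewrite Cmod_mult, Cmod_pow, Cmod_mult, Cmod_inv, Cmod_div, Cmod_circ by assumption.
  fold (Cmod y / r). assert (L := circ_sub_lower r t y Hr).
  assert (Hn' := Rle_lt_trans _ _ _ (Rle_abs _) Hn).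
  assert (P : 0 <= (Cmod y / r) ^ S n) by (apply pow_le, Rdiv_le_0_compat; lra).
  assert (Q : r / Cmod (circ r t - y) <= r / (r - Cmod y)).
  { apply Rmult_le_compat_l; [lra|]. apply Rinv_le_contravar; lra. }
  apply Rle_trans with (eps * (r - Cmod y) / r * (r / (r - Cmod y))).
  - apply Rmult_le_compat; [exact P| |lra|exact Q].
    apply Rdiv_le_0_compat; lra.
  - right. field. lra.
Qed.

Lemma bounded_on (f : R -> C) (a b : R) : a <= b -> Ccont_on f a b ->
  exists M, forall t, a <= t <= b -> Cmod (f t) <= M.
Proof.
  intros Hab Hf.
  destruct (continuity_ab_maj (fun t => Re (f t) * Re (f t) + Im (f t) * Im (f t)) a b Hab) as [m [Hm _]].
  - intros t Ht. apply continuity_pt_filterlim.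
    assert (A := cont_Re _ _ (Hf t Ht)). assert (B := cont_Im _ _ (Hf t Ht)).
    apply (continuous_plus (V:=R_NormedModule) (fun t => Re (f t) * Re (f t)) (fun t => Im (f t) * Im (f t)));
      [apply (continuous_mult (K:=R_AbsRing) (fun t => Re (f t)) (fun t => Re (f t)))
      |apply (continuous_mult (K:=R_AbsRing) (fun t => Im (f t)) (fun t => Im (f t)))]; assumption.
  - exists (sqrt (Re (f m) * Re (f m) + Im (f m) * Im (f m))). intros t Ht.
    unfold Cmod. apply sqrt_le_1_alt. simpl. rewrite !Rmult_1_r. exact (Hm t Ht).
Qed.

Section Cauchy.

Variables (f : C -> C) (p : C) (R0 r : R).
Hypothesis Hf : forall z, disc p R0 z -> C_derivable f z.
Hypothesis Hr : 0 < r < R0.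

Lemma circ_in_disc (t : R) : disc p R0 (p + circ r t)%C.
Proof.
  unfold disc. replace (p + circ r t - p)%C with (circ r t) by ring. rewrite Cmod_circ; lra.
Qed.

Lemma shift_in_disc (y : C) : Cmod y < r -> disc p R0 (p + y)%C.
Proof. intros Hy. unfold disc. replace (p + y - p)%C with y by ring. lra. Qed.

Lemma cont_disc (z : C) : disc p R0 z -> Ccont f z.
Proof. intros Hz. destruct (Hf z Hz) as [d Hd]. exact (is_C_derive_cont f z d Hd). Qed.

Lemma oncirc_comp (F : C -> C) : (forall z, disc p R0 z -> Ccont F z) ->
  oncirc (fun t => F (p + circ r t)%C).
Proof.
  intros HF t _. apply (cont_comp F).
  - apply cont_plus; [apply cont_const|apply cont_circ].
  - apply HF, circ_in_disc.
Qed.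

Lemma Av_closed (F g : C -> C) : (forall z, disc p R0 z -> is_C_derive F z (g z)) ->
  (forall z, disc p R0 z -> Ccont g z) -> Av (fun t => g (p + circ r t) * circ r t)%C = 0%C.
Proof.
  intros HF Hg.
  assert (Hc : oncirc (fun t => g (p + circ r t) * circ r t)%C).
  { apply cont_on_mult; [now apply oncirc_comp|]. intros t _. apply cont_circ. }
  assert (E : Av (fun t => Ci * (g (p + circ r t) * circ r t))%C = 0%C).
  { apply (Av_derive (fun t => F (p + circ r t)%C)).
    - intros t. eapply Rder_eq.
      + apply (Rder_comp F); [apply HF, circ_in_disc|]. apply Rder_plus; [apply Rder_const|apply Rder_circ].
      + cbv beta. ring.
    - apply cont_on_mult; [apply cont_on_const|exact Hc].
    - now rewrite circ_period. }
  rewrite Av_scal in E by exact Hc.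
  destruct (Ceq_dec (Av (fun t => g (p + circ r t) * circ r t)%C) 0%C) as [H0|H0]; [exact H0|].
  exfalso. revert E. apply Cmult_neq_0; [exact Ci_nz|exact H0].
Qed.

(** Cauchy's formula for a primitive comes first, because its slope at [p + y] is known to be
    derivable on the whole disc. The slope therefore has a primitive itself, its contour integral
    vanishes, and [Av_kernel] evaluates the constant part. *)
Lemma cauchy_primitive (F : C -> C) (y : C) : (forall z, disc p R0 z -> is_C_derive F z (f z)) ->
  Cmod y < r -> F (p + y)%C = Av (fun t => F (p + circ r t) * (circ r t / (circ r t - y)))%C.
Proof.
  intros HF Hy. assert (Hz := shift_in_disc y Hy).
  assert (HFc : forall z, disc p R0 z -> Ccont F z).
  { intros z Hz'. exact (is_C_derive_cont F z (f z) (HF z Hz')). }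
  assert (Hs : forall w, disc p R0 w -> C_derivable (slope F f (p + y)%C) w).
  { intros w Hw. now apply (slope_derivable F f p R0). }
  destruct (primitive_disc _ _ _ Hs) as [Q HQ].
  assert (E := Av_closed Q _ HQ).
  assert (K1 := oncirc_comp F HFc). assert (K2 := oncirc_kernel r y Hy).
  rewrite (Av_ext _ (fun t => F (p + circ r t) * (circ r t / (circ r t - y))
      - F (p + y) * (circ r t / (circ r t - y)))%C) in E.
  - rewrite Av_minus, Av_scal, Av_kernel in E; auto.
    + apply Ceq_minus. rewrite Cmult_1_r in E.
      transitivity (- (Av (fun t => F (p + circ r t) * (circ r t / (circ r t - y)))%C - F (p + y)%C))%C; [ring|].
      rewrite E; [ring|].
      intros z Hz'. destruct (Hs z Hz') as [d Hd]. exact (is_C_derive_cont _ z d Hd).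
    + now apply cont_on_mult.
    + apply cont_on_mult; [apply cont_on_const|exact K2].
  - intros t. unfold slope. assert (N := circ_sub_neq_0 r t y Hy).
    destruct (Ceq_dec (p + circ r t)%C (p + y)%C) as [E0|_].
    + exfalso. apply N. replace (circ r t - y)%C with ((p + circ r t) - (p + y))%C by ring. rewrite E0. ring.
    + replace (p + circ r t - (p + y))%C with (circ r t - y)%C by ring. field. exact N.
Qed.

(** The formula for the primitive [F] is differentiated in [y]. Integration by parts on the circle
    turns the claimed average into that of [psi], with squared kernel, and [psi] averages to the
    derivative of [F] at [p + y], which is [f]. *)
Lemma cauchy_formula (y : C) : Cmod y < r ->
  f (p + y)%C = Av (fun t => f (p + circ r t) * (circ r t / (circ r t - y)))%C.
Proof.
  intros Hy. destruct (primitive_disc _ _ _ Hf) as [F HF].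
  assert (Hz := shift_in_disc y Hy).
  assert (HFc : forall z, disc p R0 z -> Ccont F z).
  { intros z Hz'. exact (is_C_derive_cont F z (f z) (HF z Hz')). }
  assert (KF := oncirc_comp F HFc). assert (Kf := oncirc_comp f cont_disc).
  assert (K2 := oncirc_kernel r y Hy).
  assert (K3 : oncirc (fun t => / (circ r t - y))%C).
  { intros t _. apply cont_inv; [apply cont_minus; [apply cont_circ|apply cont_const]|now apply circ_sub_neq_0]. }
  pose (psi := fun t => (F (p + circ r t) * (circ r t / (circ r t - y)) * / (circ r t - y))%C).
  assert (Kpsi : oncirc psi) by (apply cont_on_mult; [now apply cont_on_mult|exact K3]).
  assert (A : Av (fun t => f (p + circ r t) * (circ r t / (circ r t - y)))%C = Av psi).
  { apply Ceq_minus. rewrite <- Av_minus; [|now apply cont_on_mult|exact Kpsi].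
    assert (E : Av (fun t => Ci * (f (p + circ r t) * (circ r t / (circ r t - y)) - psi t))%C = 0%C).
    { apply (Av_derive (fun t => F (p + circ r t) * / (circ r t - y))%C).
      - intros t. assert (N := circ_sub_neq_0 r t y Hy). eapply Rder_eq.
        + apply Rder_mult.
          * apply (Rder_comp F); [apply HF, circ_in_disc|]. apply Rder_plus; [apply Rder_const|apply Rder_circ].
          * apply (Rder_comp Cinv (fun t => circ r t - y)%C); [apply is_C_derive_Cinv, N|].
            apply Rder_minus; [apply Rder_circ|apply Rder_const].
        + unfold psi. cbv beta. field. exact N.
      - apply cont_on_mult; [apply cont_on_const|]. apply cont_on_minus; [now apply cont_on_mult|exact Kpsi].
      - now rewrite circ_period. }
    rewrite Av_scal in E by (apply cont_on_minus; [now apply cont_on_mult|exact Kpsi]).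
    match type of E with (Ci * ?X)%C = _ => destruct (Ceq_dec X 0%C) as [H0|H0]; [exact H0|] end.
    exfalso. revert E. apply Cmult_neq_0; [exact Ci_nz|exact H0]. }
  rewrite A. apply (is_C_derive_unique' F (p + y)%C); [apply HF, Hz|].
  destruct (bounded_on _ _ _ (Rlt_le _ _ two_PI_pos) KF) as [M HM].
  assert (M0 : 0 <= M).
  { eapply Rle_trans; [apply Cmod_ge_0|apply (HM 0)]. generalize two_PI_pos; lra. }
  assert (G := Cmod_ge_0 y). set (s := r - Cmod y). assert (Hs : 0 < s) by (unfold s; lra).
  apply is_C_derive_eps. intros eps He.
  (* The second-order remainder under the average is [F u h^2 / ((u - y)^2 (u - (y + h)))], with
     denominators at least [s] and [s / 2]. *)
  pose (K := 2 * (M * r) / (s ^ 3)).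
  assert (HK : 0 <= K).
  { apply Rdiv_le_0_compat; [|now apply pow_lt]. apply Rmult_le_pos; [lra|]. apply Rmult_le_pos; lra. }
  exists (Rmin (s / 2) (eps / (K + 1))). split.
  { apply Rmin_pos; [lra|]. apply Rdiv_lt_0_compat; lra. }
  intros w Hw.
  assert (H1 := Rlt_le_trans _ _ _ Hw (Rmin_l _ _)).
  assert (H2 := Rlt_le_trans _ _ _ Hw (Rmin_r _ _)).
  set (h := (w - (p + y))%C) in *.
  assert (Hyh : Cmod (y + h) < r).
  { eapply Rle_lt_trans; [apply Cmod_triangle|]. unfold s in H1. lra. }
  replace w with (p + (y + h))%C by (unfold h; ring).
  rewrite (cauchy_primitive F (y + h)%C HF Hyh), (cauchy_primitive F y HF Hy).
  assert (K2h := oncirc_kernel r _ Hyh).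
  rewrite (Cmult_comm (Av psi)), <- Av_scal by exact Kpsi.
  assert (K4 := cont_on_mult _ _ _ _ KF K2). assert (K5 := cont_on_mult _ _ _ _ KF K2h).
  rewrite <- Av_minus by assumption.
  rewrite <- Av_minus; [|now apply cont_on_minus|apply cont_on_mult; [apply cont_on_const|exact Kpsi]].
  apply Rle_trans with (K * Cmod h * Cmod h).
  - apply Av_bound.
    { apply cont_on_minus; [apply cont_on_minus; now apply cont_on_mult|].
      apply cont_on_mult; [apply cont_on_const|exact Kpsi]. }
    intros t Ht. unfold psi.
    assert (N1 := circ_sub_neq_0 r t _ Hy). assert (N2 := circ_sub_neq_0 r t _ Hyh).
    set (u := circ r t) in *. assert (Hu : Cmod u = r) by (apply Cmod_circ; lra).
    replace (F (p + u) * (u / (u - (y + h))) - F (p + u) * (u / (u - y)) -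
       h * (F (p + u) * (u / (u - y)) * / (u - y)))%C with
      (F (p + u) * u * (h * h) / ((u - y) * (u - y) * (u - (y + h))))%C by (field; auto).
    rewrite Cmod_div by (repeat apply Cmult_neq_0; auto). rewrite !Cmod_mult, Hu.
    assert (L1 : s <= Cmod (u - y)) by (apply circ_sub_lower; lra).
    assert (L2 : s / 2 <= Cmod (u - (y + h))).
    { eapply Rle_trans; [|apply circ_sub_lower; lra]. assert (T := Cmod_triangle y h). unfold s in *. lra. }
    specialize (HM t Ht). fold u in HM. assert (GF := Cmod_ge_0 (F (p + u)%C)).
    assert (Gh := Cmod_ge_0 h).
    assert (Q : s ^ 3 / 2 <= Cmod (u - y) * Cmod (u - y) * Cmod (u - (y + h))).
    { replace (s ^ 3 / 2) with (s * s * (s / 2)) by (simpl; field).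
      apply Rmult_le_compat; [nra|lra| |exact L2]. apply Rmult_le_compat; lra. }
    assert (Qp : 0 < s ^ 3 / 2) by (apply Rdiv_lt_0_compat; [now apply pow_lt|lra]).
    replace (K * Cmod h * Cmod h) with (M * r * (Cmod h * Cmod h) * / (s ^ 3 / 2)) by (unfold K; field; lra).
    apply Rmult_le_compat.
    + apply Rmult_le_pos; [apply Rmult_le_pos; lra|nra].
    + apply Rlt_le, Rinv_0_lt_compat. lra.
    + apply Rmult_le_compat_r; [nra|]. apply Rmult_le_compat_r; lra.
    + apply Rinv_le_contravar; assumption.
  - apply Rmult_le_compat_r; [apply Cmod_ge_0|].
    assert (Gh := Cmod_ge_0 h).
    apply (Rmult_lt_compat_r (K + 1)) in H2; [|lra].
    replace (eps / (K + 1) * (K + 1)) with eps in H2 by (field; lra). nra.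
Qed.

Lemma cauchy_expand (n : nat) (y : C) : Cmod y < r ->
  f (p + y)%C = (Csum (fun k => y ^ k * Av (fun t => f (p + circ r t) * (/ circ r t) ^ k)) n
    + y ^ n * Av (fun t => f (p + circ r t) * ((/ circ r t) ^ n * (circ r t / (circ r t - y)))))%C.
Proof.
  intros Hy. rewrite cauchy_formula by exact Hy.
  assert (Kf := oncirc_comp f cont_disc). assert (K2 := oncirc_kernel r y Hy).
  assert (Hr0 : 0 < r) by lra.
  assert (KP := fun k => oncirc_inv_pow r k Hr0).
  rewrite (Av_ext _ (fun t => Csum (fun k => y ^ k * (f (p + circ r t) * (/ circ r t) ^ k)) n
    + y ^ n * (f (p + circ r t) * ((/ circ r t) ^ n * (circ r t / (circ r t - y)))))%C).
  - assert (KS : oncirc (fun t => Csum (fun k => y ^ k * (f (p + circ r t) * (/ circ r t) ^ k)) n)%C).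
    { apply (cont_on_Csum (fun k t => y ^ k * (f (p + circ r t) * (/ circ r t) ^ k))%C). intros k _.
      apply cont_on_mult; [apply cont_on_const|now apply cont_on_mult]. }
    assert (KR : oncirc (fun t => f (p + circ r t) * ((/ circ r t) ^ n * (circ r t / (circ r t - y))))%C).
    { apply cont_on_mult; [exact Kf|now apply cont_on_mult]. }
    rewrite Av_plus, Av_scal; [|exact KR|exact KS|apply cont_on_mult; [apply cont_on_const|exact KR]].
    f_equal. unfold Av at 1.
    rewrite (CInt_Csum (fun k t => y ^ k * (f (p + circ r t) * (/ circ r t) ^ k))%C).
    + rewrite <- Csum_scal. apply Csum_ext. intros k _.
      apply (Av_scal (y ^ k) (fun t => f (p + circ r t) * (/ circ r t) ^ k)%C). now apply cont_on_mult.
    + generalize two_PI_pos; lra.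
    + intros k _. apply cont_on_mult; [apply cont_on_const|now apply cont_on_mult].
  - intros t. rewrite (kernel_expand n (circ r t) y) at 1; [|now apply circ_neq_0|now apply circ_sub_neq_0].
    rewrite Cmult_plus_distr_l, <- Csum_scal.
    f_equal; [apply Csum_ext; intros; ring|ring].
Qed.

End Cauchy.

(** * Isolated zeros and Weierstrass convergence *)

(** Either some Cauchy coefficient is nonzero, and for the least such [n] one has f(p + y) = y^n
    (a_n + y T) with [T] bounded; or all vanish, and the remainder, at most [2 M (/ 2) ^ n] for
    [Cmod y <= r / 2], forces [f] to be 0 there. *)
Lemma isolated_zeros (f : C -> C) (p : C) (R0 : R) : 0 < R0 ->
  (forall z, disc p R0 z -> C_derivable f z) ->
  (exists del, 0 < del /\ forall w, disc p del w -> f w = 0%C) \/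
  (exists del, 0 < del /\ forall w, disc p del w -> w <> p -> f w <> 0%C).
Proof.
  intros HR Hf. pose (r := R0 / 2). assert (Hr : 0 < r < R0) by (unfold r; lra).
  assert (Hr0 : 0 < r) by lra.
  assert (Kf := oncirc_comp p R0 r Hr f (cont_disc f p R0 Hf)).
  destruct (bounded_on _ _ _ (Rlt_le _ _ two_PI_pos) Kf) as [M HM].
  assert (M0 : 0 <= M).
  { eapply Rle_trans; [apply Cmod_ge_0|apply (HM 0)]. generalize two_PI_pos; lra. }
  pose (a := fun k => Av (fun t => f (p + circ r t) * (/ circ r t) ^ k)%C).
  assert (KP := fun k => oncirc_inv_pow r k Hr0).
  assert (B : forall n y, Cmod y <= r / 2 ->
     Cmod (Av (fun t => f (p + circ r t) * ((/ circ r t) ^ n * (circ r t / (circ r t - y)))))%C <= 2 * M * (/ r) ^ n).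
  { intros n y Hy. assert (Hy' : Cmod y < r) by lra. assert (K2 := oncirc_kernel r y Hy').
    apply Av_bound.
    { apply cont_on_mult; [exact Kf|now apply cont_on_mult]. }
    intros t Ht. assert (N1 := circ_neq_0 r t Hr0). assert (N2 := circ_sub_neq_0 r t y Hy').
    rewrite !Cmod_mult, Cmod_pow, Cmod_inv, Cmod_div, Cmod_circ by assumption.
    assert (L := circ_sub_lower r t y Hr0).
    assert (Q : r / Cmod (circ r t - y) <= 2).
    { apply (Rmult_le_reg_r (Cmod (circ r t - y))); [lra|].
      unfold Rdiv. rewrite Rmult_assoc, Rinv_l by lra. lra. }
    assert (P : 0 < (/ r) ^ n) by now apply pow_lt, Rinv_0_lt_compat.
    replace (2 * M * (/ r) ^ n) with (M * ((/ r) ^ n * 2)) by ring.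
    apply Rmult_le_compat; [apply Cmod_ge_0| |now apply HM|].
    - apply Rmult_le_pos; [lra|]. apply Rdiv_le_0_compat; lra.
    - apply Rmult_le_compat_l; lra. }
  destruct (classic (exists k, a k <> 0%C)) as [Hex|Hno].
  - right. destruct (dec_inh_nat_subset_has_unique_least_element (fun k => a k <> 0%C)) as [n [[Hn Hmin] _]].
    { intros n. destruct (Ceq_dec (a n) 0%C); [right|left]; tauto. }
    { exact Hex. }
    assert (P := proj1 (Cmod_gt_0 _) Hn).
    assert (Hrn : 0 < (/ r) ^ S n) by now apply pow_lt, Rinv_0_lt_compat.
    (* This radius makes [Cmod y] times the bound [2 M (/ r) ^ S n] of the remainder average smaller
       than [Cmod (a n)], so that the bracket cannot vanish. *)
    exists (Rmin (r / 2) (Cmod (a n) / (2 * M * (/ r) ^ S n + 1))).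
    assert (Hden : 0 < 2 * M * (/ r) ^ S n + 1) by nra.
    split; [apply Rmin_pos; [lra|]; apply Rdiv_lt_0_compat; assumption|].
    intros w Hw Hwp E. unfold disc in Hw. set (y := (w - p)%C) in *.
    assert (H1 := Rlt_le_trans _ _ _ Hw (Rmin_l _ _)).
    assert (H2 := Rlt_le_trans _ _ _ Hw (Rmin_r _ _)).
    assert (Hy : y <> 0%C) by now apply Cminus_eq_contra.
    replace w with (p + y)%C in E by (unfold y; ring).
    rewrite (cauchy_expand f p R0 r Hf Hr (S n) y) in E by lra.
    simpl Csum in E. rewrite (Csum_ext _ (fun _ => RtoC 0)) in E.
    2:{ intros k Hk. destruct (Ceq_dec (a k) 0%C) as [E0|N0].
        - unfold a in E0. rewrite E0. ring.
        - specialize (Hmin k N0). lia. }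
    rewrite Csum_0 in E. fold (a n) in E.
    specialize (B (S n) y ltac:(lra)).
    set (T := Av (fun t => f (p + circ r t) * ((/ circ r t) ^ S n * (circ r t / (circ r t - y))))%C) in *.
    assert (E2 : (y ^ n * (a n + y * T))%C = 0%C).
    { rewrite <- E. simpl. ring. }
    assert (E3 : (a n + y * T)%C = 0%C).
    { destruct (Ceq_dec (a n + y * T)%C 0%C) as [E3|N3]; [exact E3|].
      exfalso. revert E2. apply Cmult_neq_0; [now apply Cpow_nz|exact N3]. }
    assert (E4 : Cmod (a n) = Cmod y * Cmod T).
    { rewrite <- Cmod_mult, <- Cmod_opp. f_equal.
      transitivity (y * T - (a n + y * T))%C; [ring|]. rewrite E3. ring. }
    apply (Rmult_lt_compat_r _ _ _ Hden) in H2.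
    unfold Rdiv in H2. rewrite (Rmult_assoc (Cmod (a n))), Rinv_l, Rmult_1_r in H2 by lra.
    assert (Gy := Cmod_ge_0 y). nra.
  - left. exists (r / 2). split; [lra|]. intros w Hw. unfold disc in Hw. set (y := (w - p)%C) in *.
    replace w with (p + y)%C by (unfold y; ring).
    apply Cmod_eq_0. apply Rle_antisym; [|apply Cmod_ge_0].
    apply le_epsilon. intros eps He. rewrite Rplus_0_l.
    destruct (pow_half_small (2 * M) eps He) as [n Hn]. specialize (Hn n (le_n n)).
    rewrite (cauchy_expand f p R0 r Hf Hr n y) by lra.
    rewrite (Csum_ext _ (fun _ => RtoC 0)).
    2:{ intros k _. destruct (Ceq_dec (a k) 0%C) as [E0|N0].
        - unfold a in E0. rewrite E0. ring.
        - exfalso. eauto. }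
    rewrite Csum_0, Cplus_0_l, Cmod_mult, Cmod_pow.
    specialize (B n y ltac:(lra)).
    apply Rle_trans with ((r * / 2) ^ n * (2 * M * (/ r) ^ n)).
    + apply Rmult_le_compat; [apply pow_le, Cmod_ge_0|apply Cmod_ge_0| |exact B].
      apply pow_incr. split; [apply Cmod_ge_0|lra].
    + replace ((r * / 2) ^ n * (2 * M * (/ r) ^ n)) with (2 * M * ((r * / 2) * / r) ^ n) by (rewrite !Rpow_mult_distr; ring).
      replace (r * / 2 * / r) with (/ 2) by (field; lra). lra.
Qed.

(** Both the derivative and the quadratic Taylor remainder are controlled by the supremum alone.
    Applied to differences of a uniformly Cauchy sequence this gives convergence of the derivatives
    and expansions that are uniform in the index. *)
Lemma cauchy_estimate (f : C -> C) (p d : C) (R0 r M : R) : 0 < r < R0 ->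
  (forall z, disc p R0 z -> C_derivable f z) -> is_C_derive f p d ->
  (forall z, disc p R0 z -> Cmod (f z) <= M) ->
  Cmod d <= M / r /\
  forall h, Cmod h <= r / 2 -> Cmod (f (p + h) - f p - d * h)%C <= 2 * M / r ^ 2 * Cmod h ^ 2.
Proof.
  intros Hr Hf Hd HM. assert (Hr0 : 0 < r) by lra.
  assert (Kf := oncirc_comp p R0 r Hr f (cont_disc f p R0 Hf)).
  assert (KP := fun k => oncirc_inv_pow r k Hr0).
  assert (HMc : forall t, Cmod (f (p + circ r t)%C) <= M) by (intros t; apply HM, circ_in_disc, Hr).
  assert (M0 : 0 <= M) by (eapply Rle_trans; [apply Cmod_ge_0|apply (HMc 0)]).
  pose (a := Av (fun t => f (p + circ r t) * (/ circ r t) ^ 1)%C).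
  assert (E0 : Av (fun t => f (p + circ r t) * (/ circ r t) ^ 0)%C = f p).
  { assert (E := cauchy_expand f p R0 r Hf Hr 1 0%C). rewrite Cmod_0 in E. specialize (E Hr0).
    rewrite Cplus_0_r in E. rewrite E. simpl. ring. }
  assert (X : forall h, Cmod h <= r / 2 -> Cmod (f (p + h) - f p - a * h)%C <= 2 * M / r ^ 2 * Cmod h ^ 2).
  { intros h Hh. assert (Hh' : Cmod h < r) by lra.
    rewrite (cauchy_expand f p R0 r Hf Hr 2 h Hh'). cbn [Csum]. rewrite E0. fold a.
    set (T := Av (fun t => f (p + circ r t) * ((/ circ r t) ^ 2 * (circ r t / (circ r t - h))))%C).
    replace (0 + h ^ 0 * f p + h ^ 1 * a + h ^ 2 * T - f p - a * h)%C with (h ^ 2 * T)%C by (simpl; ring).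
    rewrite Cmod_mult, Cmod_pow, Rmult_comm. apply Rmult_le_compat_r; [apply pow2_ge_0|].
    assert (K2 := oncirc_kernel r h Hh').
    apply Av_bound.
    { apply cont_on_mult; [exact Kf|now apply cont_on_mult]. }
    intros t Ht. assert (N1 := circ_neq_0 r t Hr0). assert (N2 := circ_sub_neq_0 r t h Hh').
    rewrite !Cmod_mult, Cmod_pow, Cmod_inv, Cmod_div, Cmod_circ by assumption.
    assert (L := circ_sub_lower r t h Hr0).
    assert (Q : r / Cmod (circ r t - h) <= 2).
    { apply (Rmult_le_reg_r (Cmod (circ r t - h))); [lra|].
      unfold Rdiv. rewrite Rmult_assoc, Rinv_l by lra. lra. }
    assert (P : 0 < (/ r) ^ 2) by now apply pow_lt, Rinv_0_lt_compat.
    replace (2 * M / r ^ 2) with (M * ((/ r) ^ 2 * 2)) by (field; lra).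
    apply Rmult_le_compat; [apply Cmod_ge_0| |apply HMc|].
    - apply Rmult_le_pos; [lra|]. apply Rdiv_le_0_compat; lra.
    - apply Rmult_le_compat_l; lra. }
  assert (Hc : 0 <= 2 * M / r ^ 2) by (apply Rdiv_le_0_compat; [lra|now apply pow_lt]).
  assert (Ha : is_C_derive f p a).
  { apply is_C_derive_eps. intros eps He.
    exists (Rmin (r / 2) (eps / (2 * M / r ^ 2 + 1))). split.
    { apply Rmin_pos; [lra|]. apply Rdiv_lt_0_compat; lra. }
    intros w Hw.
    assert (H1 := Rlt_le_trans _ _ _ Hw (Rmin_l _ _)).
    assert (H2 := Rlt_le_trans _ _ _ Hw (Rmin_r _ _)).
    set (h := (w - p)%C) in *. replace w with (p + h)%C by (unfold h; ring).
    eapply Rle_trans; [apply X; lra|].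
    assert (Gh := Cmod_ge_0 h).
    apply (Rmult_lt_compat_r (2 * M / r ^ 2 + 1)) in H2; [|lra].
    replace (eps / (2 * M / r ^ 2 + 1) * (2 * M / r ^ 2 + 1)) with eps in H2 by (field; split; [lra|nra]).
    set (q := 2 * M / r ^ 2) in *. nra. }
  rewrite (is_C_derive_unique' _ _ _ _ Hd Ha). split; [|exact X].
  apply Av_bound; [now apply cont_on_mult|].
  intros t Ht. rewrite Cmod_mult, Cmod_pow, Cmod_inv, Cmod_circ by (auto using circ_neq_0).
  rewrite pow_1. apply Rmult_le_compat_r; [apply Rlt_le, Rinv_0_lt_compat; lra|apply HMc].
Qed.

(** [cauchy_estimate] for [g m - g n] makes the derivatives Cauchy and keeps the remainders uniform
    while [m] tends to infinity. The limit of the derivatives is part of the conclusion because it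
    is how the derivative of the continuation at 0 is evaluated. *)
Lemma weierstrass (g : nat -> C -> C) (f : C -> C) (p : C) (R0 : R) (e : nat -> R) : 0 < R0 ->
  (forall n z, disc p R0 z -> C_derivable (g n) z) ->
  (forall n z, disc p R0 z -> Cmod (g n z - f z) <= e n) ->
  (forall eps, 0 < eps -> eventually (fun n => e n < eps)) ->
  exists d, is_C_derive f p d /\
    forall d', (forall n, is_C_derive (g n) p (d' n)) -> tends eventually d' d.
Proof.
  intros HR Hg Hgf He.
  pose (r := R0 / 2). assert (Hr : 0 < r < R0) by (unfold r; lra).
  assert (Hp : disc p R0 p) by (unfold disc; replace (p - p)%C with (RtoC 0) by ring; rewrite Cmod_0; lra).
  assert (e0 : forall n, 0 <= e n) by (intros n; eapply Rle_trans; [apply Cmod_ge_0|apply (Hgf n p Hp)]).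
  assert (Hex : exists d', forall n, is_C_derive (g n) p (d' n)).
  { exists (fun n => C_derive (g n) p). intros n. destruct (Hg n p Hp) as [d Hd].
    change (is_C_derive (g n) p d) in Hd. rewrite (is_C_derive_unique _ _ _ Hd). exact Hd. }
  destruct Hex as [d' Hd'].
  assert (D : forall n m, Cmod (d' m - d' n) <= (e n + e m) / r /\
    forall h, Cmod h <= r / 2 ->
     Cmod ((g m (p + h) - g n (p + h)) - (g m p - g n p) - (d' m - d' n) * h)%C <= 2 * (e n + e m) / r ^ 2 * Cmod h ^ 2).
  { intros n m. apply (cauchy_estimate (fun z => g m z - g n z)%C p (d' m - d' n)%C R0 r (e n + e m) Hr).
    - intros z Hz. destruct (Hg m z Hz) as [x Hx]. destruct (Hg n z Hz) as [y Hy].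
      exists (x - y)%C. exact (is_C_derive_minus _ _ _ _ _ Hx Hy).
    - now apply is_C_derive_minus.
    - intros z Hz. replace (g m z - g n z)%C with ((g m z - f z) - (g n z - f z))%C by ring.
      eapply Rle_trans; [apply Cmod_minus_le|]. generalize (Hgf m z Hz) (Hgf n z Hz). lra. }
  assert (Hc : exists d, tends eventually d' d).
  { assert (CS : forall eps, 0 < eps -> exists N, forall n m, (N <= n)%nat -> (N <= m)%nat -> Cmod (d' m - d' n) < eps).
    { intros eps Heps. assert (H2 : 0 < eps * r / 2) by (apply Rdiv_lt_0_compat; [apply Rmult_lt_0_compat|]; lra).
      destruct (He _ H2) as [N HN]. exists N. intros n m Hn Hm.
      eapply Rle_lt_trans; [apply D|].
      assert (A := HN n Hn). assert (B := HN m Hm).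
      apply (Rmult_lt_reg_r r); [lra|]. unfold Rdiv. rewrite Rmult_assoc, Rinv_l by lra. lra. }
    assert (F : exists d, filterlim d' eventually (@locally C_UniformSpace d)).
    { apply (filterlim_locally_cauchy (U := C_R_CompleteNormedModule)). intros eps.
      destruct (CS eps (cond_pos eps)) as [N HN].
      exists (fun n => (N <= n)%nat). split; [exists N; auto|].
      intros n m Hn Hm. apply C_NormedModule_mixin_compat1. exact (HN n m Hn Hm). }
    destruct F as [d Hd]. exists d. apply tends_filterlim; [apply eventually_filter|exact Hd]. }
  destruct Hc as [d Hd].
  exists d. split.
  2:{ intros d2 Hd2. apply (tends_ext eventually d'); [|exact Hd].
      exists 0%nat. intros n _. exact (is_C_derive_unique' _ _ _ _ (Hd' n) (Hd2 n)). }
  assert (gp : forall z, disc p R0 z -> tends eventually (fun n => g n z) (f z)).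
  { intros z Hz. apply (tends_le eventually _ _ e).
    - exists 0%nat. intros n _. now apply Hgf.
    - exact He. }
  apply is_C_derive_eps. intros eps Heps.
  (* One index with all later errors below 1 suffices: passing from [g N] to the limit costs
     [K * Cmod h ^ 2], which is below [eps / 2 * Cmod h] for small [h] however large [K] is. *)
  destruct (He 1 Rlt_0_1) as [N HN].
  pose (K := 2 * (e N + 1) / r ^ 2).
  assert (HK : 0 <= K) by (apply Rdiv_le_0_compat; [generalize (e0 N); lra|apply pow_lt; lra]).
  destruct (proj1 (is_C_derive_eps (g N) p (d' N)) (Hd' N) (eps / 2) ltac:(lra)) as [del [Hdel L]].
  exists (Rmin (Rmin del (r / 2)) (eps / (2 * (K + 1)))). split.
  { repeat apply Rmin_pos; try lra. apply Rdiv_lt_0_compat; lra. }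
  intros w Hw.
  assert (H3 := Rlt_le_trans _ _ _ Hw (Rmin_r _ _)).
  assert (Hw' := Rlt_le_trans _ _ _ Hw (Rmin_l _ _)).
  assert (H1 := Rlt_le_trans _ _ _ Hw' (Rmin_l _ _)).
  assert (H2 := Rlt_le_trans _ _ _ Hw' (Rmin_r _ _)).
  specialize (L w H1). set (h := (w - p)%C) in *.
  assert (Hwd : disc p R0 w) by (unfold disc; fold h; lra).
  assert (B : Cmod ((f w - f p - d * h) - (g N w - g N p - d' N * h)) <= K * Cmod h ^ 2).
  { apply (tends_bound eventually (fun m => g m w - g m p - d' m * h)%C).
    - apply (tends_minus eventually); [apply (tends_minus eventually); apply gp; assumption|].
      apply (tends_ext eventually (fun m => h * d' m)%C); [exists 0%nat; intros; ring|].
      rewrite (Cmult_comm d). now apply (tends_scal eventually).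
    - exists N. intros m Hm. destruct (D N m) as [_ X]. specialize (X h ltac:(lra)).
      replace (p + h)%C with w in X by (unfold h; ring).
      replace (g m w - g m p - d' m * h - (g N w - g N p - d' N * h))%C with
        (g m w - g N w - (g m p - g N p) - (d' m - d' N) * h)%C by ring.
      eapply Rle_trans; [exact X|]. apply Rmult_le_compat_r; [apply pow2_ge_0|].
      unfold K. apply Rmult_le_compat_r; [apply Rlt_le, Rinv_0_lt_compat, pow_lt; lra|].
      specialize (HN m Hm). lra. }
  assert (T := Cmod_le_add (f w - f p - d * h) (g N w - g N p - d' N * h)).
  assert (Gh := Cmod_ge_0 h).
  assert (K * Cmod h ^ 2 <= eps / 2 * Cmod h).
  { apply (Rmult_lt_compat_r (K + 1)) in H3; [|lra].
    replace (eps / (2 * (K + 1)) * (K + 1)) with (eps / 2) in H3 by (field; lra). nra. }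
  lra.
Qed.

(** * Complex powers and the double difference *)

Lemma Cmod_sqr (w : C) : Cmod w * Cmod w = Re w ^ 2 + Im w ^ 2.
Proof. unfold Cmod. rewrite sqrt_sqrt; [reflexivity|]. generalize (pow2_ge_0 (fst w)) (pow2_ge_0 (snd w)); lra. Qed.

Lemma Cmod_pos_Re (w : C) : 0 < Re w -> 0 < Cmod w.
Proof. intros H. eapply Rlt_le_trans; [exact H|]. eapply Rle_trans; [apply Rle_abs|apply re_le_Cmod]. Qed.

Lemma neq_0_Re (w : C) : 0 < Re w -> w <> 0%C.
Proof. intros H. apply Cmod_gt_0. now apply Cmod_pos_Re. Qed.

(** In the right half-plane, where all lattice points lie, this form of the argument is free of the
    case distinction along the real axis and can be differentiated. *)
Lemma Carg_atan (w : C) : 0 < Re w -> Carg w = atan (Im w / Re w).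
Proof.
  intros H. assert (P := Cmod_pos_Re w H).
  assert (Q : 0 < Re w / Cmod w) by now apply Rdiv_lt_0_compat.
  assert (E : acos (Re w / Cmod w) = atan (Rabs (Im w) / Re w)).
  { rewrite acos_atan by exact Q. f_equal.
    assert (S : sqrt (1 - (Re w / Cmod w)²) = Rabs (Im w) / Cmod w).
    { replace (1 - (Re w / Cmod w)²) with ((Rabs (Im w) / Cmod w)²).
      - apply sqrt_Rsqr. apply Rdiv_le_0_compat; [apply Rabs_pos|exact P].
      - rewrite !Rsqr_div', <- Rsqr_abs. unfold Rsqr.
        replace (Im w * Im w) with (Cmod w * Cmod w - Re w * Re w) by (rewrite Cmod_sqr; ring).
        field. lra. }
    rewrite S. field. lra. }
  unfold Carg. destruct (Rle_dec 0 (Im w)) as [h|h]; rewrite E.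
  - rewrite Rabs_pos_eq by exact h. reflexivity.
  - rewrite Rabs_left by lra. rewrite <- atan_opp. f_equal. field. lra.
Qed.

Lemma Carg_bound (w : C) : Rabs (Carg w) <= PI.
Proof.
  unfold Carg. assert (H := acos_bound (Re w / Cmod w)).
  destruct Rle_dec; [|rewrite Rabs_Ropp]; rewrite Rabs_pos_eq; lra.
Qed.

Lemma Cexp_Clog (w : C) : 0 < Re w -> Cexp (Clog w) = w.
Proof.
  intros H. assert (P := Cmod_pos_Re w H). unfold Cexp, Clog. simpl.
  rewrite exp_ln by exact P. rewrite Carg_atan by exact H. rewrite cos_atan, sin_atan.
  assert (S : sqrt (1 + (Im w / Re w)²) = Cmod w / Re w).
  { replace (1 + (Im w / Re w)²) with ((Cmod w / Re w)²).
    - apply sqrt_Rsqr. apply Rdiv_le_0_compat; lra.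
    - rewrite !Rsqr_div'. unfold Rsqr. rewrite Cmod_sqr. field. lra. }
  rewrite S. destruct w as [x y]. simpl in *. f_equal; field; lra.
Qed.

Lemma is_derive_ln_norm (x y : R -> R) (t a b : R) : 0 < x t * x t + y t * y t ->
  is_derive x t a -> is_derive y t b ->
  is_derive (fun s => ln (sqrt (x s * x s + y s * y s))) t ((x t * a + y t * b) / (x t * x t + y t * y t)).
Proof.
  intros P A B.
  assert (DA : Derive (fun s => x s) t = a) by exact (is_derive_unique _ _ _ A).
  assert (DB : Derive (fun s => y s) t = b) by exact (is_derive_unique _ _ _ B).
  assert (S := sqrt_lt_R0 _ P).
  auto_derive.
  - repeat split; auto; eexists; eassumption.
  - rewrite DA, DB.
    assert (E := sqrt_sqrt _ (Rlt_le _ _ P)). set (q := sqrt _) in *.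
    replace ((x t * a + y t * b) / (x t * x t + y t * y t)) with ((x t * a + y t * b) / (q * q)) by (now rewrite E).
    field. lra.
Qed.

Lemma is_derive_atan_quot (x y : R -> R) (t a b : R) : 0 < x t ->
  is_derive x t a -> is_derive y t b ->
  is_derive (fun s => atan (y s / x s)) t ((x t * b - y t * a) / (x t * x t + y t * y t)).
Proof.
  intros P A B.
  assert (DA : Derive (fun s => x s) t = a) by exact (is_derive_unique _ _ _ A).
  assert (DB : Derive (fun s => y s) t = b) by exact (is_derive_unique _ _ _ B).
  auto_derive.
  - repeat split; try (eexists; eassumption). lra.
  - rewrite DA, DB. field. split; [nra|lra].
Qed.

Lemma Rder_Clog (g : R -> C) (t : R) (v : C) : 0 < Re (g t) -> Rder g t v ->
  Rder (fun s => Clog (g s)) t (v / g t)%C.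
Proof.
  intros Hp H. assert (A := Rder_Re _ _ _ H). assert (B := Rder_Im _ _ _ H).
  assert (P : 0 < Re (g t) * Re (g t) + Im (g t) * Im (g t)) by nra.
  assert (P' : fst (g t) * (fst (g t) * 1) + snd (g t) * (snd (g t) * 1) <> 0).
  { unfold Re, Im in P. lra. }
  apply Rder_pair.
  - apply (is_derive_ext (fun s => ln (sqrt (Re (g s) * Re (g s) + Im (g s) * Im (g s))))).
    { intros s. unfold Clog, Cmod, Re, Im. simpl. now rewrite !Rmult_1_r. }
    eapply is_derive_eq_R; [apply is_derive_ln_norm; eassumption|].
    unfold Cdiv, Cmult, Cinv, Re, Im in *. simpl. field; repeat split; lra.
  - apply (is_derive_ext_loc (fun s => atan (Im (g s) / Re (g s)))).
    { assert (Hc := ex_derive_continuous _ _ (ex_intro _ _ A)).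
      generalize (Hc _ (open_gt 0 _ Hp)). unfold filtermap. apply filter_imp.
      intros s Hs. symmetry. unfold Clog. simpl. now apply Carg_atan. }
    eapply is_derive_eq_R; [apply is_derive_atan_quot; eassumption|].
    unfold Cdiv, Cmult, Cinv, Re, Im in *. simpl. field; repeat split; lra.
Qed.

Lemma Cpower_pred (w s : C) : 0 < Re w -> (w * Cpower w (s - 1))%C = Cpower w s.
Proof.
  intros H. unfold Cpower. rewrite <- (Cexp_Clog w H) at 1. rewrite <- Cexp_add. f_equal. ring.
Qed.

Lemma Rder_Cpower (g : R -> C) (s : C) (t : R) (v : C) : 0 < Re (g t) -> Rder g t v ->
  Rder (fun u => Cpower (g u) s) t (v * s * Cpower (g t) (s - 1))%C.
Proof.
  intros Hp H. eapply Rder_eq.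
  - unfold Cpower at 1. apply (Rder_Cexp (fun u => s * Clog (g u))%C).
    apply Rder_mult; [apply Rder_const|]. apply Rder_Clog; [exact Hp|exact H].
  - cbv beta. fold (Cpower (g t) s). rewrite <- (Cpower_pred (g t) s Hp). field. now apply neq_0_Re.
Qed.

Lemma is_C_derive_Cpower (w z : C) (f : C -> C) (d : C) : is_C_derive f z d ->
  is_C_derive (fun s => Cpower w (f s)) z (d * Clog w * Cpower w (f z))%C.
Proof.
  intros H. eapply is_C_derive_eq.
  - unfold Cpower at 1. apply (is_C_derive_comp Cexp (fun s => f s * Clog w)%C); [apply is_C_derive_Cexp|].
    apply (is_C_derive_mult f (fun _ => Clog w)); [exact H|apply is_C_derive_const].
  - cbv beta. unfold Cpower. ring.
Qed.

Lemma Cmod_Cpower_le (w s : C) :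
  Cmod (Cpower w s) <= exp (PI * Rabs (Im s)) * exp (Re s * ln (Cmod w)).
Proof.
  unfold Cpower. rewrite Cmod_Cexp, re_mult. unfold Clog. simpl.
  rewrite <- exp_plus. apply exp_le.
  assert (A := Carg_bound w). assert (B := Rle_abs (- (Im s * Carg w))).
  rewrite Rabs_Ropp, Rabs_mult in B. assert (D := Rabs_pos (Im s)). nra.
Qed.

(* [phi j z] is the [j]-th derivative of [w ^ (2 - z)] with respect to [w]. *)
Fixpoint fallc (j : nat) (z : C) : C :=
  match j with O => RtoC 1 | S k => (fallc k z * (2 - z - INR k))%C end.

Definition phi (j : nat) (z w : C) : C := (fallc j z * Cpower w (2 - z - INR j))%C.

Lemma Rder_phi (j : nat) (z w h : C) (t : R) : 0 < Re (w + t * h)%C ->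
  Rder (fun u => phi j z (w + u * h)%C) t (h * phi (S j) z (w + t * h))%C.
Proof.
  intros Hp. unfold phi. eapply Rder_eq.
  - apply Rder_mult; [apply Rder_const|].
    apply (Rder_Cpower (fun u => w + u * h)%C); [exact Hp|apply Rder_line].
  - cbv beta. simpl fallc. rewrite S_INR, RtoC_plus.
    replace (2 - z - (INR j + 1))%C with (2 - z - INR j - 1)%C by ring. ring.
Qed.

(** The condition [0 <= Re h] keeps the segment from [w] to [w + h] inside the half-plane on which
    the highest derivative is bounded. *)
Lemma phi_taylor (n j : nat) (z w h : C) (B : R) : 0 < Re w -> 0 <= Re h ->
  (forall w', Re w <= Re w' -> Cmod (phi (j + n) z w') <= B) ->
  Cmod (phi j z (w + h) - Csum (fun k => h ^ k / INR (fact k) * phi (j + k) z w) n)%C <= Cmod h ^ n * B.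
Proof.
  intros Hw Hh HB.
  assert (Hre : forall t, 0 <= t -> Re w <= Re (w + t * h)%C).
  { intros t Ht. rewrite re_plus, re_scal_l. nra. }
  assert (T := taylor_C n (fun k t => h ^ k * phi (j + k) z (w + t * h))%C (Cmod h ^ n * B)).
  cbv beta in T. rewrite Nat.add_0_r in T.
  replace (w + 1%R * h)%C with (w + h)%C in T by ring.
  replace (h ^ 0 * phi j z (w + h))%C with (phi j z (w + h))%C in T by (simpl; ring).
  rewrite (Csum_ext _ (fun k => RtoC (/ INR (fact k)) * (h ^ k * phi (j + k) z (w + 0%R * h))))%C.
  - apply T.
    + intros k t Ht. rewrite Nat.add_succ_r. eapply Rder_eq.
      * apply Rder_mult; [apply Rder_const|]. apply Rder_phi.
        eapply Rlt_le_trans; [exact Hw|apply Hre; lra].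
      * cbn [Cpow]. cbv beta. ring.
    + intros t Ht. rewrite Cmod_mult, Cmod_pow. apply Rmult_le_compat_l; [apply pow_le, Cmod_ge_0|].
      apply HB. apply Hre. lra.
  - intros k _. replace (w + 0%R * h)%C with w by ring.
    rewrite RtoC_inv by apply INR_fact_neq_0. unfold Cdiv. ring.
Qed.

Definition DD (c : C) (A : C -> C) (w : C) : C :=
  (A (w + (c + 1)) - A (w + c) - A (w + 1) + A w)%C.

Lemma DD_plus (c : C) (A B : C -> C) (w : C) :
  DD c (fun v => A v + B v)%C w = (DD c A w + DD c B w)%C.
Proof. unfold DD. ring. Qed.

Lemma DD_scal (c k : C) (A : C -> C) (w : C) : DD c (fun v => k * A v)%C w = (k * DD c A w)%C.
Proof. unfold DD. ring. Qed.

Lemma DD_Csum (c : C) (A : nat -> C -> C) (w : C) (n : nat) :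
  DD c (fun v => Csum (fun k => A k v) n) w = Csum (fun k => DD c (A k) w) n.
Proof.
  induction n as [|n IH]; simpl.
  - unfold DD. ring.
  - rewrite (DD_plus c (fun v => Csum (fun k => A k v) n)), IH. reflexivity.
Qed.

(* Coefficients of (e^{cD} - 1) (e^D - 1) / D^2. *)
Definition dcoef (c : C) (k : nat) : C :=
  (((c + 1) ^ (k + 2) - c ^ (k + 2) - 1) / INR (fact (k + 2)))%C.

Lemma RtoC_fact_neq_0 (k : nat) : RtoC (INR (fact k)) <> 0%C.
Proof. intros E. apply RtoC_inj in E. now apply INR_fact_neq_0 in E. Qed.

(** Taylor's formula for the three shifts; the terms of orders 0 and 1 cancel in the double
    difference, so the expansion starts with the second derivative, whence the [+ 2]. *)
Lemma DD_phi (c : C) (m j : nat) (z w : C) (B : R) : 0 <= Re c -> 0 < Re w ->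
  (forall w', Re w <= Re w' -> Cmod (phi (j + (m + 2)) z w') <= B) ->
  Cmod (DD c (phi j z) w - Csum (fun k => dcoef c k * phi (j + (k + 2)) z w) m)%C
    <= (Cmod (c + 1) ^ (m + 2) + Cmod c ^ (m + 2) + 1) * B.
Proof.
  intros Hc Hw HB.
  assert (Hc1 : 0 <= Re (c + 1)%C) by (rewrite re_plus; simpl; lra).
  assert (H1 : 0 <= Re 1) by (simpl; lra).
  assert (T1 := phi_taylor (m + 2) j z w (c + 1)%C B Hw Hc1 HB).
  assert (T2 := phi_taylor (m + 2) j z w c B Hw Hc HB).
  assert (T3 := phi_taylor (m + 2) j z w 1%C B Hw H1 HB).
  rewrite Cmod_1, pow1, Rmult_1_l in T3.
  assert (E : Csum (fun k => dcoef c k * phi (j + (k + 2)) z w)%C m =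
    (Csum (fun k => (c + 1) ^ k / INR (fact k) * phi (j + k) z w) (m + 2)
     - Csum (fun k => c ^ k / INR (fact k) * phi (j + k) z w) (m + 2)
     - Csum (fun k => 1 ^ k / INR (fact k) * phi (j + k) z w) (m + 2) + phi j z w)%C).
  { rewrite <- !Csum_minus, !(Nat.add_comm m 2). change (2 + m)%nat with (S (S m)).
    rewrite !Csum_shift.
    rewrite (Csum_ext _ (fun k => (c + 1) ^ S (S k) / INR (fact (S (S k))) * phi (j + S (S k)) z w -
       c ^ S (S k) / INR (fact (S (S k))) * phi (j + S (S k)) z w -
       1 ^ S (S k) / INR (fact (S (S k))) * phi (j + S (S k)) z w)%C).
    - rewrite Nat.add_0_r. simpl. field.
    - intros k _. unfold dcoef. rewrite !Nat.add_succ_r, !Nat.add_0_r.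
      rewrite (Cpow_1_l). field. apply RtoC_fact_neq_0. }
  rewrite E. unfold DD.
  match type of T1 with Cmod ?X <= _ => match type of T2 with Cmod ?Y <= _ => match type of T3 with Cmod ?Z <= _ =>
    match goal with |- Cmod ?G <= _ => replace G with (X - Y - Z)%C by ring end end end end.
  eapply Rle_trans; [apply Cmod_minus_le|].
  eapply Rle_trans; [apply Rplus_le_compat_r, Cmod_minus_le|]. lra.
Qed.

(** * Regularized double series *)

Definition rect (u : nat -> nat -> C) (L N : nat) : C := Csum (fun l => Csum (fun n => u l n) N) L.

(* [wt n] is [(n + 1) ^ (- 5 / 4)]: by AM-GM, [|c l + n| ^ (- 5 / 2)] is at most a constant times [wt l * wt n]. *)
Definition wt (n : nat) : R := exp (- (5 / 4) * ln (INR (S n))).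

(** The integral of x^(-5/4) over [n, oo), which bounds the tail of the weights from index [n] on.
    At [n = 0] it takes a default value of [ln] and bounds nothing, whence the positivity conditions
    below. *)
Definition wtail (n : nat) : R := 4 * exp (- (1 / 4) * ln (INR n)).

Lemma wt_pos (n : nat) : 0 < wt n.
Proof. apply exp_pos. Qed.

Lemma wtail_pos (n : nat) : 0 < wtail n.
Proof. unfold wtail. generalize (exp_pos (- (1 / 4) * ln (INR n))). lra. Qed.

(** With [u] and [v] the fourth roots of [n] and [n + 1] the comparison is algebraic: it follows
    from [v ^ 4 - u ^ 4 = 1] and [v - u >= 1 / (4 v ^ 3)]. *)
Lemma wt_telescope (n : nat) : (0 < n)%nat -> wt n <= wtail n - wtail (S n).
Proof.
  intros Hn. assert (P : 0 < INR n) by now apply lt_0_INR.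
  assert (P1 : 0 < INR (S n)) by (apply lt_0_INR; lia).
  pose (u := exp (1 / 4 * ln (INR n))). pose (v := exp (1 / 4 * ln (INR (S n)))).
  assert (Hu : 0 < u) by apply exp_pos. assert (Hv : 0 < v) by apply exp_pos.
  assert (u4 : u ^ 4 = INR n).
  { replace (u ^ 4) with (u * u * u * u) by ring. unfold u. rewrite <- !exp_plus.
    transitivity (exp (ln (INR n))); [f_equal; field|now apply exp_ln]. }
  assert (v4 : v ^ 4 = INR (S n)).
  { replace (v ^ 4) with (v * v * v * v) by ring. unfold v. rewrite <- !exp_plus.
    transitivity (exp (ln (INR (S n)))); [f_equal; field|now apply exp_ln]. }
  assert (Huv : u <= v).
  { apply exp_le. assert (ln (INR n) <= ln (INR (S n))); [|lra].
    apply Rlt_le, ln_increasing; [exact P|apply lt_INR; lia]. }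
  assert (Ew : wt n = / v ^ 5).
  { replace (v ^ 5) with (v * v * v * v * v) by ring. unfold wt, v. rewrite <- !exp_plus, <- exp_Ropp. f_equal. field. }
  assert (E1 : wtail n = 4 * / u) by (unfold wtail, u; rewrite <- exp_Ropp; do 2 f_equal; field).
  assert (E2 : wtail (S n) = 4 * / v) by (unfold wtail, v; rewrite <- exp_Ropp; do 2 f_equal; field).
  rewrite Ew, E1, E2.
  assert (D : (v - u) * ((v + u) * (v * v + u * u)) = 1).
  { replace ((v - u) * ((v + u) * (v * v + u * u))) with (v ^ 4 - u ^ 4) by ring.
    rewrite u4, v4, S_INR. ring. }
  assert (D2 : (v + u) * (v * v + u * u) <= 4 * v ^ 3).
  { replace (4 * v ^ 3) with ((v + v) * (v * v + v * v)) by ring.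
    apply Rmult_le_compat; try nra. }
  assert (D3 : 1 <= (v - u) * (4 * v ^ 3)) by (rewrite <- D; apply Rmult_le_compat_l; lra).
  replace (4 * / u - 4 * / v) with ((v - u) * (4 * v ^ 3) * / (v ^ 4 * u)) by (field; lra).
  apply Rle_trans with (1 * / (v ^ 4 * u)).
  - rewrite Rmult_1_l. apply Rinv_le_contravar.
    + apply Rmult_lt_0_compat; [now apply pow_lt|exact Hu].
    + replace (v ^ 5) with (v ^ 4 * v) by ring. apply Rmult_le_compat_l; [apply pow_le; lra|exact Huv].
  - apply Rmult_le_compat_r; [|exact D3].
    apply Rlt_le, Rinv_0_lt_compat, Rmult_lt_0_compat; [now apply pow_lt|exact Hu].
Qed.

Lemma Rsum_wt_tail (n m : nat) : (0 < n <= m)%nat -> 0 <= Rsum wt m - Rsum wt n <= wtail n.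
Proof.
  intros [Hn Hm].
  assert (H : 0 <= Rsum wt m - Rsum wt n <= wtail n - wtail m).
  { induction Hm as [|m Hm IH]; [lra|]. simpl.
    assert (T := wt_telescope m ltac:(lia)). assert (W := wt_pos m). lra. }
  generalize (wtail_pos m). lra.
Qed.

(** The bound is [wt 0 = 1] plus [wtail 1 = 4]. *)
Lemma Rsum_wt_le (n : nat) : 0 <= Rsum wt n <= 5.
Proof.
  destruct n as [|n]; [simpl; lra|].
  assert (T := Rsum_wt_tail 1 (S n) ltac:(lia)).
  assert (E : Rsum wt 1 = 1) by (simpl; unfold wt; simpl; rewrite ln_1, Rmult_0_r, exp_0; ring).
  assert (E2 : wtail 1 = 4) by (unfold wtail; simpl; rewrite ln_1, Rmult_0_r, exp_0; ring).
  lra.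
Qed.

Lemma exp_ln_small (s : R) (eps : R) : 0 < s -> 0 < eps -> exists X, 1 <= X /\ forall x, X <= x -> exp (- s * ln x) < eps.
Proof.
  intros Hs He. exists (Rmax 1 (exp (- ln eps / s + 1))). split; [apply Rmax_l|].
  intros x Hx. assert (H1 := Rle_trans _ _ _ (Rmax_r _ _) Hx).
  assert (Hlx : - ln eps / s + 1 <= ln x).
  { rewrite <- (ln_exp (- ln eps / s + 1)).
    destruct H1 as [H1| <-]; [|lra]. apply Rlt_le, ln_increasing; [apply exp_pos|exact H1]. }
  rewrite <- (exp_ln eps) at 1 by exact He. apply exp_increasing.
  apply Ropp_lt_cancel. rewrite Ropp_mult_distr_l, Ropp_involutive.
  apply Rlt_le_trans with (s * (- ln eps / s + 1)); [|apply Rmult_le_compat_l; lra].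
  replace (s * (- ln eps / s + 1)) with (- ln eps + s) by (field; lra). lra.
Qed.

Lemma wtail_small (eps : R) : 0 < eps -> eventually (fun n => wtail n < eps).
Proof.
  intros He. destruct (exp_ln_small (1 / 4) (eps / 4) ltac:(lra) ltac:(lra)) as [X [_ HX]].
  destruct (nfloor_ex (Rmax X 0)) as [N [_ HN]]; [apply Rmax_r|].
  exists (S N). intros n Hn. unfold wtail.
  assert (Q : X <= INR n).
  { apply Rle_trans with (INR (S N)); [|now apply le_INR]. rewrite S_INR.
    generalize (Rmax_l X 0). lra. }
  specialize (HX _ Q). lra.
Qed.

Lemma rect_bound_l (u : nat -> nat -> C) (Q : R) (L k N : nat) : 0 <= Q ->
  (forall l n, Cmod (u l n) <= Q * (wt l * wt n)) ->
  Cmod (rect u (L + k) N - rect u L N) <= Q * 5 * (Rsum wt (L + k) - Rsum wt L).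
Proof.
  intros HQ Hu. induction k as [|k IH].
  - rewrite Nat.add_0_r. replace (rect u L N - rect u L N)%C with (RtoC 0) by ring. rewrite Cmod_0. lra.
  - rewrite Nat.add_succ_r. unfold rect in *. simpl Csum. simpl Rsum.
    match goal with |- Cmod (?A + ?B - ?D) <= _ => replace (A + B - D)%C with ((A - D) + B)%C by ring end.
    eapply Rle_trans; [apply Cmod_triangle|].
    assert (K : Cmod (Csum (fun n => u (L + k)%nat n) N) <= Q * wt (L + k) * 5).
    { apply Rle_trans with (Rsum (fun n => Q * (wt (L + k) * wt n)) N).
      - apply Cmod_Csum_le. intros; apply Hu.
      - assert (E : forall a n, Rsum (fun n => Q * (a * wt n)) n = Q * a * Rsum wt n).
        { intros a n. induction n as [|n IHn]; simpl; [|rewrite IHn]; ring. }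
        rewrite E. apply Rmult_le_compat_l; [|apply Rsum_wt_le].
        apply Rmult_le_pos; [exact HQ|apply Rlt_le, wt_pos]. }
    lra.
Qed.

Lemma rect_swap (u : nat -> nat -> C) (L N : nat) : rect u L N = rect (fun n l => u l n) N L.
Proof. apply Csum_swap. Qed.

(** The limit is found along squares, and any rectangle is compared with a large square containing
    it. The rate depends on [u] only through [Q], which later makes the convergence uniform on discs
    in z. *)
Lemma rect_limit (u : nat -> nat -> C) (Q : R) : 0 <= Q ->
  (forall l n, Cmod (u l n) <= Q * (wt l * wt n)) ->
  exists s, forall L N, (0 < L)%nat -> (0 < N)%nat ->
    Cmod (s - rect u L N) <= 5 * Q * (wtail L + wtail N).
Proof.
  intros HQ Hu.
  assert (B : forall L N k j, (0 < L)%nat -> (0 < N)%nat ->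
    Cmod (rect u (L + k) (N + j) - rect u L N) <= 5 * Q * (wtail L + wtail N)).
  { intros L N k j HL HN.
    replace (rect u (L + k) (N + j) - rect u L N)%C with
      ((rect u (L + k) (N + j) - rect u L (N + j)) + (rect u L (N + j) - rect u L N))%C by ring.
    eapply Rle_trans; [apply Cmod_triangle|].
    rewrite Rmult_plus_distr_l. apply Rplus_le_compat.
    - eapply Rle_trans; [now apply rect_bound_l with (Q := Q)|].
      rewrite (Rmult_comm Q). apply Rmult_le_compat_l; [lra|]. apply Rsum_wt_tail. lia.
    - rewrite (rect_swap u L (N + j)), (rect_swap u L N).
      eapply Rle_trans; [apply rect_bound_l with (Q := Q); [exact HQ|intros; rewrite (Rmult_comm (wt l)); apply Hu]|].
      rewrite (Rmult_comm Q). apply Rmult_le_compat_l; [lra|]. apply Rsum_wt_tail. lia. }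
  destruct (cauchy_C (fun n => rect u (S n) (S n)) (fun n => 5 * Q * (wtail (S n) + wtail (S n)))) as [s Hs].
  - intros n m Hnm. replace (S m) with (S n + (m - n))%nat by lia. apply B; lia.
  - intros eps He. destruct (wtail_small (eps / (10 * (Q + 1)))) as [N HN].
    { apply Rdiv_lt_0_compat; lra. }
    exists N. intros n Hn. specialize (HN (S n) ltac:(lia)).
    apply (Rmult_lt_compat_r (10 * (Q + 1))) in HN; [|lra].
    replace (eps / (10 * (Q + 1)) * (10 * (Q + 1))) with eps in HN by (field; lra).
    assert (W := wtail_pos (S n)). nra.
  - exists s. intros L N HL HN. apply le_epsilon. intros eps He.
    destruct (wtail_small (eps / (10 * (Q + 1)))) as [K HK].
    { apply Rdiv_lt_0_compat; lra. }
    pose (m := Nat.max K (Nat.max L N)).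
    specialize (HK (S m) ltac:(unfold m; lia)). specialize (Hs m). cbv beta in Hs.
    apply (Rmult_lt_compat_r (10 * (Q + 1))) in HK; [|lra].
    replace (eps / (10 * (Q + 1)) * (10 * (Q + 1))) with eps in HK by (field; lra).
    specialize (B L N (S m - L)%nat (S m - N)%nat HL HN).
    replace (L + (S m - L))%nat with (S m) in B by (unfold m; lia).
    replace (N + (S m - N))%nat with (S m) in B by (unfold m; lia).
    replace (s - rect u L N)%C with ((s - rect u (S m) (S m)) + (rect u (S m) (S m) - rect u L N))%C by ring.
    eapply Rle_trans; [apply Cmod_triangle|].
    assert (W := wtail_pos (S m)). nra.
Qed.

(** * Reciprocal coefficients and the remainder of the double difference *)

(* Course-of-values recursion: [bpref c n] is the sequence of coefficients, correct up to index [n]. *)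
Fixpoint bpref (c : C) (n : nat) : nat -> C :=
  match n with
  | O => fun _ => (/ c)%C
  | S m => fun k => if Nat.leb k m then bpref c m k else
      (- Csum (fun j => bpref c m j * dcoef c (S m - j)) (S m) / c)%C
  end.

(* Coefficients of the reciprocal power series D^2 / ((e^{cD} - 1) (e^D - 1)). *)
Definition bcoef (c : C) (k : nat) : C := bpref c k k.

Lemma bpref_stable (c : C) (n k : nat) : (k <= n)%nat -> bpref c n k = bcoef c k.
Proof.
  intros H. induction n as [|n IH].
  - replace k with 0%nat by lia. reflexivity.
  - destruct (Nat.eq_dec k (S n)) as [->|Hne]; [reflexivity|].
    simpl. replace (Nat.leb k n) with true by (symmetry; apply Nat.leb_le; lia). apply IH. lia.
Qed.

Lemma dcoef_0 (c : C) : dcoef c 0 = c.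
Proof. unfold dcoef. simpl. replace (1 + 1)%R with 2 by ring. field. Qed.

Lemma bcoef_S (c : C) (m : nat) :
  bcoef c (S m) = (- Csum (fun j => bcoef c j * dcoef c (S m - j)) (S m) / c)%C.
Proof.
  unfold bcoef at 1. cbn [bpref].
  replace (Nat.leb (S m) m) with false by (symmetry; apply Nat.leb_gt; lia).
  rewrite (Csum_ext _ (fun j => bcoef c j * dcoef c (S m - j))%C); [reflexivity|].
  intros k Hk. rewrite bpref_stable by lia. reflexivity.
Qed.

Lemma bcoef_conv (c : C) (m : nat) : c <> 0%C ->
  Csum (fun j => bcoef c j * dcoef c (m - j))%C (S m) = match m with O => RtoC 1 | _ => RtoC 0 end.
Proof.
  intros Hc. destruct m as [|m].
  - simpl. rewrite dcoef_0. unfold bcoef. simpl. field. exact Hc.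
  - change (Csum ?f (S (S m))) with (Csum f (S m) + f (S m))%C. cbv beta.
    rewrite Nat.sub_diag, dcoef_0, bcoef_S. field. exact Hc.
Qed.

Lemma Csum_triangle (F : nat -> nat -> C) (M : nat) :
  Csum (fun j => Csum (fun k => F j k) (M - j)) M = Csum (fun i => Csum (fun j => F j (i - j)%nat) (S i)) M.
Proof.
  induction M as [|M IH]; [reflexivity|].
  cbn [Csum]. cbn [Csum] in IH. rewrite <- IH.
  rewrite (Csum_ext (fun j => Csum (fun k => F j k) (S M - j))
    (fun j => Csum (fun k => F j k) (M - j) + F j (M - j)%nat)%C).
  - rewrite Csum_plus. replace (S M - M)%nat with 1%nat by lia. simpl.
    rewrite Nat.sub_diag. ring.
  - intros j Hj. replace (S M - j)%nat with (S (M - j)) by lia. reflexivity.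
Qed.

Definition gsum (c : C) (M : nat) (z w : C) : C := Csum (fun j => bcoef c j * phi j z w)%C M.

(* As [bcoef] inverts [dcoef], all the Taylor terms of [phi 2 z w - DD c (gsum c M z) w] below order [M + 2] cancel,
   and [rterm] is of the order of [w ^ (- z - M)]. *)
Definition rterm (c : C) (M : nat) (z w : C) : C := (phi 2 z w - DD c (gsum c M z) w)%C.

Lemma DD_gsum (c : C) (M : nat) (z w : C) :
  DD c (gsum c M z) w = Csum (fun j => bcoef c j * DD c (phi j z) w)%C M.
Proof.
  unfold gsum. rewrite (DD_Csum c (fun j v => bcoef c j * phi j z v)%C).
  apply Csum_ext. intros k _. apply DD_scal.
Qed.

Definition rconst (c : C) (M : nat) : R :=
  Rsum (fun j => Cmod (bcoef c j) * (Cmod (c + 1) ^ (M - j + 2) + Cmod c ^ (M - j + 2) + 1)) M.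

Lemma rconst_pos (c : C) (M : nat) : 0 <= rconst c M.
Proof.
  unfold rconst. generalize M at 1 2 as m. intros m. induction M as [|M IH]; simpl; [lra|].
  apply Rplus_le_le_0_compat; [exact IH|].
  apply Rmult_le_pos; [apply Cmod_ge_0|].
  assert (0 <= Cmod (c + 1) ^ (m - M + 2)) by (apply pow_le, Cmod_ge_0).
  assert (0 <= Cmod c ^ (m - M + 2)) by (apply pow_le, Cmod_ge_0). lra.
Qed.

(** By [bcoef_conv], [phi 2] is the sum over [j] of [bcoef c j] times the expansion of
    [DD c (phi j)] truncated at [M - j] terms. With this truncation the error for each [j] involves
    the same derivative, of order [M + 2]. *)
Lemma rterm_bound (c : C) (M : nat) (z w : C) (B : R) : c <> 0%C -> 0 <= Re c -> 0 < Re w -> (0 < M)%nat ->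
  (forall w', Re w <= Re w' -> Cmod (phi (M + 2) z w') <= B) ->
  Cmod (rterm c M z w) <= rconst c M * B.
Proof.
  intros Hc0 Hc Hw HM HB.
  assert (E : phi 2 z w = Csum (fun j => bcoef c j * Csum (fun k => dcoef c k * phi (j + (k + 2)) z w) (M - j))%C M).
  { rewrite (Csum_ext _ (fun j => Csum (fun k => bcoef c j * (dcoef c k * phi (j + (k + 2)) z w)) (M - j))%C)
      by (intros; now rewrite Csum_scal).
    rewrite (Csum_triangle (fun j k => bcoef c j * (dcoef c k * phi (j + (k + 2)) z w))%C).
    rewrite (Csum_ext _ (fun i => (match i with O => RtoC 1 | _ => RtoC 0 end) * phi (i + 2) z w)%C).
    - destruct M as [|M]; [lia|]. rewrite Csum_shift. rewrite (Csum_ext _ (fun _ => RtoC 0)); [|intros; ring].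
      rewrite Csum_0. simpl Nat.add. ring.
    - intros i _. rewrite <- (bcoef_conv c i Hc0), Cmult_comm, <- Csum_scal. apply Csum_ext.
      intros j Hj. replace (j + (i - j + 2))%nat with (i + 2)%nat by lia. ring. }
  unfold rterm. rewrite E, DD_gsum, <- Csum_minus.
  unfold rconst.
  apply Rle_trans with (Rsum (fun j => Cmod (bcoef c j) * (Cmod (c + 1) ^ (M - j + 2) + Cmod c ^ (M - j + 2) + 1) * B) M).
  - apply Cmod_Csum_le. intros j Hj.
    match goal with |- Cmod (?b * ?X - ?b * ?Y) <= _ => replace (b * X - b * Y)%C with (b * (X - Y))%C by ring end.
    rewrite Cmod_mult, Rmult_assoc. apply Rmult_le_compat_l; [apply Cmod_ge_0|].
    rewrite Cmod_minus_sym. apply DD_phi; auto.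
    replace (j + (M - j + 2))%nat with (M + 2)%nat by lia. exact HB.
  - right. generalize M at 1 2 4 5 as m. intros m. clear. induction M as [|M IH]; simpl; [ring|]. rewrite IH. ring.
Qed.

(** * Lattice points and bounds uniform in z *)

Definition pt (c : C) (l n : nat) : C := (c * INR (S l) + INR (S n))%C.

Lemma Re_pt (c : C) (l n : nat) : Re (pt c l n) = Re c * INR (S l) + INR (S n).
Proof. unfold pt. rewrite re_plus, re_scal_r, re_RtoC. reflexivity. Qed.

Lemma Re_pt_ge (c : C) (l n : nat) : 0 <= Re c -> INR (S n) <= Re (pt c l n).
Proof. intros H. rewrite Re_pt. assert (0 <= INR (S l)) by apply pos_INR. nra. Qed.

Lemma INR_S_ge (n : nat) : 1 <= INR (S n).
Proof. rewrite S_INR. generalize (pos_INR n). lra. Qed.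

Lemma fallc_bound (j : nat) (z : C) (rho : R) : Cmod z <= rho -> Cmod (fallc j z) <= (2 + rho + INR j) ^ j.
Proof.
  intros Hz. assert (G := Cmod_ge_0 z). induction j as [|j IH].
  - simpl. rewrite Cmod_1. lra.
  - cbn [fallc]. rewrite Cmod_mult, <- tech_pow_Rmult, Rmult_comm.
    assert (J := pos_INR j).
    apply Rmult_le_compat; try apply Cmod_ge_0.
    + eapply Rle_trans; [apply Cmod_minus_le|]. rewrite Cmod_R, Rabs_pos_eq by exact J.
      eapply Rle_trans; [apply Rplus_le_compat_r, Cmod_minus_le|]. rewrite Cmod_R, Rabs_pos_eq by lra.
      rewrite S_INR. lra.
    + eapply Rle_trans; [exact IH|]. apply pow_incr. rewrite S_INR. lra.
Qed.

(** The exponent has real part [- (Re z + M)]. A double lattice sum needs decay beyond order 2, and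
    [5 / 2] leaves room for two factors of order [5 / 4 > 1], one for each index. *)
Lemma phi_bound (M : nat) (z w : C) (rho x : R) : Cmod z <= rho -> 5 / 2 <= Re z + INR M ->
  1 <= x -> x <= Re w ->
  Cmod (phi (M + 2) z w) <= (2 + rho + INR (M + 2)) ^ (M + 2) * exp (PI * rho) * exp (- (5 / 2) * ln x).
Proof.
  intros Hz HM Hx Hw. unfold phi. rewrite Cmod_mult, Rmult_assoc.
  apply Rmult_le_compat; try apply Cmod_ge_0; [now apply fallc_bound|].
  eapply Rle_trans; [apply Cmod_Cpower_le|].
  apply Rmult_le_compat; try (apply Rlt_le, exp_pos).
  - apply exp_le. apply Rmult_le_compat_l; [generalize PI_RGT_0; lra|].
    unfold Cminus. rewrite !im_plus, !im_opp, !im_RtoC.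
    replace (0 + - Im z + - 0) with (- Im z) by ring. rewrite Rabs_Ropp.
    eapply Rle_trans; [apply im_le_Cmod|exact Hz].
  - apply exp_le. unfold Cminus. rewrite !re_plus, !re_opp, !re_RtoC, plus_INR. simpl (INR 2).
    replace (2 + - Re z + - (INR M + (1 + 1))) with (- (Re z + INR M)) by ring.
    assert (L0 : 0 <= ln x).
    { rewrite <- ln_1. destruct Hx as [Hx| <-]; [|lra]. apply Rlt_le, ln_increasing; lra. }
    assert (L1 : ln x <= ln (Cmod w)).
    { assert (X : x <= Cmod w) by (eapply Rle_trans; [exact Hw|]; eapply Rle_trans; [apply Rle_abs|apply re_le_Cmod]).
      destruct X as [X|X]; [|rewrite X; lra]. apply Rlt_le, ln_increasing; lra. }
    nra.
Qed.

Lemma weight_bound (c : C) (l n : nat) : 0 < Re c ->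
  exp (- (5 / 2) * ln (Re (pt c l n))) <= exp (- (5 / 4) * ln (4 * Re c)) * (wt l * wt n).
Proof.
  intros Hc. unfold wt. rewrite <- !exp_plus. apply exp_le.
  assert (A := INR_S_ge l). assert (B := INR_S_ge n).
  assert (X : ln (4 * Re c) + ln (INR (S l)) + ln (INR (S n)) <= 2 * ln (Re (pt c l n))).
  { rewrite <- !ln_mult by nra.
    replace (2 * ln (Re (pt c l n))) with (ln (Re (pt c l n)) + ln (Re (pt c l n))) by ring.
    assert (P : 0 < Re (pt c l n)) by (rewrite Re_pt; nra).
    rewrite <- ln_mult by exact P. rewrite Re_pt.
    set (L := INR (S l)) in *. set (K := INR (S n)) in *.
    assert (H : 4 * Re c * L * K <= (Re c * L + K) * (Re c * L + K)).
    { assert (0 <= (Re c * L - K) ^ 2) by apply pow2_ge_0. nra. }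
    destruct H as [H|H]; [|rewrite H; lra]. apply Rlt_le, ln_increasing; [|exact H].
    repeat apply Rmult_lt_0_compat; lra. }
  lra.
Qed.

Definition Qb (c : C) (M : nat) (rho : R) : R :=
  rconst c M * ((2 + rho + INR (M + 2)) ^ (M + 2) * exp (PI * rho) * exp (- (5 / 4) * ln (4 * Re c))).

Lemma Qb_pos (c : C) (M : nat) (rho : R) : 0 <= rho -> 0 <= Qb c M rho.
Proof.
  intros Hr. unfold Qb. apply Rmult_le_pos; [apply rconst_pos|].
  repeat apply Rmult_le_pos; try (apply Rlt_le, exp_pos).
  apply pow_le. generalize (pos_INR (M + 2)); lra.
Qed.

Lemma rterm_pt_bound (c : C) (M : nat) (z : C) (rho : R) (l n : nat) : 0 < Re c -> (0 < M)%nat ->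
  Cmod z <= rho -> 5 / 2 <= Re z + INR M ->
  Cmod (rterm c M z (pt c l n)) <= Qb c M rho * (wt l * wt n).
Proof.
  intros Hc HM Hz HzM.
  assert (P : 1 <= Re (pt c l n)) by (eapply Rle_trans; [apply (INR_S_ge n)|apply Re_pt_ge; lra]).
  eapply Rle_trans.
  - apply (rterm_bound c M z (pt c l n)); [now apply neq_0_Re|lra|lra|exact HM|].
    intros w' Hw'. exact (phi_bound M z w' rho _ Hz HzM P Hw').
  - unfold Qb. rewrite !Rmult_assoc.
    apply Rmult_le_compat_l; [apply rconst_pos|].
    assert (0 <= rho) by (eapply Rle_trans; [apply Cmod_ge_0|exact Hz]).
    apply Rmult_le_compat_l; [apply pow_le; generalize (pos_INR (M + 2)); lra|].
    apply Rmult_le_compat_l; [apply Rlt_le, exp_pos|].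
    apply weight_bound. exact Hc.
Qed.

(* By telescoping, for [2 < Re z] the limit of [Psum c M L N z] is [(z - 1) * (z - 2)] times the double series. *)
Definition Psum (c : C) (M L N : nat) (z : C) : C :=
  (gsum c M z (c + 1) + rect (fun l n => rterm c M z (pt c l n)) L N)%C.

Lemma rect_DD (c : C) (A : C -> C) (L N : nat) :
  rect (fun l n => DD c A (pt c l n)) L N = (A (pt c L N) - A (pt c L 0) - A (pt c 0 N) + A (c + 1))%C.
Proof.
  assert (E0 : (c + 1)%C = pt c 0 0) by (unfold pt; simpl; ring). rewrite E0.
  assert (In : forall l, Csum (fun n => DD c A (pt c l n)) N =
     (A (pt c (S l) N) - A (pt c l N) - A (pt c (S l) 0) + A (pt c l 0))%C).
  { intros l. induction N as [|N IH].
    - simpl. ring.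
    - cbn [Csum]. rewrite IH. unfold DD.
      replace (pt c l N + (c + 1))%C with (pt c (S l) (S N)) by (unfold pt; rewrite (S_INR (S l)), (S_INR (S N)), !RtoC_plus; ring).
      replace (pt c l N + c)%C with (pt c (S l) N) by (unfold pt; rewrite (S_INR (S l)), !RtoC_plus; ring).
      replace (pt c l N + 1)%C with (pt c l (S N)) by (unfold pt; rewrite (S_INR (S N)), !RtoC_plus; ring).
      ring. }
  unfold rect. induction L as [|L IH].
  - simpl. ring.
  - cbn [Csum]. rewrite IH, In. ring.
Qed.

Lemma phi_small (j : nat) (z : C) (eps : R) : 2 < Re z + INR j -> 0 < eps ->
  exists X, 1 <= X /\ forall w, X <= Re w -> Cmod (phi j z w) < eps.
Proof.
  intros Hz He.
  pose (K := Cmod (fallc j z) * exp (PI * Rabs (Im (2 - z - INR j)%C)) + 1).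
  assert (K0 : 0 <= Cmod (fallc j z) * exp (PI * Rabs (Im (2 - z - INR j)%C))).
  { apply Rmult_le_pos; [apply Cmod_ge_0|apply Rlt_le, exp_pos]. }
  destruct (exp_ln_small (Re z + INR j - 2) (eps / K)) as [X [X1 HX]].
  - lra.
  - apply Rdiv_lt_0_compat; unfold K; lra.
  - exists X. split; [exact X1|]. intros w Hw.
    assert (Hw' : X <= Cmod w) by (eapply Rle_trans; [exact Hw|]; eapply Rle_trans; [apply Rle_abs|apply re_le_Cmod]).
    specialize (HX _ Hw'). unfold phi. rewrite Cmod_mult.
    apply (Rmult_lt_compat_l K) in HX; [|unfold K; lra].
    replace (K * (eps / K)) with eps in HX by (field; unfold K; lra).
    eapply Rle_lt_trans; [|exact HX].
    eapply Rle_trans; [apply Rmult_le_compat_l; [apply Cmod_ge_0|apply Cmod_Cpower_le]|].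
    rewrite <- Rmult_assoc.
    replace (Re (2 - z - INR j)%C) with (- (Re z + INR j - 2)).
    + apply Rmult_le_compat_r; [apply Rlt_le, exp_pos|unfold K; lra].
    + unfold Cminus. rewrite !re_plus, !re_opp, !re_RtoC. ring.
Qed.

Lemma INR_large (X : R) : eventually (fun n => X <= INR n).
Proof.
  destruct (nfloor_ex (Rmax X 0)) as [N [_ HN]]; [apply Rmax_r|].
  exists (S N). intros n Hn. apply Rle_trans with (INR (S N)); [|now apply le_INR].
  rewrite S_INR. generalize (Rmax_l X 0). lra.
Qed.

Definition two_index : (nat * nat -> Prop) -> Prop := filter_prod eventually eventually.

Lemma two_index_and (P Q : nat -> Prop) : eventually P -> eventually Q ->
  two_index (fun p => P (fst p) /\ Q (snd p)).
Proof. intros HP HQ. apply (Filter_prod _ _ _ P Q HP HQ). auto. Qed.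

(* The boundary terms left over by telescoping a rectangular sum of [DD c A]. *)
Definition bdry (c : C) (A : C -> C) (p : nat * nat) : C :=
  (A (pt c (fst p) (snd p)) - A (pt c (fst p) 0) - A (pt c 0 (snd p)))%C.

Lemma bdry_phi (c : C) (j : nat) (z : C) : 0 < Re c -> 2 < Re z + INR j ->
  tends two_index (bdry c (phi j z)) 0.
Proof.
  intros Hc Hz eps He.
  destruct (phi_small j z (eps / 3) Hz ltac:(lra)) as [X [X1 HX]].
  generalize (two_index_and _ _ (INR_large (X / Re c)) (INR_large X)).
  apply filter_imp. intros [L N] [HL HN]. unfold bdry. simpl fst in *. simpl snd in *.
  assert (HL' : X <= Re c * INR L).
  { apply (Rmult_le_compat_l (Re c)) in HL; [|lra]. replace (Re c * (X / Re c)) with X in HL by (field; lra). exact HL. }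
  assert (GL := INR_S_ge L). assert (GN := INR_S_ge N). assert (PL := pos_INR L).
  assert (A1 : X <= Re (pt c L N)) by (rewrite Re_pt, !S_INR; nra).
  assert (A2 : X <= Re (pt c L 0)) by (rewrite Re_pt, !S_INR; simpl; nra).
  assert (A3 : X <= Re (pt c 0 N)) by (rewrite Re_pt, !S_INR; simpl; nra).
  apply HX in A1. apply HX in A2. apply HX in A3.
  replace (phi j z (pt c L N) - phi j z (pt c L 0) - phi j z (pt c 0 N) - 0)%C with
    (phi j z (pt c L N) - phi j z (pt c L 0) - phi j z (pt c 0 N))%C by ring.
  eapply Rle_lt_trans; [apply Cmod_minus_le|].
  eapply Rle_lt_trans; [apply Rplus_le_compat_r, Cmod_minus_le|]. lra.
Qed.

Global Instance two_index_filter : ProperFilter two_index.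
Proof. apply filter_prod_proper. Qed.

Lemma rect_limit_tends (u : nat -> nat -> C) (s : C) (Q : R) : 0 <= Q ->
  (forall L N, (0 < L)%nat -> (0 < N)%nat -> Cmod (s - rect u L N) <= Q * (wtail L + wtail N)) ->
  tends two_index (fun p => rect u (fst p) (snd p)) s.
Proof.
  intros HQ H eps He.
  assert (W : eventually (fun n => wtail n < eps / (2 * (Q + 1)))).
  { apply wtail_small. apply Rdiv_lt_0_compat; lra. }
  assert (E0 : eventually (fun n => (0 < n)%nat)) by (exists 1%nat; intros; lia).
  generalize (two_index_and _ _ (filter_and _ _ W E0) (filter_and _ _ W E0)).
  apply filter_imp. intros [L N]. simpl. intros [[A B] [A' B']].
  rewrite Cmod_minus_sym. eapply Rle_lt_trans; [now apply H|].
  apply Rle_lt_trans with (Q * (eps / (Q + 1))).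
  - apply Rmult_le_compat_l; [exact HQ|].
    replace (eps / (Q + 1)) with (eps / (2 * (Q + 1)) + eps / (2 * (Q + 1))) by (field; lra). lra.
  - apply (Rmult_lt_reg_r (Q + 1)); [lra|]. unfold Rdiv.
    replace (Q * (eps * / (Q + 1)) * (Q + 1)) with (Q * eps) by (field; lra). nra.
Qed.

(** Raising [M] moves one more [DD]-term out of the remainders, and by telescoping this changes the
    whole expression only at the boundary of the rectangle. Hence the limit does not depend on
    [M]. *)
Lemma Psum_succ (c : C) (M L N : nat) (z : C) :
  (Psum c (S M) L N z - Psum c M L N z)%C = (- (bcoef c M * bdry c (phi M z) (L, N)))%C.
Proof.
  unfold Psum.
  assert (E : forall w, rterm c (S M) z w = (rterm c M z w - bcoef c M * DD c (phi M z) w)%C).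
  { intros w. unfold rterm. rewrite !DD_gsum. cbn [Csum]. ring. }
  assert (E2 : rect (fun l n => rterm c (S M) z (pt c l n)) L N =
    (rect (fun l n => rterm c M z (pt c l n)) L N - bcoef c M * rect (fun l n => DD c (phi M z) (pt c l n)) L N)%C).
  { unfold rect. rewrite <- Csum_scal, <- Csum_minus. apply Csum_ext. intros l _.
    rewrite <- Csum_scal, <- Csum_minus. apply Csum_ext. intros n _. apply E. }
  rewrite E2, rect_DD. unfold gsum. cbn [Csum]. unfold bdry. simpl fst. simpl snd. ring.
Qed.

(** The limit has to be fixed before [rho], since the bound is to hold with one [rho] for all points
    of a disc; limits found for different [rho] agree by uniqueness. *)
Lemma Psum_limit (c : C) (M : nat) (z : C) : 0 < Re c -> (0 < M)%nat -> 5 / 2 <= Re z + INR M ->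
  exists s, forall rho, Cmod z <= rho -> forall L N, (0 < L)%nat -> (0 < N)%nat ->
    Cmod (s - Psum c M L N z) <= 5 * Qb c M rho * (wtail L + wtail N).
Proof.
  intros Hc HM Hz.
  assert (K : forall rho, Cmod z <= rho -> exists s, forall L N, (0 < L)%nat -> (0 < N)%nat ->
    Cmod (s - Psum c M L N z) <= 5 * Qb c M rho * (wtail L + wtail N)).
  { intros rho Hrho. destruct (rect_limit (fun l n => rterm c M z (pt c l n)) (Qb c M rho)) as [s Hs].
    - apply Qb_pos. eapply Rle_trans; [apply Cmod_ge_0|exact Hrho].
    - intros l n. now apply rterm_pt_bound.
    - exists (gsum c M z (c + 1) + s)%C. intros L N HL HN. unfold Psum.
      match goal with |- Cmod (?a + ?b - (?a + ?d)) <= _ => replace (a + b - (a + d))%C with (b - d)%C by ring end.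
      now apply Hs. }
  destruct (K (Cmod z) (Rle_refl _)) as [s Hs]. exists s. intros rho Hrho.
  destruct (K rho Hrho) as [s' Hs']. replace s with s'; [exact Hs'|].
  assert (T : forall s r, 0 <= r -> (forall L N, (0 < L)%nat -> (0 < N)%nat ->
    Cmod (s - Psum c M L N z) <= 5 * Qb c M r * (wtail L + wtail N)) ->
    tends two_index (fun p => rect (fun l n => rterm c M z (pt c l n)) (fst p) (snd p)) (s - gsum c M z (c + 1)%C)).
  { intros s0 r Hr H. apply (rect_limit_tends _ _ (5 * Qb c M r)).
    - generalize (Qb_pos c M r Hr). lra.
    - intros L N HL HN. specialize (H L N HL HN). unfold Psum in H.
      match type of H with Cmod (?a - (?b + ?d)) <= _ => replace (a - b - d)%C with (a - (b + d))%C by ring end.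
      exact H. }
  assert (G := Cmod_ge_0 z).
  assert (U := tends_unique two_index _ _ _ (T s' rho ltac:(lra) Hs') (T s (Cmod z) G Hs)).
  transitivity (s' - gsum c M z (c + 1) + gsum c M z (c + 1))%C; [ring|]. rewrite U. ring.
Qed.

Lemma tends_Psum (c : C) (M : nat) (z s : C) (Q : R) : 0 <= Q ->
  (forall L N, (0 < L)%nat -> (0 < N)%nat -> Cmod (s - Psum c M L N z) <= Q * (wtail L + wtail N)) ->
  tends two_index (fun p => Psum c M (fst p) (snd p) z) s.
Proof.
  intros HQ H. apply (tends_ext two_index (fun p => gsum c M z (c + 1)%C + rect (fun l n => rterm c M z (pt c l n)) (fst p) (snd p))%C).
  - apply filter_forall. reflexivity.
  - replace s with (gsum c M z (c + 1) + (s - gsum c M z (c + 1)))%C by ring.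
    apply (tends_plus two_index); [apply (tends_const two_index)|].
    apply (rect_limit_tends _ _ Q HQ). intros L N HL HN. specialize (H L N HL HN). unfold Psum in H.
    match type of H with Cmod (?a - (?b + ?d)) <= _ => replace (a - b - d)%C with (a - (b + d))%C by ring end.
    exact H.
Qed.

(** One function has to serve every [M]: the limits for [M] and for [m] are both carried up to
    [M + m] by [Psum_succ], whose boundary terms vanish because [Re z + M > 2]. *)
Lemma Hfun_exists (c : C) : 0 < Re c ->
  exists H : C -> C, forall M z rho, (0 < M)%nat -> 5 / 2 <= Re z + INR M -> Cmod z <= rho ->
    forall L N, (0 < L)%nat -> (0 < N)%nat ->
    Cmod (H z - Psum c M L N z) <= 5 * Qb c M rho * (wtail L + wtail N).
Proof.
  intros Hc.
  destruct (functional_choice (fun z s => forall M rho, (0 < M)%nat -> 5 / 2 <= Re z + INR M -> Cmod z <= rho ->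
    forall L N, (0 < L)%nat -> (0 < N)%nat ->
    Cmod (s - Psum c M L N z) <= 5 * Qb c M rho * (wtail L + wtail N))) as [H HH].
  - intros z. destruct (INR_large (5 / 2 - Re z)) as [M0 HM0].
    pose (m := S M0). assert (Hm : 5 / 2 <= Re z + INR m) by (specialize (HM0 m ltac:(unfold m; lia)); lra).
    destruct (Psum_limit c m z Hc ltac:(unfold m; lia) Hm) as [s Hs]. exists s.
    assert (QP : forall M, 0 <= 5 * Qb c M (Cmod z)) by (intros M; generalize (Qb_pos c M (Cmod z) (Cmod_ge_0 z)); lra).
    assert (Step : forall M x, (0 < M)%nat -> 5 / 2 <= Re z + INR M ->
      (tends two_index (fun p => Psum c M (fst p) (snd p) z) x <->
       tends two_index (fun p => Psum c (S M) (fst p) (snd p) z) x)).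
    { intros M x HM HzM.
      assert (B : tends two_index (fun p => - (bcoef c M * bdry c (phi M z) p))%C 0).
      { replace (RtoC 0) with (- (bcoef c M * 0))%C by ring.
        apply (tends_opp two_index), (tends_scal two_index), bdry_phi; [exact Hc|lra]. }
      split; intros T.
      - apply (tends_ext two_index (fun p => Psum c M (fst p) (snd p) z + - (bcoef c M * bdry c (phi M z) p))%C).
        + apply filter_forall. intros [L N]. rewrite <- Psum_succ. simpl. ring.
        + replace x with (x + 0)%C by ring. now apply (tends_plus two_index).
      - apply (tends_ext two_index (fun p => Psum c (S M) (fst p) (snd p) z - - (bcoef c M * bdry c (phi M z) p))%C).
        + apply filter_forall. intros [L N]. rewrite <- Psum_succ. simpl. ring.
        + replace x with (x - 0)%C by ring. now apply (tends_minus two_index). }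
    assert (Up : forall M k x, (0 < M)%nat -> 5 / 2 <= Re z + INR M ->
      (tends two_index (fun p => Psum c M (fst p) (snd p) z) x <->
       tends two_index (fun p => Psum c (M + k) (fst p) (snd p) z) x)).
    { intros M k x HM HzM. induction k as [|k IH]; [now rewrite Nat.add_0_r|].
      rewrite IH, Nat.add_succ_r. apply Step; [lia|]. rewrite plus_INR. generalize (pos_INR k); lra. }
    assert (T0 := tends_Psum c m z s _ (QP m) (Hs _ (Rle_refl _))).
    intros M rho HM HzM Hrho.
    destruct (Psum_limit c M z Hc HM HzM) as [s' Hs'].
    assert (T1 := tends_Psum c M z s' _ (QP M) (Hs' _ (Rle_refl _))).
    replace s with s'; [now apply Hs'|].
    apply (Up M m s' HM HzM) in T1. apply (Up m M s) in T0; [|unfold m; lia|exact Hm].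
    rewrite Nat.add_comm in T0. exact (tends_unique two_index _ _ _ T1 T0).
  - exists H. intros M z rho. exact (HH z M rho).
Qed.

(** * The meromorphic continuation *)

Lemma fallc_derivable (j : nat) (z : C) : exists d, is_C_derive (fallc j) z d.
Proof.
  induction j as [|j [d IH]].
  - exists 0%C. apply (is_C_derive_const 1).
  - eexists. apply (is_C_derive_mult (fallc j) (fun z => 2 - z - INR j)%C); [exact IH|].
    apply is_C_derive_minus; [|apply is_C_derive_const].
    apply is_C_derive_minus; [apply is_C_derive_const|apply is_C_derive_id].
Qed.

Lemma is_C_derive_phi (j : nat) (w z d : C) : is_C_derive (fallc j) z d ->
  is_C_derive (fun z => phi j z w) z ((d - fallc j z * Clog w) * Cpower w (2 - z - INR j))%C.
Proof.
  intros H. unfold phi. eapply is_C_derive_eq.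
  - apply (is_C_derive_mult (fallc j) (fun z => Cpower w (2 - z - INR j))); [exact H|].
    apply (is_C_derive_Cpower w z (fun z => 2 - z - INR j)%C).
    apply is_C_derive_minus; [|apply is_C_derive_const].
    apply is_C_derive_minus; [apply is_C_derive_const|apply is_C_derive_id].
  - cbv beta. ring.
Qed.

(** [Psum] with an arbitrary family in place of the [phi j z]. Being linear in the family, it is
    applied below to derivatives in z, to exponential integrals, to their integrands and to their
    divergent parts. *)
Definition dPsum (c : C) (M L N : nat) (psi : nat -> C -> C) : C :=
  (Csum (fun j => bcoef c j * psi j (c + 1)) M +
   rect (fun l n => psi 2%nat (pt c l n) - DD c (fun v => Csum (fun j => bcoef c j * psi j v) M) (pt c l n)) L N)%C.

Lemma is_C_derive_Psum (c : C) (M L N : nat) (z : C) (psi : nat -> C -> C) : 0 < Re c ->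
  (forall j w, (j < M \/ j = 2)%nat -> 0 < Re w -> is_C_derive (fun z => phi j z w) z (psi j w)) ->
  is_C_derive (Psum c M L N) z (dPsum c M L N psi).
Proof.
  intros Hc Hpsi.
  assert (G : forall w, 0 < Re w -> is_C_derive (fun z => gsum c M z w) z (Csum (fun j => bcoef c j * psi j w) M)%C).
  { intros w Hw. unfold gsum. apply (is_C_derive_Csum (fun j z => bcoef c j * phi j z w)%C).
    intros k Hk. eapply is_C_derive_eq.
    - apply (is_C_derive_mult (fun _ => bcoef c k) (fun z => phi k z w)); [apply is_C_derive_const|]. apply Hpsi; auto.
    - cbv beta. ring. }
  unfold Psum, dPsum. apply is_C_derive_plus.
  - apply G. rewrite re_plus. simpl. lra.
  - unfold rect. apply (is_C_derive_Csum (fun l z => Csum (fun n => rterm c M z (pt c l n)) N)). intros l _.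
    apply (is_C_derive_Csum (fun n z => rterm c M z (pt c l n))). intros n _.
    assert (Hp : 0 < Re (pt c l n)).
    { eapply Rlt_le_trans; [|apply Re_pt_ge; lra]. apply lt_0_INR. lia. }
    revert Hp. generalize (pt c l n). intros w Hp.
    unfold rterm, DD. apply is_C_derive_minus; [apply Hpsi; auto|].
    apply is_C_derive_plus; [|now apply G].
    apply is_C_derive_minus; [apply is_C_derive_minus|]; apply G; rewrite !re_plus; simpl; lra.
Qed.

Section Continuation.

Variables (c : C) (H : C -> C).
Hypothesis Hc : 0 < Re c.
Hypothesis HP : forall M z rho, (0 < M)%nat -> 5 / 2 <= Re z + INR M -> Cmod z <= rho ->
    forall L N, (0 < L)%nat -> (0 < N)%nat ->
    Cmod (H z - Psum c M L N z) <= 5 * Qb c M rho * (wtail L + wtail N).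

(* Raising [M] moves the half-plane of uniform convergence as far to the left as desired. *)
Lemma H_weierstrass (p : C) (M : nat) (R0 : R) : 0 < R0 -> (0 < M)%nat -> 5 / 2 <= Re p - R0 + INR M ->
  exists d, is_C_derive H p d /\
    forall d', (forall n, is_C_derive (Psum c M (S n) (S n)) p (d' n)) -> tends eventually d' d.
Proof.
  intros HR HM Hp.
  assert (G := Cmod_ge_0 p). assert (Hrho : 0 <= Cmod p + R0) by lra.
  assert (HQ := Qb_pos c M _ Hrho).
  apply (weierstrass (fun n => Psum c M (S n) (S n)) H p R0
    (fun n => 5 * Qb c M (Cmod p + R0) * (wtail (S n) + wtail (S n))) HR).
  - intros n z _.
    pose (psi := fun j w => ((C_derive (fallc j) z - fallc j z * Clog w) * Cpower w (2 - z - INR j))%C).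
    exists (dPsum c M (S n) (S n) psi). apply is_C_derive_Psum; [exact Hc|].
    intros j w _ _. apply is_C_derive_phi. destruct (fallc_derivable j z) as [d Hd].
    rewrite (is_C_derive_unique _ _ _ Hd). exact Hd.
  - intros n z Hz. rewrite Cmod_minus_sym. unfold disc in Hz. apply HP; try lia.
    + assert (A := re_le_Cmod (z - p)). assert (B := Rle_abs (- Re (z - p))). rewrite Rabs_Ropp in B.
      unfold Cminus in A, B, Hz. rewrite re_plus, re_opp in A, B. lra.
    + eapply Rle_trans; [apply (Cmod_le_add z p)|]. lra.
  - intros eps He. set (Q := Qb c M (Cmod p + R0)) in *.
    destruct (wtail_small (eps / (10 * (Q + 1)))) as [K HK]; [apply Rdiv_lt_0_compat; lra|].
    exists K. intros n Hn. specialize (HK (S n) ltac:(lia)).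
    apply (Rmult_lt_compat_r (10 * (Q + 1))) in HK; [|lra].
    replace (eps / (10 * (Q + 1)) * (10 * (Q + 1))) with eps in HK by (field; lra).
    assert (W := wtail_pos (S n)). nra.
Qed.

Lemma H_derivable (z : C) : C_derivable H z.
Proof.
  (* [7 / 2] is the threshold [5 / 2] plus the radius 1 of the disc. *)
  destruct (INR_large (7 / 2 - Re z)) as [M HM]. specialize (HM (S M) ltac:(lia)).
  destruct (H_weierstrass z (S M) 1) as [d [Hd _]]; [lra|lia|lra|]. exists d. exact Hd.
Qed.

(** For z = 0, 1, 2 the functions [phi j z] are polynomials in [w], on which the expansion of [DD]
    is exact; nothing remains to be summed, and the value of [H] is the corner term. *)
Lemma H_eq_gsum (M : nat) (z : C) : (0 < M)%nat -> 5 / 2 <= Re z + INR M ->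
  (forall w, 0 < Re w -> rterm c M z w = 0%C) -> H z = gsum c M z (c + 1)%C.
Proof.
  intros HM Hz Hr.
  assert (T := tends_Psum c M z (H z) (5 * Qb c M (Cmod z))).
  assert (HQ := Qb_pos c M _ (Cmod_ge_0 z)).
  specialize (T ltac:(lra) (HP M z (Cmod z) HM Hz (Rle_refl _))).
  apply (tends_unique two_index _ _ _ T).
  apply (tends_ext two_index (fun _ => gsum c M z (c + 1)%C)); [|apply (tends_const two_index)].
  apply filter_forall. intros [L N]. unfold Psum, rect. simpl fst. simpl snd.
  rewrite (Csum_ext _ (fun _ => RtoC 0)).
  - rewrite Csum_0. ring.
  - intros l _. rewrite (Csum_ext _ (fun _ => RtoC 0)); [apply Csum_0|].
    intros n _. apply Hr. eapply Rlt_le_trans; [|apply Re_pt_ge; lra]. apply lt_0_INR. lia.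
Qed.

Lemma c_neq_0 : c <> 0%C.
Proof. now apply neq_0_Re. Qed.

Lemma bcoef_0 : bcoef c 0 = bm2 c.
Proof. reflexivity. Qed.

Lemma bcoef_1 : bcoef c 1 = (- (c + 1) / (2 * c))%C.
Proof.
  rewrite bcoef_S. simpl Csum. rewrite bcoef_0. unfold dcoef, bm2. simpl.
  replace (1 + 1 + 1 + (1 + 1 + 1))%R with 6 by ring.
  replace (RtoC (1 + 1 + 1 + 1 + 1 + 1)) with (RtoC 6) by (f_equal; ring).
  field. exact c_neq_0.
Qed.

Lemma bcoef_2 : bcoef c 2 = b0 c.
Proof.
  rewrite bcoef_S. cbn [Csum]. rewrite bcoef_0, bcoef_1. unfold dcoef, bm2, b0.
  simpl Nat.sub. simpl Nat.add.
  replace (INR (Factorial.fact 4)) with 24 by (simpl; ring).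
  replace (INR (Factorial.fact 3)) with 6 by (simpl; ring).
  simpl. field. exact c_neq_0.
Qed.

Lemma Cpower_0 (w : C) : Cpower w 0 = 1%C.
Proof. unfold Cpower. rewrite Cmult_0_l. apply Cexp_0. Qed.

Lemma Cpower_1 (w : C) : 0 < Re w -> Cpower w 1 = w.
Proof. intros Hw. unfold Cpower. rewrite Cmult_1_l. now apply Cexp_Clog. Qed.

Lemma Cpower_2 (w : C) : 0 < Re w -> Cpower w 2 = (w * w)%C.
Proof.
  intros Hw. rewrite <- (Cpower_pred w 2 Hw). f_equal.
  replace (2 - 1)%C with (RtoC 1) by ring. now apply Cpower_1.
Qed.

(** This value and that at 2 are nonzero, so that 1 and 2 are genuine poles as [has_pole]
    demands. *)
Lemma H_at_1 : H 1 = ((c + 1) / (2 * c))%C.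
Proof.
  assert (P0 : forall w, 0 < Re w -> phi 0 1 w = w).
  { intros w Hw. unfold phi. simpl. replace (2 - 1 - 0)%C with (RtoC 1) by ring. rewrite Cpower_1 by exact Hw. ring. }
  assert (P1 : forall w, phi 1 1 w = 1%C).
  { intros w. unfold phi. simpl. replace (2 - 1 - 1)%C with (RtoC 0) by ring. rewrite Cpower_0. ring. }
  rewrite (H_eq_gsum 2 1); [|lia|simpl; lra|].
  - unfold gsum. cbn [Csum]. rewrite P0, P1, bcoef_0, bcoef_1 by (rewrite re_plus; simpl; lra).
    unfold bm2. field. exact c_neq_0.
  - intros w Hw. unfold rterm, gsum, DD. cbn [Csum].
    rewrite !P0, !P1 by (rewrite ?re_plus; simpl; lra). unfold phi. simpl. ring.
Qed.

Lemma H_at_2 : H 2 = bm2 c.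
Proof.
  assert (P0 : forall w, phi 0 2 w = 1%C).
  { intros w. unfold phi. simpl. replace (2 - 2 - 0)%C with (RtoC 0) by ring. rewrite Cpower_0. ring. }
  rewrite (H_eq_gsum 1 2); [|lia|simpl; lra|].
  - unfold gsum. cbn [Csum]. rewrite P0, bcoef_0. ring.
  - intros w Hw. unfold rterm, gsum, DD. cbn [Csum].
    rewrite !P0. unfold phi. simpl. ring.
Qed.

(** In other words zeta_c(0) = b_0: at [w = c + 1] the terms for [j = 0] and [j = 1] cancel. *)
Lemma H_at_0 : H 0 = (2 * b0 c)%C.
Proof.
  assert (P0 : forall w, 0 < Re w -> phi 0 0 w = (w * w)%C).
  { intros w Hw. unfold phi. simpl. replace (2 - 0 - 0)%C with (RtoC 2) by ring. rewrite Cpower_2 by exact Hw. ring. }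
  assert (P1 : forall w, 0 < Re w -> phi 1 0 w = (2 * w)%C).
  { intros w Hw. unfold phi. simpl. replace (2 - 0 - 1)%C with (RtoC 1) by ring. rewrite Cpower_1 by exact Hw. ring. }
  assert (P2 : forall w, phi 2 0 w = 2%C).
  { intros w. unfold phi. simpl. replace (1 + 1)%R with 2 by ring.
    replace (2 - 0 - 2)%C with (RtoC 0) by ring. rewrite Cpower_0. ring. }
  assert (Hw1 : 0 < Re (c + 1)%C) by (rewrite re_plus; simpl; lra).
  rewrite (H_eq_gsum 3 0); [|lia|simpl; lra|].
  - unfold gsum. cbn [Csum]. rewrite P0, P1, P2, bcoef_0, bcoef_1, bcoef_2 by exact Hw1.
    unfold bm2. field. exact c_neq_0.
  - intros w Hw. unfold rterm, gsum, DD. cbn [Csum].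
    rewrite !P0, !P1, !P2 by (rewrite ?re_plus; simpl; lra).
    rewrite bcoef_0, bcoef_1. unfold bm2. field. exact c_neq_0.
Qed.

Definition zfun (z : C) : C := (H z / ((z - 1) * (z - 2)))%C.

Lemma phi_2_zeta_term (z : C) (l n : nat) :
  phi 2 z (pt c l n) = ((z - 1) * (z - 2) * zeta_term c z l n)%C.
Proof.
  unfold phi, zeta_term. fold (pt c l n). simpl. replace (1 + 1)%R with 2 by ring.
  replace (2 - z - 2)%C with (- z)%C by ring. ring.
Qed.

Lemma RtoC_neq (x y : R) : x <> y -> RtoC x <> RtoC y.
Proof. intros Hxy E. apply Hxy. now apply RtoC_inj. Qed.

Lemma Re_neq (z w : C) : Re z <> Re w -> (z - w)%C <> 0%C.
Proof. intros Hzw E. apply Hzw. apply (f_equal Re) in E. unfold Cminus in E. rewrite re_plus, re_opp in E. simpl in E. lra. Qed.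

Lemma zfun_is_zeta (z : C) : 2 < Re z -> is_zeta c z (zfun z).
Proof.
  intros Hz.
  assert (N1 : (z - 1)%C <> 0%C) by (apply Re_neq; simpl; lra).
  assert (N2 : (z - 2)%C <> 0%C) by (apply Re_neq; simpl; lra).
  assert (HQ := Qb_pos c 1 _ (Cmod_ge_0 z)).
  assert (T := tends_Psum c 1 z (H z) (5 * Qb c 1 (Cmod z)) ltac:(lra)
    (HP 1 z (Cmod z) ltac:(lia) ltac:(simpl; lra) (Rle_refl _))).
  assert (B := tends_scal two_index (bcoef c 0) _ _ (bdry_phi c 0 z Hc ltac:(simpl; lra))).
  assert (T2 := tends_scal two_index (/ ((z - 1) * (z - 2)))%C _ _ (tends_plus two_index _ _ _ _ T B)).
  assert (T3 : tends two_index (fun p => rect (fun l n => zeta_term c z l n) (fst p) (snd p)) (zfun z)).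
  { replace (zfun z) with (/ ((z - 1) * (z - 2)) * (H z + bcoef c 0 * 0))%C by (unfold zfun; field; auto).
    apply (tends_ext two_index _ _ _) with (2 := T2).
    apply filter_forall. intros [L N]. simpl fst. simpl snd.
    (* For [M = 1] the telescoped part is [bcoef c 0] times the four corners of the rectangle.
       [Psum] holds the corner [c + 1], and [bdry] the other three, which vanish in the limit as
       [Re z > 2]. *)
    assert (E : ((z - 1) * (z - 2) * rect (fun l n => zeta_term c z l n) L N)%C =
       (Psum c 1 L N z + bcoef c 0 * bdry c (phi 0 z) (L, N))%C).
    { transitivity (rect (fun l n => phi 2 z (pt c l n)) L N).
      - unfold rect. rewrite <- Csum_scal. apply Csum_ext. intros l _. rewrite <- Csum_scal. apply Csum_ext.
        intros n _. now rewrite phi_2_zeta_term.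
      - assert (E2 : rect (fun l n => phi 2 z (pt c l n)) L N = (rect (fun l n => rterm c 1 z (pt c l n)) L N
          + bcoef c 0 * rect (fun l n => DD c (phi 0 z) (pt c l n)) L N)%C).
        { unfold rect. rewrite <- Csum_scal, <- Csum_plus. apply Csum_ext. intros l _.
          rewrite <- Csum_scal, <- Csum_plus. apply Csum_ext. intros n _.
          unfold rterm. rewrite DD_gsum. cbn [Csum]. ring. }
        rewrite E2, rect_DD. unfold Psum, gsum, bdry. cbn [Csum fst snd]. ring. }
    rewrite <- E. field. auto. }
  unfold is_zeta. apply tends_filterlim; [apply filter_prod_filter; apply eventually_filter|].
  (* [sum_n] includes its upper index, so the bounds L, N stand for a rectangle of [S L] by [S N]
     terms. *)
  apply (tends_ext (filter_prod eventually eventually) (fun p : nat * nat => rect (fun l n => zeta_term c z l n) (S (fst p)) (S (snd p)))).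
  - apply filter_forall. intros [L N]. simpl fst. simpl snd. rewrite sum_n_Csum.
    apply Csum_ext. intros l _. now rewrite sum_n_Csum.
  - apply (tends_comp two_index (filter_prod eventually eventually) (fun p : nat * nat => (S (fst p), S (snd p)))
      (fun p => rect (fun l n => zeta_term c z l n) (fst p) (snd p))); [|exact T3].
    intros P [Q R [NQ HQ'] [NR HR] HPQ]. unfold filtermap.
    apply (Filter_prod _ _ _ (fun n => Q (Datatypes.S n)) (fun n => R (Datatypes.S n))).
    + exists NQ. intros n Hn. apply HQ'. lia.
    + exists NR. intros n Hn. apply HR. lia.
    + intros x y Hx Hy. now apply HPQ.
Qed.

Lemma zfun_derivable (z : C) : z <> 1%C -> z <> 2%C -> C_derivable zfun z.
Proof.
  intros N1 N2. destruct (H_derivable z) as [d Hd].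
  eexists. unfold zfun.
  apply (is_C_derive_mult H (fun z => / ((z - 1) * (z - 2)))%C); [exact Hd|].
  apply (is_C_derive_inv (fun z => (z - 1) * (z - 2))%C).
  - apply Cmult_neq_0; now apply Cminus_eq_contra.
  - apply (is_C_derive_mult (fun z => z - 1)%C (fun z => z - 2)%C);
      apply is_C_derive_minus; try apply is_C_derive_id; apply is_C_derive_const.
Qed.

Lemma locally'_Cmod (z : C) (P : C -> Prop) :
  @locally' C_UniformSpace z P <-> exists del, 0 < del /\ forall w, Cmod (w - z) < del -> w <> z -> P w.
Proof. unfold locally', within. apply locally_Cmod. Qed.

Lemma simple_pole (p q : C) : p <> q -> H p <> 0%C ->
  (forall z, zfun z = (H z / ((z - p) * (z - q)))%C) -> has_pole zfun p.
Proof.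
  intros Hpq Hp E. assert (Hd := proj1 (Cmod_gt_0 _) (Cminus_eq_contra _ _ Hpq)).
  exists 0%nat, (fun z => H z / (z - q))%C. repeat split.
  - apply locally_Cmod. exists (Cmod (p - q)). split; [exact Hd|]. intros z Hz.
    assert (N : (z - q)%C <> 0%C).
    { intros E0. revert Hz. replace (z - p)%C with ((z - q) - (p - q))%C by ring. rewrite E0.
      replace (0 - (p - q))%C with (- (p - q))%C by ring. rewrite Cmod_opp. lra. }
    destruct (H_derivable z) as [d Hd0]. eexists.
    apply (is_C_derive_mult H (fun z => / (z - q))%C); [exact Hd0|].
    apply (is_C_derive_inv (fun z => z - q)%C); [exact N|].
    apply is_C_derive_minus; [apply is_C_derive_id|apply is_C_derive_const].
  - apply Cmult_neq_0; [exact Hp|]. apply Cmod_gt_0. rewrite Cmod_inv by now apply Cminus_eq_contra.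
    now apply Rinv_0_lt_compat.
  - apply locally'_Cmod. exists (Cmod (p - q)). split; [exact Hd|]. intros z Hz Hzp.
    assert (N : (z - q)%C <> 0%C).
    { intros E0. revert Hz. replace (z - p)%C with ((z - q) - (p - q))%C by ring. rewrite E0.
      replace (0 - (p - q))%C with (- (p - q))%C by ring. rewrite Cmod_opp. lra. }
    rewrite E, Cpow_1_r. field. split; [exact N|now apply Cminus_eq_contra].
Qed.

Lemma connected_setT : connected_set (fun _ => True).
Proof.
  (* The indicator of [A] along a segment is locally constant, hence has zero derivative. *)
  intros A B HA HB Hcov Hdis [a [_ Ha]] [b [_ Hb]].
  pose (g := fun t : R => (a + t * (b - a))%C).
  pose (f := fun t : R => if excluded_middle_informative (A (g t)) then 1 else 0).
  assert (Hg : forall t, Ccont g t) by (intros t; eapply Rder_cont, Rder_line).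
  assert (D : forall t, is_derive f t 0).
  { intros t. destruct (excluded_middle_informative (A (g t))) as [Ht|Ht].
    - apply (is_derive_ext_loc (fun _ => 1)); [|exact (is_derive_const 1 t)].
      assert (X : locally t (fun s => A (g s))) by exact (Hg t A (HA _ Ht)).
      revert X. apply filter_imp. intros s Hs.
      unfold f. destruct excluded_middle_informative; [reflexivity|contradiction].
    - apply (is_derive_ext_loc (fun _ => 0)); [|exact (is_derive_const 0 t)].
      assert (Ht' : B (g t)) by (destruct (Hcov (g t) I); [contradiction|assumption]).
      assert (X : locally t (fun s => B (g s))) by exact (Hg t B (HB _ Ht')).
      revert X. apply filter_imp. intros s Hs.
      unfold f. destruct excluded_middle_informative as [Hs'|]; [|reflexivity].
      exfalso. exact (Hdis (g s) I (conj Hs' Hs)). }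
  assert (E : f 1 = f 0).
  { destruct (MVT_gen f 0 1 (fun _ => 0)) as [x [_ Hx]].
    - intros; apply D.
    - intros x _. apply continuity_pt_filterlim. apply (ex_derive_continuous (K:=R_AbsRing) (V:=R_NormedModule)).
      eexists. apply D.
    - lra. }
  unfold f in E.
  replace (g 0) with a in E by (unfold g; ring). replace (g 1) with b in E by (unfold g; ring).
  destruct (excluded_middle_informative (A b)) as [Hb'|_]; [exact (Hdis b I (conj Hb' Hb))|].
  destruct (excluded_middle_informative (A a)) as [_|Ha']; [lra|contradiction].
Qed.

Lemma punctured_12 (z : C) :
  exists del, 0 < del /\ forall w, Cmod (w - z) < del -> w <> z -> w <> 1%C /\ w <> 2%C.
Proof.
  assert (K : forall a : C, exists del, 0 < del /\ forall w, Cmod (w - z) < del -> w <> z -> w <> a).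
  { intros a. destruct (Ceq_dec a z) as [->|Ha].
    - exists 1. split; [lra|auto].
    - exists (Cmod (a - z)). split; [now apply Cmod_gt_0, Cminus_eq_contra|].
      intros w Hw _ ->. lra. }
  destruct (K 1%C) as [d1 [H1 K1]]. destruct (K 2%C) as [d2 [H2 K2]].
  exists (Rmin d1 d2). split; [now apply Rmin_pos|]. intros w Hw Hwz. split.
  - apply K1; [|exact Hwz]. eapply Rlt_le_trans; [exact Hw|apply Rmin_l].
  - apply K2; [|exact Hwz]. eapply Rlt_le_trans; [exact Hw|apply Rmin_r].
Qed.

Lemma zfun_continuation : zeta_continuation c (fun _ => True) zfun.
Proof.
  split; [apply open_true|]. split; [apply connected_setT|]. split; [auto|]. split; [exact I|].
  split; [|exact zfun_is_zeta].
  exists (fun z : C => z = 1%C \/ z = 2%C). repeat split.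
  - intros z _. apply locally'_Cmod. destruct (punctured_12 z) as [d [Hd K]].
    exists d. split; [exact Hd|]. intros w Hw Hwz. specialize (K w Hw Hwz). tauto.
  - intros z _ Hz. apply zfun_derivable; tauto.
  - assert (Nc := c_neq_0). intros z _ [-> | ->].
    + apply (simple_pole 1 2); [apply RtoC_neq; lra| |reflexivity].
      rewrite H_at_1. apply Cmult_neq_0.
      * apply neq_0_Re. rewrite re_plus. simpl. lra.
      * intros E. assert (X : (2 * c * / (2 * c))%C = 1%C) by (apply Cinv_r, Cmult_neq_0; [apply RtoC_neq; lra|exact Nc]).
        rewrite E, Cmult_0_r in X. apply RtoC_inj in X. lra.
    + apply (simple_pole 2 1); [apply RtoC_neq; lra| |].
      * rewrite H_at_2. unfold bm2. intros E. assert (X := Cinv_r c Nc). rewrite E, Cmult_0_r in X.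
        apply RtoC_inj in X. lra.
      * intros z. unfold zfun. f_equal. ring.
Qed.

End Continuation.

(** * Uniqueness of the continuation *)

(** Regular points are treated as poles of order 0, so that one argument covers both; [m] is the
    order itself, whereas [has_pole] stores the order minus one. *)
Lemma meromorphic_local (U : C -> Prop) (F : C -> C) (z : C) :
  open U -> meromorphic_on U F -> U z ->
  exists (m : nat) (h : C -> C) (del : R), 0 < del /\ (forall w, disc z del w -> C_derivable h w) /\
    forall w, disc z del w -> w <> z -> F w = (h w / (w - z) ^ m)%C.
Proof.
  intros HU [P [Hiso [Hder Hpole]]] Hz.
  destruct (classic (P z)) as [HPz|HPz].
  - destruct (Hpole z Hz HPz) as [m [h [H1 [_ H2]]]].
    apply locally_Cmod in H1. apply locally'_Cmod in H2.
    destruct H1 as [d1 [Hd1 K1]]. destruct H2 as [d2 [Hd2 K2]].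
    exists (S m), h, (Rmin d1 d2). split; [now apply Rmin_pos|]. split.
    + intros w Hw. apply K1. eapply Rlt_le_trans; [exact Hw|apply Rmin_l].
    + intros w Hw. apply K2. eapply Rlt_le_trans; [exact Hw|apply Rmin_r].
  - assert (H1 := HU z Hz). apply locally_Cmod in H1.
    assert (H2 := Hiso z Hz). apply locally'_Cmod in H2.
    destruct H1 as [d1 [Hd1 K1]]. destruct H2 as [d2 [Hd2 K2]].
    exists 0%nat, F, (Rmin d1 d2). split; [now apply Rmin_pos|]. split.
    + intros w Hw. assert (Hw1 := Rlt_le_trans _ _ _ Hw (Rmin_l _ _)).
      assert (Hw2 := Rlt_le_trans _ _ _ Hw (Rmin_r _ _)).
      apply Hder; [now apply K1|].
      destruct (Ceq_dec w z) as [->|Hne]; [exact HPz|now apply K2].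
    + intros w _ _. simpl. field.
Qed.

(** The centre is left out because a meromorphic function has unspecified values at its poles. *)
Definition germ_eq (F G : C -> C) (z : C) : Prop :=
  exists del, 0 < del /\ forall w, disc z del w -> w <> z -> F w = G w.

Definition germ_neq (F G : C -> C) (z : C) : Prop :=
  exists del, 0 < del /\ forall w, disc z del w -> w <> z -> F w <> G w.

Lemma punctured_open (Q : C -> Prop) :
  open (fun z => exists del, 0 < del /\ forall w, disc z del w -> w <> z -> Q w).
Proof.
  intros z [d [Hd K]]. apply locally_Cmod. exists d. split; [exact Hd|]. intros v Hv.
  destruct (Ceq_dec v z) as [->|Hne]; [exists d; auto|].
  assert (P := proj1 (Cmod_gt_0 _) (Cminus_eq_contra _ _ Hne)).
  exists (Rmin (d - Cmod (v - z)) (Cmod (v - z))). split; [apply Rmin_pos; lra|].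
  intros w Hw _. unfold disc in *.
  assert (Hw1 := Rlt_le_trans _ _ _ Hw (Rmin_l _ _)).
  assert (Hw2 := Rlt_le_trans _ _ _ Hw (Rmin_r _ _)).
  apply K.
  - replace (w - z)%C with ((w - v) + (v - z))%C by ring.
    eapply Rle_lt_trans; [apply Cmod_triangle|]. lra.
  - intros ->. rewrite Cmod_minus_sym in Hw2. lra.
Qed.

Lemma disc_punctured_ex (z : C) (r : R) : 0 < r -> exists w, disc z r w /\ w <> z.
Proof.
  intros Hr. exists (z + (r / 2)%R)%C. unfold disc.
  replace (z + (r / 2)%R - z)%C with (RtoC (r / 2)) by ring. rewrite Cmod_R, Rabs_pos_eq by lra.
  split; [lra|]. intros E. assert (E2 : RtoC (r / 2) = 0%C).
  { transitivity (z + (r / 2)%R - z)%C; [ring|]. rewrite E. ring. }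
  apply RtoC_inj in E2. lra.
Qed.

Section Uniqueness.

Variables (c : C) (H : C -> C).
Hypothesis Hc : 0 < Re c.
Hypothesis HP : forall M z rho, (0 < M)%nat -> 5 / 2 <= Re z + INR M -> Cmod z <= rho ->
    forall L N, (0 < L)%nat -> (0 < N)%nat ->
    Cmod (H z - Psum c M L N z) <= 5 * Qb c M rho * (wtail L + wtail N).

(** Clearing denominators gives a function [k], holomorphic on a full disc, whose zeros off the
    centre are the points where the two functions agree; [isolated_zeros] applies to it. *)
Lemma germ_dichotomy (U : C -> Prop) (F : C -> C) (z : C) :
  open U -> meromorphic_on U F -> U z -> germ_eq F (zfun H) z \/ germ_neq F (zfun H) z.
Proof.
  intros HU HF Hz.
  destruct (meromorphic_local U F z HU HF Hz) as [m [h [d [Hd [Hh HFh]]]]].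
  destruct (punctured_12 z) as [d' [Hd' K]].
  pose (k := fun w => (h w * ((w - 1) * (w - 2)) - H w * (w - z) ^ m)%C).
  assert (Hk : forall w, disc z d w -> C_derivable k w).
  { intros w Hw. destruct (Hh w Hw) as [a Ha]. destruct (H_derivable c H Hc HP w) as [b Hb].
    eexists. apply is_C_derive_minus.
    - apply (is_C_derive_mult h (fun w => (w - 1) * (w - 2))%C); [exact Ha|].
      apply (is_C_derive_mult (fun z => z - 1)%C (fun z => z - 2)%C);
      apply is_C_derive_minus; try apply is_C_derive_id; apply is_C_derive_const.
    - apply (is_C_derive_mult H (fun w => (w - z) ^ m)%C); [exact Hb|apply is_C_derive_pow]. }
  assert (E : forall w, disc z d w -> disc z d' w -> w <> z -> (F w = zfun H w <-> k w = 0%C)).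
  { intros w Hw Hw' Hwz. destruct (K w Hw' Hwz) as [N1 N2].
    apply Cminus_eq_contra in N1. apply Cminus_eq_contra in N2.
    assert (N3 := Cpow_nz _ m (Cminus_eq_contra _ _ Hwz)).
    rewrite (HFh w Hw Hwz). unfold zfun, k. split; intros E.
    - transitivity (((h w / (w - z) ^ m) - H w / ((w - 1) * (w - 2))) * ((w - 1) * (w - 2) * (w - z) ^ m))%C.
      + field. auto.
      + rewrite E. ring.
    - apply Ceq_minus.
      transitivity ((h w * ((w - 1) * (w - 2)) - H w * (w - z) ^ m) / ((w - 1) * (w - 2) * (w - z) ^ m))%C.
      + field. auto.
      + rewrite E. field. auto. }
  destruct (isolated_zeros k z d Hd Hk) as [[e [He Z]]|[e [He Z]]]; [left|right];
    exists (Rmin e (Rmin d d')); (split; [repeat apply Rmin_pos; assumption|]); intros w Hw Hwz;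
    unfold disc in Hw;
    assert (W1 := Rlt_le_trans _ _ _ Hw (Rmin_l _ _));
    assert (W' := Rlt_le_trans _ _ _ Hw (Rmin_r _ _));
    assert (W2 := Rlt_le_trans _ _ _ W' (Rmin_l _ _));
    assert (W3 := Rlt_le_trans _ _ _ W' (Rmin_r _ _)).
  - apply E; auto.
  - intros E0. apply E in E0; auto. now apply (Z w W1 Hwz).
Qed.

Lemma is_zeta_unique (z s s' : C) : is_zeta c z s -> is_zeta c z s' -> s = s'.
Proof.
  intros H1 H2. apply tends_filterlim in H1; [|apply filter_prod_filter; apply eventually_filter].
  apply tends_filterlim in H2; [|apply filter_prod_filter; apply eventually_filter].
  exact (tends_unique two_index _ _ _ H1 H2).
Qed.

(** The identity theorem: agreement and disagreement on a punctured disc are disjoint open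
    conditions that cover [U]. Agreement occurs at 3, whose unit disc lies in the half-plane of
    convergence, so disagreement at 0 would disconnect [U]. *)
Lemma continuation_germ_0 (U : C -> Prop) (F : C -> C) : zeta_continuation c U F -> germ_eq F (zfun H) 0.
Proof.
  intros [HU [Hconn [Hhalf [U0 [HF HZ]]]]].
  destruct (germ_dichotomy U F 0 HU HF U0) as [|Hn]; [assumption|]. exfalso.
  apply (Hconn (germ_eq F (zfun H)) (germ_neq F (zfun H))).
  - apply (punctured_open (fun w => F w = zfun H w)).
  - apply (punctured_open (fun w => F w <> zfun H w)).
  - intros z Hz. now apply (germ_dichotomy U).
  - intros z _ [[d1 [Hd1 K1]] [d2 [Hd2 K2]]].
    destruct (disc_punctured_ex z (Rmin d1 d2)) as [w [Hw Hwz]]; [now apply Rmin_pos|].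
    apply (K2 w); [eapply Rlt_le_trans; [exact Hw|apply Rmin_r]|exact Hwz|].
    apply K1; [eapply Rlt_le_trans; [exact Hw|apply Rmin_l]|exact Hwz].
  - exists 3%C. split; [apply Hhalf; simpl; lra|]. exists 1. split; [lra|].
    intros w Hw _. assert (X : 2 < Re w).
    { unfold disc in Hw. assert (A := re_le_Cmod (w - 3)). assert (B := Rle_abs (- Re (w - 3))).
      rewrite Rabs_Ropp in B. unfold Cminus in A, B, Hw. rewrite re_plus, re_opp in A, B. simpl (Re 3) in A, B. lra. }
    apply (is_zeta_unique w); [now apply HZ|now apply (zfun_is_zeta c H Hc HP)].
  - exists 0%C. split; assumption.
Qed.

(** Agreement off 0 does not yet control [F] at 0. The point cannot be marked as a pole: the
    numerator [h] would equal [G w * w ^ S m], which tends to 0, against [h 0 <> 0]. So [F] is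
    derivable at 0, and continuity forces [F 0 = G 0]. *)
Lemma germ_eq_derive (U : C -> Prop) (F G : C -> C) (d : C) : open U -> U 0 -> meromorphic_on U F ->
  germ_eq F G 0 -> is_C_derive G 0 d -> is_C_derive F 0 d.
Proof.
  intros HU U0 [P [_ [Hder Hpole]]] [e [He E]] HG.
  assert (GC := proj1 (cont_eps_iff G 0%C) (is_C_derive_cont G 0 d HG)).
  assert (HFd : C_derivable F 0).
  { destruct (classic (P 0%C)) as [H0|H0]; [|now apply Hder].
    exfalso. destruct (Hpole 0%C U0 H0) as [m [h [Hh [Hh0 HFh]]]].
    apply locally_singleton in Hh. destruct Hh as [b Hb].
    change (is_C_derive h 0 b) in Hb.
    assert (HCt := proj1 (cont_eps_iff h 0%C) (is_C_derive_cont h 0 b Hb)).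
    apply locally'_Cmod in HFh. destruct HFh as [e1 [He1 K1]].
    assert (Ph := proj1 (Cmod_gt_0 _) Hh0). set (a := Cmod (h 0%C)) in *.
    destruct (HCt (a / 2) ltac:(lra)) as [e2 [He2 K2]].
    destruct (GC 1 Rlt_0_1) as [e3 [He3 K3]].
    pose (q := Cmod (G 0%C) + 1). assert (Hq : 0 < q) by (unfold q; generalize (Cmod_ge_0 (G 0%C)); lra).
    pose (r := Rmin (Rmin (Rmin e e1) (Rmin e2 e3)) (Rmin 1 (a / (2 * q)))).
    assert (Hr : 0 < r).
    { unfold r. repeat apply Rmin_pos; try assumption; try lra. apply Rdiv_lt_0_compat; lra. }
    destruct (disc_punctured_ex 0 r Hr) as [w [Hw Hw0]]. unfold disc in Hw, E.
    assert (R1 : r <= e) by (unfold r; eapply Rle_trans; [apply Rmin_l|]; eapply Rle_trans; [apply Rmin_l|apply Rmin_l]).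
    assert (R2 : r <= e1) by (unfold r; eapply Rle_trans; [apply Rmin_l|]; eapply Rle_trans; [apply Rmin_l|apply Rmin_r]).
    assert (R3 : r <= e2) by (unfold r; eapply Rle_trans; [apply Rmin_l|]; eapply Rle_trans; [apply Rmin_r|apply Rmin_l]).
    assert (R4 : r <= e3) by (unfold r; eapply Rle_trans; [apply Rmin_l|]; eapply Rle_trans; [apply Rmin_r|apply Rmin_r]).
    assert (R5 : r <= 1) by (unfold r; eapply Rle_trans; [apply Rmin_r|apply Rmin_l]).
    assert (R6 : r <= a / (2 * q)) by (unfold r; eapply Rle_trans; [apply Rmin_r|apply Rmin_r]).
    specialize (E w ltac:(lra) Hw0). specialize (K1 w ltac:(lra) Hw0).
    specialize (K2 w ltac:(lra)). specialize (K3 w ltac:(lra)).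
    assert (Nw : (w - 0)%C <> 0%C) by now apply Cminus_eq_contra.
    assert (X : h w = (G w * (w - 0) ^ S m)%C).
    { rewrite <- E, K1. field. now apply Cpow_nz. }
    assert (B1 : Cmod (h w) <= q * r).
    { rewrite X, Cmod_mult, Cmod_pow.
      assert (T := Cmod_le_add (G w) (G 0%C)).
      apply Rmult_le_compat; [apply Cmod_ge_0|apply pow_le, Cmod_ge_0|unfold q; lra|].
      assert (G0 := Cmod_ge_0 (w - 0)).
      assert (P1 : 0 <= Cmod (w - 0) ^ m <= 1).
      { split; [now apply pow_le|]. rewrite <- (pow1 m). apply pow_incr. lra. }
      rewrite <- tech_pow_Rmult. nra. }
    assert (B2 := Cmod_le_add (h 0%C) (h w)). rewrite Cmod_minus_sym in B2. fold a in B2.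
    apply (Rmult_le_compat_l q) in R6; [|lra].
    replace (q * (a / (2 * q))) with (a / 2) in R6 by (field; lra). lra. }
  destruct HFd as [b Hb]. change (is_C_derive F 0 b) in Hb.
  assert (FC := proj1 (cont_eps_iff F 0%C) (is_C_derive_cont F 0 b Hb)).
  assert (E0 : F 0%C = G 0%C).
  { apply Ceq_minus, Cmod_eq_0, Rle_antisym; [|apply Cmod_ge_0].
    apply le_epsilon. intros eps Heps. rewrite Rplus_0_l.
    destruct (FC (eps / 2) ltac:(lra)) as [e1 [He1 K1]].
    destruct (GC (eps / 2) ltac:(lra)) as [e2 [He2 K2]].
    destruct (disc_punctured_ex 0 (Rmin e (Rmin e1 e2))) as [w [Hw Hw0]]; [repeat apply Rmin_pos; assumption|].
    unfold disc in Hw.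
    assert (W1 := Rlt_le_trans _ _ _ Hw (Rmin_l _ _)).
    assert (W' := Rlt_le_trans _ _ _ Hw (Rmin_r _ _)).
    assert (W2 := Rlt_le_trans _ _ _ W' (Rmin_l _ _)).
    assert (W3 := Rlt_le_trans _ _ _ W' (Rmin_r _ _)).
    specialize (E w W1 Hw0). specialize (K1 w W2). specialize (K2 w W3).
    replace (F 0%C - G 0%C)%C with ((G w - G 0%C) - (F w - F 0%C))%C by (rewrite E; ring).
    eapply Rle_trans; [apply Cmod_minus_le|]. lra. }
  apply (is_C_derive_ext_loc G); [|exact HG].
  exists e. split; [exact He|]. intros w Hw.
  destruct (Ceq_dec w 0%C) as [->|Hne]; [now symmetry|]. symmetry. now apply E.
Qed.

(** At 0 the factor [/ ((z - 1) * (z - 2))] has value 1/2 and derivative 3/4, and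
    [H 0 = 2 * b0 c]. *)
Lemma zfun_derive_0 (d : C) : is_C_derive H 0 d ->
  is_C_derive (zfun H) 0 (d / 2 + 3 / 2 * b0 c)%C.
Proof.
  intros Hd.
  assert (N : ((0 - 1) * (0 - 2))%C <> 0%C).
  { replace ((0 - 1) * (0 - 2))%C with (RtoC 2) by ring. apply RtoC_neq. lra. }
  eapply is_C_derive_eq.
  - unfold zfun. apply (is_C_derive_mult H (fun z => / ((z - 1) * (z - 2)))%C); [exact Hd|].
    apply (is_C_derive_inv (fun z => (z - 1) * (z - 2))%C); [exact N|].
    apply (is_C_derive_mult (fun z => z - 1)%C (fun z => z - 2)%C);
      (apply is_C_derive_minus; [apply is_C_derive_id|apply is_C_derive_const]).
  - cbv beta. rewrite (H_at_0 c H Hc HP). replace ((0 - 1) * (0 - 2))%C with (RtoC 2) by ring. field.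
Qed.

Lemma continuation_derive_0 (U : C -> Prop) (F : C -> C) (d : C) : zeta_continuation c U F ->
  is_C_derive H 0 d -> is_C_derive F 0 (d / 2 + 3 / 2 * b0 c)%C.
Proof.
  intros HUF Hd. assert (G := continuation_germ_0 U F HUF).
  destruct HUF as [HU [_ [_ [U0 [HF _]]]]].
  apply (germ_eq_derive U F (zfun H)); auto. now apply zfun_derive_0.
Qed.

(* The derivative at [z = 0] of [phi j z w]; the last clause is meant for [j = 2] only. *)
Definition psi (j : nat) (w : C) : C :=
  match j with
  | O => (- (Clog w * (w * w)))%C
  | S O => (- (2 * Clog w * w) - w)%C
  | _ => (- (2 * Clog w) - 3)%C
  end.

Lemma is_C_derive_phi_0 (j : nat) (w : C) : (j < 3)%nat -> 0 < Re w ->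
  is_C_derive (fun z => phi j z w) 0 (psi j w).
Proof.
  intros Hj Hw.
  assert (D0 : forall z, is_C_derive (fallc 0) z 0) by (intros z; apply (is_C_derive_const 1)).
  assert (D1 : forall z, is_C_derive (fallc 1) z (- (1))%C).
  { intros z. apply (is_C_derive_ext (fun z => 2 - z)%C); [intros v; simpl; ring|].
    eapply is_C_derive_eq; [apply is_C_derive_minus; [apply is_C_derive_const|apply is_C_derive_id]|].
    ring. }
  destruct j as [|[|[|j]]]; [| | |lia].
  - eapply is_C_derive_eq; [apply is_C_derive_phi, D0|]. simpl.
    replace (2 - 0 - 0)%C with (RtoC 2) by ring. rewrite Cpower_2 by exact Hw. ring.
  - eapply is_C_derive_eq; [apply is_C_derive_phi, D1|]. simpl.
    replace (2 - 0 - 1)%C with (RtoC 1) by ring. rewrite Cpower_1 by exact Hw. ring.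
  - eapply is_C_derive_eq.
    + apply is_C_derive_phi.
      apply (is_C_derive_mult (fallc 1) (fun z => 2 - z - 1)%C); [apply D1|].
      apply is_C_derive_minus; [apply is_C_derive_minus; [apply is_C_derive_const|apply is_C_derive_id]|apply is_C_derive_const].
    + simpl. replace (1 + 1)%R with 2 by ring.
      replace (2 - 0 - 2)%C with (RtoC 0) by ring. rewrite Cpower_0. ring.
Qed.

Lemma H_derive_0 (d : C) : tends eventually (fun n => dPsum c 3 (S n) (S n) psi) d -> is_C_derive H 0 d.
Proof.
  (* [3] is the least [M] that admits a disc about 0, and [1 / 2] is then the largest radius
     allowed. *)
  intros Hd. destruct (H_weierstrass c H Hc HP 0 3 (1 / 2)) as [d' [Hd' K]]; [lra|lia|simpl; lra|].
  rewrite (tends_unique eventually _ _ _ Hd (K _ (fun n => is_C_derive_Psum c 3 (S n) (S n) 0 psi Hc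
    (fun j w Hj Hw => is_C_derive_phi_0 j w ltac:(lia) Hw)))).
  exact Hd'.
Qed.

End Uniqueness.

(** * Exponential integrals *)

(* Lower and upper bounds of integration, tending to [0] from the right and to infinity. *)
Definition ends : (R * R -> Prop) -> Prop := filter_prod (at_right 0) (Rbar_locally p_infty).

Global Instance ends_filter : ProperFilter ends.
Proof. apply filter_prod_proper. Qed.

Lemma ends_intro (d X : R) (P : R -> R -> Prop) : 0 < d ->
  (forall e T, 0 < e < d -> X < T -> P e T) -> ends (fun p => P (fst p) (snd p)).
Proof.
  intros Hd H. apply (Filter_prod _ _ _ (fun e => 0 < e < d) (fun T => X < T)).
  - exists (mkposreal d Hd). intros e He He0. split; [exact He0|].
    unfold ball in He; simpl in He. unfold AbsRing_ball, abs, minus, plus, opp in He; simpl in He.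
    rewrite Rabs_pos_eq in He; lra.
  - exists X. auto.
  - intros e T He HT. now apply H.
Qed.

Lemma exp_neg_small (m eps : R) : 0 < m -> 0 < eps -> exists X, 1 <= X /\ forall T, X < T -> exp (- m * T) < eps.
Proof.
  intros Hm He. exists (Rmax 1 (- ln eps / m)). split; [apply Rmax_l|]. intros T HT.
  assert (H : - ln eps / m < T) by (eapply Rle_lt_trans; [apply Rmax_r|exact HT]).
  rewrite <- (exp_ln eps) by exact He. apply exp_increasing.
  apply (Rmult_lt_compat_l m) in H; [|exact Hm]. replace (m * (- ln eps / m)) with (- ln eps) in H by (field; lra). lra.
Qed.

Lemma Cmod_exp_arg (w : C) (t : R) : Cmod (Cexp (- (w * t))) = exp (- Re w * t).
Proof. rewrite Cmod_Cexp. f_equal. rewrite re_opp, re_scal_r. ring. Qed.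

Lemma Rder_expm (w : C) (t : R) : Rder (fun s => Cexp (- (w * s))) t (- w * Cexp (- (w * t)))%C.
Proof.
  eapply Rder_eq.
  - apply (Rder_Cexp (fun s => - (w * s))%C). apply (Rder_opp (fun s => w * s)%C).
    apply Rder_mult; [apply Rder_const|apply Rder_id].
  - cbv beta. ring.
Qed.

Lemma RtoC_neq_0 (x : R) : x <> 0 -> RtoC x <> 0%C.
Proof. intros H E. apply H. now apply RtoC_inj. Qed.

Lemma Rder_inv_id (t : R) : t <> 0 -> Rder (fun s => / RtoC s)%C t (- (/ t * / t))%C.
Proof.
  intros H. assert (N := RtoC_neq_0 t H). eapply Rder_eq.
  - apply (Rder_comp Cinv (fun s => RtoC s)); [apply is_C_derive_Cinv, N|apply Rder_id].
  - field. exact N.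
Qed.

Lemma cont_expm (w : C) (a b : R) : Ccont_on (fun s => Cexp (- (w * s))) a b.
Proof. intros t _. eapply Rder_cont, Rder_expm. Qed.

Lemma cont_inv_id (a b : R) : 0 < a -> Ccont_on (fun s => / RtoC s)%C a b.
Proof. intros Ha t Ht. eapply Rder_cont, Rder_inv_id. lra. Qed.

Definition I1 (w : C) (e T : R) : C := CInt (fun t => Cexp (- (w * t)) * / t)%C e T.
Definition I2 (w : C) (e T : R) : C := CInt (fun t => Cexp (- (w * t)) * (/ t * / t))%C e T.
Definition I3 (w : C) (e T : R) : C := CInt (fun t => Cexp (- (w * t)) * (/ t * / t * / t))%C e T.

Lemma cont_I1 (w : C) (a b : R) : 0 < a -> Ccont_on (fun t => Cexp (- (w * t)) * / t)%C a b.
Proof. intros Ha. apply cont_on_mult; [apply cont_expm|now apply cont_inv_id]. Qed.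

Lemma cont_I2 (w : C) (a b : R) : 0 < a -> Ccont_on (fun t => Cexp (- (w * t)) * (/ t * / t))%C a b.
Proof. intros Ha. apply cont_on_mult; [apply cont_expm|]. apply cont_on_mult; now apply cont_inv_id. Qed.

Lemma cont_I3 (w : C) (a b : R) : 0 < a -> Ccont_on (fun t => Cexp (- (w * t)) * (/ t * / t * / t))%C a b.
Proof.
  intros Ha. apply cont_on_mult; [apply cont_expm|].
  apply cont_on_mult; [apply cont_on_mult|]; now apply cont_inv_id.
Qed.

Lemma CInt_expm (w : C) (a b : R) : a <= b -> w <> 0%C ->
  CInt (fun t => Cexp (- (w * t))) a b = ((Cexp (- (w * a)) - Cexp (- (w * b))) / w)%C.
Proof.
  intros Hab Hw. rewrite (CInt_derive (fun t => - / w * Cexp (- (w * t)))%C).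
  - field. exact Hw.
  - exact Hab.
  - intros t _. eapply Rder_eq; [apply Rder_mult; [apply Rder_const|apply Rder_expm]|]. cbv beta. field. exact Hw.
  - apply cont_expm.
Qed.

Lemma I2_parts (w : C) (e T : R) : 0 < e <= T ->
  I2 w e T = (- w * I1 w e T - (Cexp (- (w * T)) * / T - Cexp (- (w * e)) * / e))%C.
Proof.
  intros [He HT]. unfold I1, I2.
  assert (K1 := cont_I1 w e T He). assert (K2 := cont_I2 w e T He).
  rewrite <- (CInt_derive (fun t => Cexp (- (w * t)) * / t)%C
    (fun t => - w * (Cexp (- (w * t)) * / t) - Cexp (- (w * t)) * (/ t * / t))%C e T HT).
  - rewrite CInt_minus, CInt_scal by (assumption || (apply cont_on_mult; [apply cont_on_const|exact K1])). ring.
  - intros t Ht. eapply Rder_eq; [apply Rder_mult; [apply Rder_expm|apply Rder_inv_id; lra]|]. cbv beta. ring.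
  - apply cont_on_minus; [apply cont_on_mult; [apply cont_on_const|exact K1]|exact K2].
Qed.

Lemma I3_parts (w : C) (e T : R) : 0 < e <= T ->
  (2 * I3 w e T)%C = (- w * I2 w e T - (Cexp (- (w * T)) * (/ T * / T) - Cexp (- (w * e)) * (/ e * / e)))%C.
Proof.
  intros [He HT]. unfold I2, I3.
  assert (K1 := cont_I2 w e T He). assert (K2 := cont_I3 w e T He).
  rewrite <- (CInt_derive (fun t => Cexp (- (w * t)) * (/ t * / t))%C
    (fun t => - w * (Cexp (- (w * t)) * (/ t * / t)) - 2 * (Cexp (- (w * t)) * (/ t * / t * / t)))%C e T HT).
  - rewrite CInt_minus, !CInt_scal by (assumption || (apply cont_on_mult; [apply cont_on_const|assumption])). ring.
  - intros t Ht. eapply Rder_eq.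
    + apply Rder_mult; [apply Rder_expm|]. apply Rder_mult; apply Rder_inv_id; lra.
    + cbv beta. ring.
  - apply cont_on_minus; (apply cont_on_mult; [apply cont_on_const|assumption]).
Qed.

(** Differentiation brings down a factor [t] that cancels [/ t], so the derivative is an elementary
    integral. The exchange rests on the quadratic Taylor bound, in which [/ t] again absorbs one
    power of [t]; this leaves the factor [Cmod k ^ 2 * T] in [B]. *)
Lemma Rder_I1 (w k : C) (s e T : R) : 0 < e <= T ->
  Rder (fun s => I1 (w + s * k) e T) s (- (k * CInt (fun t => Cexp (- ((w + s * k) * t))) e T))%C.
Proof.
  intros [He HT]. set (v := (w + s * k)%C).
  pose (B := exp (Cmod v * T) * (Cmod k ^ 2 * T) * exp (Cmod k * T) * (T - e)).
  assert (B0 : 0 <= B).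
  { unfold B. repeat apply Rmult_le_pos; try (apply Rlt_le, exp_pos); try lra; apply Cmod_ge_0 || lra. }
  apply Rder_eps. intros eps Heps.
  exists (Rmin 1 (eps / (B + 1))). split; [apply Rmin_pos; [lra|apply Rdiv_lt_0_compat; lra]|].
  intros s' Hs. set (h := s' - s) in *.
  assert (H1 := Rlt_le_trans _ _ _ Hs (Rmin_l _ _)).
  assert (H2 := Rlt_le_trans _ _ _ Hs (Rmin_r _ _)).
  assert (Eq : (w + s' * k)%C = (v + h * k)%C) by (unfold v, h; rewrite RtoC_minus; ring).
  rewrite Eq. unfold I1. fold v.
  replace (h * - (k * CInt (fun t => Cexp (- (v * t))) e T))%C with
    (- ((h * k) * CInt (fun t => Cexp (- (v * t))) e T))%C by ring.
  rewrite <- CInt_scal by (try exact HT; apply cont_expm).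
  replace (CInt (fun t => Cexp (- ((v + h * k) * t)) * / t) e T - CInt (fun t => Cexp (- (v * t)) * / t) e T
    - - CInt (fun t => h * k * Cexp (- (v * t))) e T)%C with
   ((CInt (fun t => Cexp (- ((v + h * k) * t)) * / t) e T - CInt (fun t => Cexp (- (v * t)) * / t) e T)
    + CInt (fun t => h * k * Cexp (- (v * t))) e T)%C by ring.
  assert (K1 := cont_I1 (v + h * k) e T He). assert (K2 := cont_I1 v e T He).
  assert (K3 : Ccont_on (fun t => h * k * Cexp (- (v * t)))%C e T).
  { apply cont_on_mult; [apply cont_on_const|apply cont_expm]. }
  rewrite <- CInt_minus, <- CInt_plus; auto; [|now apply cont_on_minus].
  apply Rle_trans with (B * Rabs h * Rabs h).
  - replace (B * Rabs h * Rabs h) with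
      (Rabs h ^ 2 * (exp (Cmod v * T) * (Cmod k ^ 2 * T) * exp (Cmod k * T)) * (T - e)) by (unfold B; ring).
    apply CInt_bound; [exact HT|apply cont_on_plus; [now apply cont_on_minus|exact K3]|].
    intros t Ht. assert (Nt : RtoC t <> 0%C) by (apply RtoC_neq_0; lra).
    replace (Cexp (- ((v + h * k) * t)) * / t - Cexp (- (v * t)) * / t + h * k * Cexp (- (v * t)))%C with
      (Cexp (- (v * t)) * (Cexp (- (h * k * t)) - 1 - - (h * k * t)) * / t)%C.
    2:{ replace (- ((v + h * k) * t))%C with (- (v * t) + - (h * k * t))%C by ring. rewrite Cexp_add. field. exact Nt. }
    rewrite !Cmod_mult, Cmod_inv, Cmod_R, Rabs_pos_eq by (lra || exact Nt).
    assert (X := Cexp_taylor2 (- (h * k * t))). rewrite Cmod_opp, !Cmod_mult, !Cmod_R, (Rabs_pos_eq t) in X by lra.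
    assert (Gk := Cmod_ge_0 k). assert (Gh := Rabs_pos h). assert (Gv := Cmod_ge_0 v).
    assert (Y : Cmod (Cexp (- (v * t))) <= exp (Cmod v * T)).
    { rewrite Cmod_exp_arg. apply exp_le.
      assert (A := re_le_Cmod v). assert (A' := Rle_abs (- Re v)). rewrite Rabs_Ropp in A'.
      apply Rle_trans with (Cmod v * t); [apply Rmult_le_compat_r; lra|apply Rmult_le_compat_l; lra]. }
    assert (Z : exp (Rabs h * Cmod k * t) <= exp (Cmod k * T)).
    { apply exp_le. replace (Cmod k * T) with (1 * Cmod k * T) by ring.
      apply Rmult_le_compat; try lra; [apply Rmult_le_pos; lra|]. apply Rmult_le_compat_r; lra. }
    apply Rle_trans with (exp (Cmod v * T) * ((Rabs h * Cmod k * t) ^ 2 * exp (Cmod k * T)) * / t).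
    + apply Rmult_le_compat_r; [apply Rlt_le, Rinv_0_lt_compat; lra|].
      apply Rmult_le_compat; try apply Cmod_ge_0; [exact Y|].
      eapply Rle_trans; [exact X|]. apply Rmult_le_compat_l; [apply pow2_ge_0|exact Z].
    + replace (exp (Cmod v * T) * ((Rabs h * Cmod k * t) ^ 2 * exp (Cmod k * T)) * / t) with
        (Rabs h ^ 2 * (exp (Cmod v * T) * (Cmod k ^ 2 * t) * exp (Cmod k * T))) by (field; lra).
      apply Rmult_le_compat_l; [apply pow2_ge_0|].
      apply Rmult_le_compat_r; [apply Rlt_le, exp_pos|].
      apply Rmult_le_compat_l; [apply Rlt_le, exp_pos|].
      apply Rmult_le_compat_l; [apply pow2_ge_0|lra].
  - apply Rmult_le_compat_r; [apply Rabs_pos|]. assert (Gh := Rabs_pos h).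
    apply (Rmult_lt_compat_r (B + 1)) in H2; [|lra].
    replace (eps / (B + 1) * (B + 1)) with eps in H2 by (field; lra). nra.
Qed.

Lemma Clog_1 : Clog 1 = 0%C.
Proof.
  unfold Clog. rewrite Carg_atan by (simpl; lra). rewrite Cmod_1, ln_1. simpl.
  replace (0 / 1) with 0 by field. rewrite atan_0. reflexivity.
Qed.

(* Frullani's integral: the derivative of [I1 w e T] in [w] is explicit and tends to [- / w]. *)
Lemma I1_log (w : C) : 0 < Re w -> tends ends (fun p => I1 w (fst p) (snd p) - I1 1 (fst p) (snd p))%C (- Clog w)%C.
Proof.
  intros Hw. set (k := (w - 1)%C). set (m := Rmin 1 (Re w)).
  assert (Hm : 0 < m) by (apply Rmin_pos; lra).
  set (B := 1 + Cmod w). assert (HB : 1 <= B) by (unfold B; generalize (Cmod_ge_0 w); lra).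
  assert (Hk0 := Cmod_ge_0 k).
  assert (Hws : forall s, 0 <= s <= 1 -> m <= Re (1 + s * k)%C /\ Cmod (1 + s * k)%C <= B).
  { intros s Hs. replace (1 + s * k)%C with ((1 - s)%R + s * w)%C by (unfold k; rewrite RtoC_minus; ring).
    split.
    - rewrite re_plus, re_RtoC, re_scal_l.
      assert (A := Rmin_l 1 (Re w)). assert (A' := Rmin_r 1 (Re w)). fold m in A, A'. nra.
    - eapply Rle_trans; [apply Cmod_triangle|]. rewrite Cmod_mult, !Cmod_R, !Rabs_pos_eq by lra.
      unfold B. assert (G := Cmod_ge_0 w). nra. }
  assert (Main : forall e T, 0 < e < 1 -> 1 < T ->
    Cmod (I1 w e T - I1 1 e T - - Clog w) <= Cmod k / m * (B * e * exp B + exp (- m * T))).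
  { intros e T He HT.
    pose (g := fun s : R => (I1 (1 + s * k) e T + Clog (1 + s * k))%C).
    replace (I1 w e T - I1 1 e T - - Clog w)%C with (g 1 - g 0)%C.
    2:{ unfold g. replace (1 + 1%R * k)%C with w by (unfold k; ring).
        replace (1 + 0%R * k)%C with (RtoC 1) by ring. rewrite Clog_1. ring. }
    match goal with |- _ <= ?X => replace X with (X * (1 - 0)) by ring end.
    apply (mean_value_C g (fun s => k / (1 + s * k) * (1 - Cexp (- ((1 + s * k) * e)) + Cexp (- ((1 + s * k) * T))))%C); [lra| |].
    - intros s Hs. destruct (Hws s Hs) as [W1 W2].
      assert (Nz : (1 + s * k)%C <> 0%C) by (apply neq_0_Re; lra).
      unfold g. eapply Rder_eq.
      + apply Rder_plus; [apply Rder_I1; lra|]. apply (Rder_Clog (fun s => 1 + s * k)%C); [lra|apply Rder_line].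
      + rewrite CInt_expm by (lra || exact Nz). field. exact Nz.
    - intros s Hs. destruct (Hws s Hs) as [W1 W2].
      assert (Nz : (1 + s * k)%C <> 0%C) by (apply neq_0_Re; lra).
      set (v := (1 + s * k)%C) in *.
      rewrite Cmod_mult, Cmod_div by exact Nz.
      assert (Gv : m <= Cmod v) by (eapply Rle_trans; [exact W1|]; eapply Rle_trans; [apply Rle_abs|apply re_le_Cmod]).
      apply Rmult_le_compat; try apply Cmod_ge_0; [apply Rdiv_le_0_compat; lra| |].
      + apply Rmult_le_compat_l; [exact Hk0|]. apply Rinv_le_contravar; lra.
      + eapply Rle_trans; [apply Cmod_triangle|]. apply Rplus_le_compat.
        * rewrite Cmod_minus_sym. eapply Rle_trans; [apply Cexp_taylor1|].
          rewrite Cmod_opp, Cmod_mult, Cmod_R, Rabs_pos_eq by lra.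
          apply Rmult_le_compat; [apply Rmult_le_pos; lra|apply Rlt_le, exp_pos|apply Rmult_le_compat_r; lra|].
          apply exp_le. nra.
        * rewrite Cmod_exp_arg. apply exp_le. apply Rmult_le_compat_r; lra. }
  intros eps Heps.
  set (q := Cmod k / m + 1). assert (Hq : 0 < q).
  { unfold q. assert (0 <= Cmod k / m) by (apply Rdiv_le_0_compat; lra). lra. }
  destruct (exp_neg_small m (eps / (2 * q)) Hm) as [X [X1 HX]]; [apply Rdiv_lt_0_compat; lra|].
  set (d := Rmin 1 (eps / (2 * q * (B * exp B)))).
  assert (HBe : 0 < B * exp B) by (apply Rmult_lt_0_compat; [lra|apply exp_pos]).
  apply (ends_intro d X (fun e T => Cmod (I1 w e T - I1 1 e T - - Clog w)%C < eps)).
  { apply Rmin_pos; [lra|]. apply Rdiv_lt_0_compat; [lra|]. apply Rmult_lt_0_compat; lra. }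
  intros e T [He0 He] HT.
  assert (He1 := Rlt_le_trans _ _ _ He (Rmin_l _ _)).
  assert (He2 := Rlt_le_trans _ _ _ He (Rmin_r _ _)).
  eapply Rle_lt_trans; [apply Main; lra|].
  specialize (HX T HT).
  assert (Y : B * e * exp B < eps / (2 * q)).
  { apply (Rmult_lt_compat_r (B * exp B)) in He2; [|lra].
    replace (eps / (2 * q * (B * exp B)) * (B * exp B)) with (eps / (2 * q)) in He2 by (field; split; [apply Rgt_not_eq, exp_pos|lra]).
    lra. }
  assert (E : q * (eps / (2 * q) + eps / (2 * q)) = eps) by (field; lra).
  assert (P1 : 0 <= B * e * exp B) by (apply Rmult_le_pos; [nra|apply Rlt_le, exp_pos]).
  assert (P2 := exp_pos (- m * T)).
  assert (Z : Cmod k / m * (B * e * exp B + exp (- m * T)) <= q * (B * e * exp B + exp (- m * T))).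
  { apply Rmult_le_compat_r; [lra|]. unfold q. lra. }
  assert (Z2 : q * (B * e * exp B + exp (- m * T)) < q * (eps / (2 * q) + eps / (2 * q))).
  { apply Rmult_lt_compat_l; lra. }
  lra.
Qed.

(** * The Euler-Mascheroni constant *)

Lemma is_RInt_exp (m a b : R) : 0 < m ->
  is_RInt (fun t => exp (- m * t)) a b ((exp (- m * a) - exp (- m * b)) / m).
Proof.
  intros Hm.
  replace ((exp (- m * a) - exp (- m * b)) / m) with (minus (- / m * exp (- m * b)) (- / m * exp (- m * a))).
  - apply (is_RInt_derive (V:=R_CompleteNormedModule) (fun t => - / m * exp (- m * t))).
    + intros t _. auto_derive; [auto|]. field. lra.
    + intros t _. apply (ex_derive_continuous (K:=R_AbsRing) (V:=R_NormedModule)). auto_derive. auto.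
  - unfold minus, plus, opp; simpl. field. lra.
Qed.

Lemma CInt_exp_le (f : R -> C) (M m a b : R) : 0 < m -> 0 <= M -> 0 <= a <= b -> Ccont_on f a b ->
  (forall t, a <= t <= b -> Cmod (f t) <= M * exp (- m * t)) -> Cmod (CInt f a b) <= M / m * exp (- m * a).
Proof.
  intros Hm HM [Ha Hab] Hc Hf.
  eapply Rle_trans.
  - apply (CInt_le f (fun t => M * exp (- m * t)) a b _ Hab Hc Hf).
    apply (is_RInt_scal (V:=R_NormedModule) _ a b M). now apply is_RInt_exp.
  - unfold scal; simpl. unfold mult; simpl.
    assert (P := exp_pos (- m * b)). unfold Rdiv.
    assert (Q : 0 <= M * / m) by (apply Rmult_le_pos; [exact HM|apply Rlt_le, Rinv_0_lt_compat, Hm]).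
    replace (M * ((exp (- m * a) - exp (- m * b)) * / m)) with (M * / m * (exp (- m * a) - exp (- m * b))) by ring.
    apply Rmult_le_compat_l; lra.
Qed.

Lemma exp_opp_lt_1 (t : R) : 0 < t -> 0 < 1 - exp (- t).
Proof. intros Ht. rewrite <- exp_0. assert (exp (- t) < exp 0) by (apply exp_increasing; lra). lra. Qed.

(** The quotient is 1 / (e^t - 1). The lower bound is e^x >= 1 + x at x = - t, the upper one the
    same at x = t. *)
Lemma bose_diff_bound (t : R) : 0 < t -> -1 <= exp (- t) / (1 - exp (- t)) - / t <= 0.
Proof.
  intros Ht. assert (P := exp_opp_lt_1 t Ht). assert (E := exp_pos (- t)).
  assert (A : 1 - t <= exp (- t)) by (assert (X := exp_ineq1_le (- t)); lra).
  assert (B : t * exp (- t) <= 1 - exp (- t)).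
  { assert (X := exp_ineq1_le t). assert (Y : exp t * exp (- t) = 1) by (rewrite <- exp_plus, Rplus_opp_r; apply exp_0). nra. }
  set (x := exp (- t)) in *. split.
  - apply Rmult_le_reg_r with (t * (1 - x)); [nra|].
    replace ((x / (1 - x) - / t) * (t * (1 - x))) with (t * x - (1 - x)) by (field; lra). nra.
  - apply Rmult_le_reg_r with (t * (1 - x)); [nra|].
    replace ((x / (1 - x) - / t) * (t * (1 - x))) with (t * x - (1 - x)) by (field; lra). nra.
Qed.

Lemma ln_near_1 (eps : R) : 0 < eps -> exists d, 0 < d <= 1 / 2 /\ forall x, 1 - d < x <= 1 -> Rabs (ln x) < eps.
Proof.
  intros He.
  assert (H : continuous ln 1).
  { apply (ex_derive_continuous (K:=R_AbsRing) (V:=R_NormedModule)). auto_derive. lra. }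
  destruct (proj1 (filterlim_locally _ _) H (mkposreal eps He)) as [d Hd].
  exists (Rmin d (1 / 2)). split; [split; [apply Rmin_pos; [apply cond_pos|lra]|apply Rmin_r]|].
  intros x Hx. assert (A := Rmin_l d (1 / 2)).
  assert (B : ball 1 d x).
  { unfold ball; simpl. unfold AbsRing_ball, abs, minus, plus, opp; simpl. rewrite Rabs_left1 by lra. lra. }
  specialize (Hd x B). unfold ball in Hd; simpl in Hd. unfold AbsRing_ball, abs, minus, plus, opp in Hd; simpl in Hd.
  rewrite ln_1 in Hd. replace (ln x) with (ln x + - 0) by ring. exact Hd.
Qed.

Definition geosum (N : nat) (t : R) : C := Csum (fun k => Cexp (- (INR (S k) * t)))%C N.

Lemma geosum_eq (N : nat) (t : R) :
  (geosum N t * (1 - exp (- t)%R))%C = RtoC (exp (- t) - exp (- INR N * t) * exp (- t)).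
Proof.
  unfold geosum. induction N as [|N IH].
  - simpl. replace (- 0 * t) with 0 by ring. rewrite exp_0. rewrite RtoC_minus, RtoC_mult. ring.
  - cbn [Csum]. rewrite Cmult_plus_distr_r, IH.
    replace (- (INR (S N) * t))%C with (RtoC (- INR (S N) * t)) by (rewrite RtoC_mult, RtoC_opp; ring).
    rewrite Cexp_RtoC. replace (- INR (S N) * t) with (- INR N * t + - t) by (rewrite S_INR; ring).
    rewrite exp_plus, <- RtoC_minus, <- RtoC_mult, <- RtoC_plus. f_equal. ring.
Qed.

(* Tends to H_N - ln N along [ends]. *)
Definition Jsum (N : nat) (e T : R) : C := (CInt (geosum N) e T - (I1 1 e T - I1 (INR N) e T))%C.

(** 1 / (e^t - 1) has the primitive ln(1 - e^(-t)), while [geosum N] minus it plus e^(-N t) / t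
    equals e^(-N t) times a factor in [0, 1] by [bose_diff_bound]. The integral of this is at most
    [/ INR N]; the two logarithms are the values at the end points. *)
Lemma kappa_Jsum (N : nat) (e T : R) : (0 < N)%nat -> 0 < e <= T ->
  Cmod (I1 1 e T + ln e + Jsum N e T) <= / INR N + Rabs (ln (1 - exp (- T))) + Rabs (ln ((1 - exp (- e)) / e)).
Proof.
  intros HN [He HT]. assert (PN : 0 < INR N) by now apply lt_0_INR.
  pose (b := fun t => RtoC (exp (- t) / (1 - exp (- t)))).
  assert (Db : forall t, e <= t <= T -> Rder (fun t => RtoC (ln (1 - exp (- t)))) t (b t)).
  { intros t Ht. assert (P := exp_opp_lt_1 t ltac:(lra)). apply Rder_RtoC. auto_derive; [lra|]. field. lra. }
  assert (Cb : Ccont_on b e T).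
  { intros t Ht. assert (P := exp_opp_lt_1 t ltac:(lra)). apply (cont_RtoC (fun t => exp (- t) / (1 - exp (- t)))).
    apply (ex_derive_continuous (K:=R_AbsRing) (V:=R_NormedModule)). auto_derive. lra. }
  assert (Lg : CInt b e T = RtoC (ln (1 - exp (- T)) - ln (1 - exp (- e)))).
  { rewrite (CInt_derive (fun t => RtoC (ln (1 - exp (- t)))) b e T HT Db Cb). now rewrite RtoC_minus. }
  assert (Cg : Ccont_on (geosum N) e T).
  { apply (cont_on_Csum (fun k t => Cexp (- (INR (S k) * t)))%C). intros k _. apply cont_expm. }
  assert (CI := cont_I1 (INR N) e T He).
  assert (B : Cmod (CInt (fun t => geosum N t - b t + Cexp (- (INR N * t)) * / t)%C e T) <= / INR N).
  { apply Rle_trans with (1 / INR N * exp (- INR N * e)).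
    - apply CInt_exp_le; [exact PN|lra|lra|apply cont_on_plus; [now apply cont_on_minus|exact CI]|].
      intros t Ht. assert (P := exp_opp_lt_1 t ltac:(lra)). assert (BB := bose_diff_bound t ltac:(lra)).
      assert (Nx : RtoC (1 - exp (- t)) <> 0%C) by (apply RtoC_neq_0; lra).
      replace (geosum N t - b t + Cexp (- (INR N * t)) * / t)%C with
        (RtoC (- exp (- INR N * t) * (exp (- t) / (1 - exp (- t)) - / t))).
      + rewrite Cmod_R, Rabs_mult, Rabs_Ropp, (Rabs_pos_eq (exp _)) by apply Rlt_le, exp_pos.
        rewrite (Rabs_left1 _ (proj2 BB)). rewrite Rmult_comm. apply Rmult_le_compat_r; [apply Rlt_le, exp_pos|lra].
      + replace (geosum N t) with (RtoC (exp (- t) - exp (- INR N * t) * exp (- t)) / RtoC (1 - exp (- t)))%C.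
        2:{ rewrite <- geosum_eq, RtoC_minus. field. rewrite RtoC_minus in Nx. exact Nx. }
        replace (- (INR N * t))%C with (RtoC (- INR N * t)) by (rewrite RtoC_mult, RtoC_opp; ring).
        rewrite Cexp_RtoC. unfold b. rewrite <- RtoC_inv, <- RtoC_div, <- RtoC_minus, <- RtoC_mult, <- RtoC_plus by lra.
        f_equal. field. lra.
    - unfold Rdiv. rewrite Rmult_1_l. rewrite <- (Rmult_1_r (/ INR N)) at 2.
      apply Rmult_le_compat_l; [apply Rlt_le, Rinv_0_lt_compat, PN|].
      rewrite <- exp_0. apply exp_le. nra. }
  rewrite CInt_plus, CInt_minus in B; [|exact HT|exact Cg|exact Cb|exact HT|now apply cont_on_minus|exact CI].
  fold (I1 (INR N) e T) in B. rewrite Lg in B.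
  assert (Pe := exp_opp_lt_1 e He).
  assert (El : ln ((1 - exp (- e)) / e) = ln (1 - exp (- e)) - ln e) by (apply ln_div; lra).
  replace (I1 1 e T + ln e + Jsum N e T)%C with
    ((CInt (geosum N) e T - RtoC (ln (1 - exp (- T)) - ln (1 - exp (- e))) + I1 (INR N) e T)
     + (RtoC (ln (1 - exp (- T))) - RtoC (ln ((1 - exp (- e)) / e))))%C.
  2:{ unfold Jsum. rewrite El, !RtoC_minus. ring. }
  eapply Rle_trans; [apply Cmod_triangle|].
  rewrite Rplus_assoc. apply Rplus_le_compat; [exact B|].
  eapply Rle_trans; [apply Cmod_minus_le|]. rewrite !Cmod_R. lra.
Qed.

Lemma tends_exp_T (w : C) : 0 < Re w -> tends ends (fun p => Cexp (- (w * snd p)))%C 0%C.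
Proof.
  intros Hw eps He. destruct (exp_neg_small (Re w) eps Hw He) as [X [_ HX]].
  apply (ends_intro 1 X (fun e T => Cmod (Cexp (- (w * T)) - 0)%C < eps)); [lra|].
  intros e T _ HT. replace (Cexp (- (w * T)) - 0)%C with (Cexp (- (w * T))) by ring.
  rewrite Cmod_exp_arg. now apply HX.
Qed.

Lemma tends_exp_e (w : C) : tends ends (fun p => Cexp (- (w * fst p)))%C 1%C.
Proof.
  intros eps He. pose (B := Cmod w * exp (Cmod w)).
  assert (HB : 0 <= B) by (apply Rmult_le_pos; [apply Cmod_ge_0|apply Rlt_le, exp_pos]).
  apply (ends_intro (Rmin 1 (eps / (B + 1))) 0 (fun e T => Cmod (Cexp (- (w * e)) - 1)%C < eps)).
  { apply Rmin_pos; [lra|apply Rdiv_lt_0_compat; lra]. }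
  intros e T [He0 He1] _.
  assert (H1 := Rlt_le_trans _ _ _ He1 (Rmin_l _ _)).
  assert (H2 := Rlt_le_trans _ _ _ He1 (Rmin_r _ _)).
  eapply Rle_lt_trans; [apply Cexp_taylor1|].
  rewrite Cmod_opp, Cmod_mult, Cmod_R, Rabs_pos_eq by lra.
  assert (G := Cmod_ge_0 w).
  apply Rle_lt_trans with (e * B).
  - unfold B. rewrite <- Rmult_assoc, (Rmult_comm e). apply Rmult_le_compat_l; [nra|]. apply exp_le. nra.
  - apply (Rmult_lt_compat_r (B + 1)) in H2; [|lra].
    replace (eps / (B + 1) * (B + 1)) with eps in H2 by (field; lra). nra.
Qed.

Lemma ends_pos : ends (fun p => 0 < fst p <= snd p).
Proof. apply (ends_intro 1 1 (fun e T => 0 < e <= T)); [lra|]. intros; lra. Qed.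

Definition harm (n : nat) : R := sum_n (fun k => / INR (S k)) n - ln (INR (S n)).

Lemma Clog_RtoC (x : R) : 0 < x -> Clog x = RtoC (ln x).
Proof.
  intros Hx. unfold Clog. rewrite Carg_atan by exact Hx. rewrite Cmod_R, Rabs_pos_eq by lra. simpl.
  replace (0 / x) with 0 by (field; lra). rewrite atan_0. reflexivity.
Qed.

Lemma RtoC_sum_n (f : nat -> R) (n : nat) : RtoC (sum_n f n) = Csum (fun k => RtoC (f k)) (S n).
Proof.
  induction n as [|n IH].
  - rewrite sum_O. simpl. ring.
  - rewrite sum_Sn. change (RtoC (sum_n f n + f (S n)) = Csum (fun k => RtoC (f k)) (S n) + RtoC (f (S n)))%C.
    rewrite RtoC_plus, IH. reflexivity.
Qed.

Lemma tends_Jsum (n : nat) : tends ends (fun p => Jsum (S n) (fst p) (snd p)) (RtoC (harm n)).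
Proof.
  assert (E : RtoC (harm n) = (Csum (fun k => / INR (S k) * (1 - 0)) (S n) + (- Clog (INR (S n))))%C).
  { unfold harm. rewrite RtoC_minus. unfold Cminus at 1. f_equal.
    - rewrite RtoC_sum_n. apply Csum_ext. intros k _. rewrite RtoC_inv by (apply not_0_INR; lia). ring.
    - rewrite Clog_RtoC; [reflexivity|]. apply lt_0_INR. lia. }
  rewrite E.
  apply (tends_ext ends (fun p => Csum (fun k => / INR (S k) * (Cexp (- (INR (S k) * fst p)) - Cexp (- (INR (S k) * snd p)))) (S n)
    + (I1 (INR (S n)) (fst p) (snd p) - I1 1 (fst p) (snd p)))%C).
  - generalize ends_pos. apply filter_imp. intros [e T]. cbn [fst snd]. intros [He HT].
    unfold Jsum, geosum. rewrite (CInt_Csum (fun k t => Cexp (- (INR (S k) * t)))%C) by (auto using cont_expm).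
    replace (Csum (fun k => / INR (S k) * (Cexp (- (INR (S k) * e)) - Cexp (- (INR (S k) * T)))) (S n))%C
      with (Csum (fun k => CInt (fun t => Cexp (- (INR (S k) * t))) e T) (S n))%C.
    + ring.
    + apply Csum_ext. intros k _. rewrite CInt_expm by (exact HT || (apply RtoC_neq_0, not_0_INR; lia)).
      unfold Cdiv. ring.
  - apply (tends_plus ends).
    + apply (tends_Csum ends (fun k p => / INR (S k) * (Cexp (- (INR (S k) * fst p)) - Cexp (- (INR (S k) * snd p))))%C).
      intros k _. apply (tends_scal ends). apply (tends_minus ends); [apply tends_exp_e|].
      apply tends_exp_T. rewrite re_RtoC. apply lt_0_INR. lia.
    + apply I1_log. rewrite re_RtoC. apply lt_0_INR. lia.
Qed.

Lemma kappa_harm (n : nat) :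
  ends (fun p => Cmod (I1 1 (fst p) (snd p) + ln (fst p) + harm n) <= 2 / INR (S n)).
Proof.
  assert (P : 0 < INR (S n)) by (apply lt_0_INR; lia).
  (* A third of [/ INR (S n)] for each of the two logarithms and for [Jsum]. *)
  set (q := / INR (S n) / 3). assert (Hq : 0 < q) by (unfold q; apply Rdiv_lt_0_compat; [now apply Rinv_0_lt_compat|lra]).
  destruct (ln_near_1 q Hq) as [d [Hd Hln]].
  destruct (exp_neg_small 1 d ltac:(lra) ltac:(lra)) as [X [X1 HX]].
  assert (Hend := ends_intro d X (fun e T => 0 < e < d /\ X < T) (proj1 Hd) (fun e T he hT => conj he hT)).
  generalize (filter_and _ _ Hend (tends_Jsum n q Hq)). apply filter_imp.
  intros [e T]. cbn [fst snd]. intros [[[He Hed] HT] HJ].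
  assert (K := kappa_Jsum (S n) e T ltac:(lia) ltac:(lra)).
  assert (A1 : Rabs (ln (1 - exp (- T))) < q).
  { apply Hln. specialize (HX T HT). replace (- (1) * T) with (- T) in HX by ring.
    assert (E := exp_pos (- T)). lra. }
  assert (A2 : Rabs (ln ((1 - exp (- e)) / e)) < q).
  { apply Hln. assert (E1 := exp_ineq1_le (- e)). assert (E2 := exp_ineq1_le e).
    assert (E3 : exp e * exp (- e) = 1) by (rewrite <- exp_plus, Rplus_opp_r; apply exp_0).
    assert (E4 := exp_pos (- e)). split.
    - apply (Rmult_lt_reg_r e); [exact He|]. replace ((1 - exp (- e)) / e * e) with (1 - exp (- e)) by (field; lra).
      assert (e * exp (- e) <= 1 - exp (- e)) by nra. nra.
    - apply (Rmult_le_reg_r e); [exact He|]. replace ((1 - exp (- e)) / e * e) with (1 - exp (- e)) by (field; lra). lra. }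
  replace (I1 1 e T + ln e + harm n)%C with ((I1 1 e T + ln e + Jsum (S n) e T) - (Jsum (S n) e T - harm n))%C by ring.
  eapply Rle_trans; [apply Cmod_minus_le|].
  replace (2 / INR (S n)) with (/ INR (S n) + q + q + q) by (unfold q; field; lra). lra.
Qed.

Lemma INR_inv_small (K eps : R) : 0 < eps -> eventually (fun n => K / INR (S n) < eps).
Proof.
  intros He. destruct (INR_large (Rabs K / eps)) as [N HN]. exists N. intros n Hn.
  specialize (HN n Hn). assert (P : 0 < INR (S n)) by (apply lt_0_INR; lia).
  apply (Rmult_lt_reg_r (INR (S n))); [exact P|]. replace (K / INR (S n) * INR (S n)) with K by (field; lra).
  apply (Rmult_le_compat_l eps) in HN; [|lra]. replace (eps * (Rabs K / eps)) with (Rabs K) in HN by (field; lra).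
  rewrite S_INR. assert (A := Rle_abs K). nra.
Qed.

(** [gamma_e] is given by the total function [Lim_seq], so convergence of the harmonic differences
    has to be proved. Since [I1 1 + ln e] does not involve [n], two instances of [kappa_harm]
    compared at one point (e, T) make [harm] Cauchy, with rate [4 / INR (S n)]. *)
Lemma kappa_limit : tends ends (fun p => I1 1 (fst p) (snd p) + ln (fst p))%C (- gamma_e)%C.
Proof.
  destruct (cauchy_C (fun n => RtoC (harm n)) (fun n => 4 / INR (S n))) as [l Hl].
  - intros n m Hnm.
    destruct (filter_ex _ (filter_and _ _ (kappa_harm n) (kappa_harm m))) as [[e T] [A B]].
    cbn [fst snd] in A, B.
    replace (harm m - harm n)%C with ((I1 1 e T + ln e + harm m) - (I1 1 e T + ln e + harm n))%C by ring.
    eapply Rle_trans; [apply Cmod_minus_le|].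
    assert (2 / INR (S m) <= 2 / INR (S n)).
    { apply Rmult_le_compat_l; [lra|]. apply Rinv_le_contravar; [apply lt_0_INR; lia|apply le_INR; lia]. }
    replace (4 / INR (S n)) with (2 / INR (S n) + 2 / INR (S n)) by (field; apply not_0_INR; lia). lra.
  - intros eps He. now apply INR_inv_small.
  - assert (Lim : is_lim_seq harm (Re l)).
    { apply is_lim_seq_spec. intros eps. destruct (INR_inv_small 4 eps (cond_pos eps)) as [N HN].
      exists N. intros n Hn. eapply Rle_lt_trans; [|exact (HN n Hn)].
      eapply Rle_trans; [|exact (Hl n)]. rewrite Cmod_minus_sym.
      eapply Rle_trans; [|apply re_le_Cmod]. unfold Cminus. rewrite re_plus, re_opp, re_RtoC. right. reflexivity. }
    assert (G : gamma_e = Re l).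
    { unfold gamma_e. change (real (Lim_seq harm) = Re l). now rewrite (is_lim_seq_unique _ _ Lim). }
    assert (Hn : forall n, Cmod (harm n - gamma_e)%C <= 4 / INR (S n)).
    { intros n. rewrite <- RtoC_minus, Cmod_R, G, <- Rabs_Ropp.
      replace (- (harm n - Re l)) with (Re (l - harm n)%C) by (unfold Cminus; rewrite re_plus, re_opp, re_RtoC; ring).
      eapply Rle_trans; [apply re_le_Cmod|apply Hl]. }
    intros eps He. destruct (INR_inv_small 6 eps He) as [N HN]. specialize (HN N (le_n N)).
    generalize (kappa_harm N). apply filter_imp. intros [e T]. cbn [fst snd]. intros K.
    replace (I1 1 e T + ln e - - gamma_e)%C with ((I1 1 e T + ln e + harm N) - (harm N - gamma_e))%C by ring.
    eapply Rle_lt_trans; [apply Cmod_minus_le|].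
    specialize (Hn N). replace (6 / INR (S N)) with (2 / INR (S N) + 4 / INR (S N)) in HN by (field; apply not_0_INR; lia).
    lra.
Qed.

(** * Improper integrals and divergent parts *)

(** The same value is delivered in two forms: as the improper integral of the final formula and as a
    limit along [ends], where the computation takes place. *)
Lemma is_RInt_gen_at_point_infty (f : R -> C) (M m : R) : 0 < m -> 0 <= M ->
  (forall t, 1 <= t -> Ccont f t) -> (forall t, 1 <= t -> Cmod (f t) <= M * exp (- m * t)) ->
  exists l : C, @is_RInt_gen C_R_NormedModule f (at_point 1) (Rbar_locally p_infty) l /\
    tends ends (fun p => CInt f 1 (snd p)) l.
Proof.
  intros Hm HM Hc Hf.
  assert (Hc' : forall a b, 1 <= a -> Ccont_on f a b) by (intros a b Ha t Ht; apply Hc; lra).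
  assert (D : forall a b, 1 <= a <= b -> Cmod (CInt f 1 b - CInt f 1 a) <= M / m * exp (- m * a)).
  { intros a b Hab. rewrite <- (CInt_Chasles f 1 a b) by (lra || apply Hc'; lra).
    replace (CInt f 1 a + CInt f a b - CInt f 1 a)%C with (CInt f a b) by ring.
    apply CInt_exp_le; try lra; [apply Hc'; lra|]. intros t Ht. apply Hf. lra. }
  assert (Q : 0 <= M / m) by (apply Rdiv_le_0_compat; lra).
  assert (Sm : forall eps, 0 < eps -> exists X, 1 <= X /\ forall T, X < T -> M / m * exp (- m * T) < eps).
  { intros eps He. destruct (exp_neg_small m (eps / (M / m + 1)) Hm) as [X [X1 HX]]; [apply Rdiv_lt_0_compat; lra|].
    exists X. split; [exact X1|]. intros T HT. specialize (HX T HT). assert (P := exp_pos (- m * T)).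
    apply (Rmult_lt_compat_r (M / m + 1)) in HX; [|lra].
    replace (eps / (M / m + 1) * (M / m + 1)) with eps in HX by (field; split; lra). nra. }
  destruct (cauchy_C (fun n => CInt f 1 (INR (S n))) (fun n => M / m * exp (- m * INR (S n)))) as [l Hl].
  - intros n k Hnk. apply D. split; [apply INR_S_ge|apply le_INR; lia].
  - intros eps He. destruct (Sm eps He) as [X [_ HX]]. destruct (INR_large X) as [N HN].
    exists N. intros n Hn. apply HX. specialize (HN n Hn). rewrite S_INR. lra.
  - assert (B : forall T, 1 <= T -> Cmod (CInt f 1 T - l) <= M / m * exp (- m * T)).
    { intros T HT. apply le_epsilon. intros eps He. destruct (Sm eps He) as [X [_ HX]].
      destruct (INR_large (Rmax X T)) as [N HN]. specialize (HN N (le_n N)).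
      assert (NX := Rmax_l X T). assert (NT := Rmax_r X T). specialize (Hl N). rewrite S_INR in Hl.
      assert (HX' := HX (INR N + 1) ltac:(lra)).
      replace (CInt f 1 T - l)%C with (- (CInt f 1 (INR N + 1)%R - CInt f 1 T) - (l - CInt f 1 (INR N + 1)%R))%C by ring.
      eapply Rle_trans; [apply Cmod_minus_le|]. rewrite Cmod_opp.
      assert (DD := D T (INR N + 1) ltac:(lra)). lra. }
    exists l. split.
    + intros P HP. apply locally_Cmod in HP. destruct HP as [d [Hd HP]].
      destruct (Sm d Hd) as [X [X1 HX]].
      apply (Filter_prod _ _ _ (fun a => a = 1) (fun T => X < T)).
      * reflexivity.
      * exists X. auto.
      * intros a T -> HT. exists (CInt f 1 T). split.
        -- apply CInt_correct; [lra|apply Hc'; lra].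
        -- apply HP. eapply Rle_lt_trans; [apply B; lra|]. now apply HX.
    + intros eps He. destruct (Sm eps He) as [X [X1 HX]].
      apply (ends_intro 1 X (fun e T => Cmod (CInt f 1 T - l)%C < eps)); [lra|].
      intros e T _ HT. eapply Rle_lt_trans; [apply B; lra|]. now apply HX.
Qed.

Lemma is_RInt_gen_at_right_0 (f : R -> C) (M : R) :
  (forall t, 0 < t <= 1 -> Ccont f t) -> (forall t, 0 < t <= 1 -> Cmod (f t) <= M) ->
  exists l : C, @is_RInt_gen C_R_NormedModule f (at_right 0) (at_point 1) l /\
    tends ends (fun p => CInt f (fst p) 1) l.
Proof.
  intros Hc Hf.
  assert (HM : 0 <= M) by (eapply Rle_trans; [apply Cmod_ge_0|apply (Hf 1); lra]).
  assert (Hc' : forall a b, 0 < a -> b <= 1 -> Ccont_on f a b) by (intros a b Ha Hb t Ht; apply Hc; lra).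
  assert (D : forall a b, 0 < a <= b -> b <= 1 -> Cmod (CInt f a 1 - CInt f b 1) <= M * b).
  { intros a b Hab Hb. rewrite <- (CInt_Chasles f a b 1) by (lra || apply Hc'; lra).
    replace (CInt f a b + CInt f b 1 - CInt f b 1)%C with (CInt f a b) by ring.
    apply Rle_trans with (M * (b - a)); [|apply Rmult_le_compat_l; lra].
    apply CInt_bound; try lra; [apply Hc'; lra|]. intros t Ht. apply Hf. lra. }
  assert (Pn : forall n, 0 < / INR (S n) <= 1).
  { intros n. assert (A := INR_S_ge n). split; [apply Rinv_0_lt_compat; lra|].
    rewrite <- Rinv_1. apply Rinv_le_contravar; lra. }
  destruct (cauchy_C (fun n => CInt f (/ INR (S n)) 1) (fun n => M / INR (S n))) as [l Hl].
  - intros n k Hnk. apply D; [|apply Pn]. split; [apply Pn|].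
    apply Rinv_le_contravar; [generalize (INR_S_ge n); lra|apply le_INR; lia].
  - intros eps He. now apply INR_inv_small.
  - assert (B : forall e, 0 < e <= 1 -> Cmod (CInt f e 1 - l) <= M * e).
    { intros e He. apply le_epsilon. intros eps Heps.
      destruct (filter_and _ _ (INR_inv_small M eps Heps) (INR_inv_small 1 e (proj1 He))) as [N HN].
      destruct (HN N (le_n N)) as [N1 N2]. specialize (Hl N). specialize (Pn N).
      replace (CInt f e 1 - l)%C with (- (CInt f (/ INR (S N))%R 1 - CInt f e 1) - (l - CInt f (/ INR (S N))%R 1))%C by ring.
      eapply Rle_trans; [apply Cmod_minus_le|]. rewrite Cmod_opp.
      assert (DD := D (/ INR (S N)) e ltac:(unfold Rdiv in N2; lra) ltac:(lra)). lra. }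
    exists l.
    assert (Sm : forall eps e, 0 < eps -> 0 < e < Rmin 1 (eps / (M + 1)) -> M * e < eps /\ e <= 1).
    { intros eps e He Hee.
      assert (A1 := Rlt_le_trans _ _ _ (proj2 Hee) (Rmin_l _ _)).
      assert (A2 := Rlt_le_trans _ _ _ (proj2 Hee) (Rmin_r _ _)).
      apply (Rmult_lt_compat_r (M + 1)) in A2; [|lra].
      replace (eps / (M + 1) * (M + 1)) with eps in A2 by (field; lra). split; nra. }
    assert (Dp : forall eps, 0 < eps -> 0 < Rmin 1 (eps / (M + 1))).
    { intros eps He. apply Rmin_pos; [lra|]. apply Rdiv_lt_0_compat; lra. }
    split.
    + intros P HP. apply locally_Cmod in HP. destruct HP as [d [Hd HP]].
      apply (Filter_prod _ _ _ (fun e => 0 < e < Rmin 1 (d / (M + 1))) (fun b => b = 1)).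
      * exists (mkposreal _ (Dp d Hd)). intros e He He0. split; [exact He0|].
        unfold ball in He; simpl in He. unfold AbsRing_ball, abs, minus, plus, opp in He; simpl in He.
        rewrite Rabs_pos_eq in He; lra.
      * reflexivity.
      * intros e b He ->. destruct (Sm d e Hd He) as [A1 A2]. exists (CInt f e 1). split.
        -- apply CInt_correct; [simpl; lra|apply Hc'; lra].
        -- apply HP. eapply Rle_lt_trans; [apply B; lra|exact A1].
    + intros eps He. apply (ends_intro _ 0 (fun e T => Cmod (CInt f e 1 - l)%C < eps) (Dp eps He)).
      intros e T Hee _. destruct (Sm eps e He Hee) as [A1 A2].
      eapply Rle_lt_trans; [apply B; lra|exact A1].
Qed.

(** [Cexp (- (w * t)) * kap j t] is the [j]-th derivative in [w] of 2 e^(-w t) t^(-3). Formally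
    w^(2-z) is 1 / Gamma(z-2) times the integral of e^(-w t) t^(z-3), and 2 is the derivative of 1 /
    Gamma at -2, so at z = 0 this is the integrand for the z-derivative of w^(2-z). *)
Definition kap (j : nat) (t : R) : C :=
  match j with
  | O => (2 * (/ t * / t * / t))%C
  | S O => (- (2 * (/ t * / t)))%C
  | _ => (2 * / t)%C
  end.

(* The part of the integral over [e, oo) that diverges as [e] tends to 0, with the constants for which the
   remainder tends to [psi j]; as functions of [w] these are [A + B w + C w^2] and its derivatives. *)
Definition ppi (j : nat) (e : R) (w : C) : C :=
  let lam := (ln e + gamma_e)%R in
  match j with
  | O => (/ e * / e - 2 * w * / e + (3 / 2 - lam) * (w * w))%C
  | S O => (- (2 * / e) + (3 - 2 * lam) * w)%C
  | _ => (3 - 2 * lam)%C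
  end.

Definition Yint (j : nat) (w : C) (e T : R) : C := CInt (fun t => Cexp (- (w * t)) * kap j t)%C e T.

Lemma cont_kap (j : nat) (a b : R) : 0 < a -> Ccont_on (kap j) a b.
Proof.
  intros Ha. assert (K := cont_inv_id a b Ha). destruct j as [|[|j]].
  - apply (cont_on_mult (fun _ => 2%C)); [apply cont_on_const|]. apply cont_on_mult; [now apply cont_on_mult|exact K].
  - apply cont_on_opp. apply (cont_on_mult (fun _ => 2%C)); [apply cont_on_const|]. now apply cont_on_mult.
  - apply (cont_on_mult (fun _ => 2%C)); [apply cont_on_const|exact K].
Qed.

Lemma cont_Yint (j : nat) (w : C) (a b : R) : 0 < a -> Ccont_on (fun t => Cexp (- (w * t)) * kap j t)%C a b.
Proof. intros Ha. apply cont_on_mult; [apply cont_expm|now apply cont_kap]. Qed.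

Lemma Yint_0 (w : C) (e T : R) : 0 < e <= T -> Yint 0 w e T = (2 * I3 w e T)%C.
Proof.
  intros [He HT]. unfold Yint, I3. rewrite <- CInt_scal by (exact HT || now apply cont_I3).
  apply CInt_ext; [exact HT|]. intros t _. unfold kap. ring.
Qed.

Lemma Yint_1 (w : C) (e T : R) : 0 < e <= T -> Yint 1 w e T = (- 2 * I2 w e T)%C.
Proof.
  intros [He HT]. unfold Yint, I2. rewrite <- CInt_scal by (exact HT || now apply cont_I2).
  apply CInt_ext; [exact HT|]. intros t _. unfold kap. ring.
Qed.

Lemma Yint_2 (w : C) (e T : R) : 0 < e <= T -> Yint 2 w e T = (2 * I1 w e T)%C.
Proof.
  intros [He HT]. unfold Yint, I1. rewrite <- CInt_scal by (exact HT || now apply cont_I1).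
  apply CInt_ext; [exact HT|]. intros t _. unfold kap. ring.
Qed.

Lemma tends_0_linear (u : R -> R -> C) (K : R) : 0 <= K ->
  (forall e T, 0 < e < 1 -> 1 < T -> Cmod (u e T) <= K * e) -> tends ends (fun p => u (fst p) (snd p)) 0%C.
Proof.
  intros HK Hu eps He.
  apply (ends_intro (Rmin 1 (eps / (K + 1))) 1 (fun e T => Cmod (u e T - 0)%C < eps)).
  { apply Rmin_pos; [lra|apply Rdiv_lt_0_compat; lra]. }
  intros e T [He0 He1] HT.
  assert (H1 := Rlt_le_trans _ _ _ He1 (Rmin_l _ _)).
  assert (H2 := Rlt_le_trans _ _ _ He1 (Rmin_r _ _)).
  replace (u e T - 0)%C with (u e T) by ring.
  eapply Rle_lt_trans; [apply Hu; lra|].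
  apply (Rmult_lt_compat_r (K + 1)) in H2; [|lra].
  replace (eps / (K + 1) * (K + 1)) with eps in H2 by (field; lra). nra.
Qed.

Lemma tends_I1 (w : C) : 0 < Re w ->
  tends ends (fun p => I1 w (fst p) (snd p) + (ln (fst p) + gamma_e)%R)%C (- Clog w)%C.
Proof.
  intros Hw.
  apply (tends_ext ends (fun p => (I1 w (fst p) (snd p) - I1 1 (fst p) (snd p)) + ((I1 1 (fst p) (snd p) + ln (fst p)) + gamma_e))%C).
  - apply filter_forall. intros p. rewrite RtoC_plus. ring.
  - replace (- Clog w)%C with (- Clog w + (- gamma_e + gamma_e))%C by ring.
    apply (tends_plus ends); [now apply I1_log|]. apply (tends_plus ends); [apply kappa_limit|apply (tends_const ends)].
Qed.

Lemma tends_exp_T_div (w : C) (k : R -> C) : 0 < Re w -> (forall T, 1 < T -> Cmod (k T) <= 1) ->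
  tends ends (fun p => Cexp (- (w * snd p)) * k (snd p))%C 0%C.
Proof.
  intros Hw Hk eps He.
  assert (A := tends_exp_T w Hw eps He).
  assert (B := ends_intro 1 1 (fun e T => 1 < T) Rlt_0_1 (fun e T _ h => h)).
  generalize (filter_and _ _ A B). apply filter_imp. intros [e T]. cbn [fst snd]. intros [A1 B1].
  replace (Cexp (- (w * T)) - 0)%C with (Cexp (- (w * T))) in A1 by ring.
  replace (Cexp (- (w * T)) * k T - 0)%C with (Cexp (- (w * T)) * k T)%C by ring.
  rewrite Cmod_mult. specialize (Hk T B1). assert (P := Cmod_ge_0 (Cexp (- (w * T)))). nra.
Qed.

Lemma Cmod_inv_R (t : R) : 0 < t -> Cmod (/ RtoC t) = / t.
Proof. intros Ht. rewrite Cmod_inv by (apply RtoC_neq_0; lra). rewrite Cmod_R, Rabs_pos_eq by lra. reflexivity. Qed.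

Lemma inv_le_1 (t : R) : 1 < t -> 0 < / t <= 1.
Proof. intros Ht. split; [apply Rinv_0_lt_compat; lra|]. rewrite <- Rinv_1. apply Rinv_le_contravar; lra. Qed.

Lemma tends_exp_e_1 (w : C) : tends ends (fun p => Cexp (- (w * fst p)) * / fst p - / fst p + w)%C 0%C.
Proof.
  apply (tends_0_linear (fun e _ => Cexp (- (w * e)) * / e - / e + w)%C (Cmod w ^ 2 * exp (Cmod w))).
  { apply Rmult_le_pos; [apply pow2_ge_0|apply Rlt_le, exp_pos]. }
  intros e _ He _. assert (N : RtoC e <> 0%C) by (apply RtoC_neq_0; lra).
  replace (Cexp (- (w * e)) * / e - / e + w)%C with ((Cexp (- (w * e)) - 1 - - (w * e)) * / e)%C by (field; exact N).
  rewrite Cmod_mult, Cmod_inv_R by lra.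
  assert (T := Cexp_taylor2 (- (w * e))). rewrite Cmod_opp, Cmod_mult, Cmod_R, Rabs_pos_eq in T by lra.
  assert (G := Cmod_ge_0 w).
  apply Rle_trans with ((Cmod w * e) ^ 2 * exp (Cmod w) * / e).
  - apply Rmult_le_compat_r; [apply Rlt_le, Rinv_0_lt_compat; lra|].
    eapply Rle_trans; [exact T|]. apply Rmult_le_compat_l; [apply pow2_ge_0|]. apply exp_le. nra.
  - right. field. lra.
Qed.

Lemma Cexp_taylor3 (h : C) : Cmod (Cexp h - 1 - h - h * h / 2) <= Cmod h ^ 3 * exp (Cmod h).
Proof.
  replace (Cexp h - 1 - h - h * h / 2)%C with (Cexp h - Csum (fun k => RtoC (/ INR (Factorial.fact k)) * h ^ k) 3)%C.
  - apply Cexp_taylor.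
  - simpl. rewrite Rinv_1. replace (1 + 1)%R with 2 by ring. rewrite RtoC_inv by lra. field.
Qed.

Lemma tends_exp_e_2 (w : C) :
  tends ends (fun p => Cexp (- (w * fst p)) * (/ fst p * / fst p) - / fst p * / fst p + w * / fst p - w * w / 2)%C 0%C.
Proof.
  apply (tends_0_linear (fun e _ => Cexp (- (w * e)) * (/ e * / e) - / e * / e + w * / e - w * w / 2)%C (Cmod w ^ 3 * exp (Cmod w))).
  { apply Rmult_le_pos; [apply pow_le, Cmod_ge_0|apply Rlt_le, exp_pos]. }
  intros e _ He _. assert (N : RtoC e <> 0%C) by (apply RtoC_neq_0; lra).
  set (h := (- (w * e))%C).
  replace (Cexp h * (/ e * / e) - / e * / e + w * / e - w * w / 2)%C with
    ((Cexp h - 1 - h - h * h / 2) * (/ e * / e))%C by (unfold h; field; exact N).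
  rewrite !Cmod_mult, !Cmod_inv_R by lra.
  assert (T := Cexp_taylor3 h). unfold h in T at 5 6. rewrite Cmod_opp, Cmod_mult, Cmod_R, Rabs_pos_eq in T by lra.
  assert (G := Cmod_ge_0 w).
  apply Rle_trans with ((Cmod w * e) ^ 3 * exp (Cmod w) * (/ e * / e)).
  - apply Rmult_le_compat_r; [apply Rlt_le, Rmult_lt_0_compat; apply Rinv_0_lt_compat; lra|].
    eapply Rle_trans; [exact T|]. apply Rmult_le_compat_l; [apply pow_le; nra|]. apply exp_le. nra.
  - right. field. lra.
Qed.

(** Integration by parts reduces all cases to [I1]. The end point terms at [T] vanish; those at [e]
    are expanded to second order, and for [j = 0] the expansion leaves w^2 + w^2 / 2, the origin of
    the [3 / 2] in [ppi]. *)
Lemma tends_Yint (j : nat) (w : C) : 0 < Re w ->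
  tends ends (fun p => Yint j w (fst p) (snd p) - ppi j (fst p) w)%C (psi j w).
Proof.
  intros Hw. assert (U := tends_I1 w Hw).
  assert (A1 := tends_exp_T_div w (fun T => / T)%C Hw
    (fun T hT => eq_ind_r (fun x => x <= 1) (proj2 (inv_le_1 T hT)) (Cmod_inv_R T (Rlt_trans _ _ _ Rlt_0_1 hT)))).
  assert (A2 : tends ends (fun p => Cexp (- (w * snd p)) * (/ snd p * / snd p))%C 0%C).
  { apply (tends_exp_T_div w (fun T => / T * / T)%C Hw). intros T hT.
    rewrite Cmod_mult, Cmod_inv_R by lra. assert (I := inv_le_1 T hT). nra. }
  assert (B1 := tends_exp_e_1 w). assert (B2 := tends_exp_e_2 w).
  assert (Hp := ends_pos).
  destruct j as [|[|j]].
  - apply (tends_ext ends (fun p => (w * w) * (I1 w (fst p) (snd p) + (ln (fst p) + gamma_e)%R)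
      + w * (Cexp (- (w * snd p)) * / snd p) - Cexp (- (w * snd p)) * (/ snd p * / snd p)
      - w * (Cexp (- (w * fst p)) * / fst p - / fst p + w)
      + (Cexp (- (w * fst p)) * (/ fst p * / fst p) - / fst p * / fst p + w * / fst p - w * w / 2))%C).
    + revert Hp. apply filter_imp. intros [e T]. cbn [fst snd]. intros He.
      rewrite Yint_0, I3_parts, I2_parts by exact He. unfold ppi. field. split; apply RtoC_neq_0; lra.
    + replace (psi 0 w) with ((w * w) * (- Clog w) + w * 0 - 0 - w * 0 + 0)%C by (unfold psi; ring).
      repeat first [assumption | apply (tends_minus ends) | apply (tends_plus ends) | apply (tends_scal ends)].
  - apply (tends_ext ends (fun p => (2 * w) * (I1 w (fst p) (snd p) + (ln (fst p) + gamma_e)%R)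
      + 2 * (Cexp (- (w * snd p)) * / snd p)
      - 2 * (Cexp (- (w * fst p)) * / fst p - / fst p + w) - w)%C).
    + revert Hp. apply filter_imp. intros [e T]. cbn [fst snd]. intros He.
      rewrite Yint_1, I2_parts by exact He. unfold ppi. field. split; apply RtoC_neq_0; lra.
    + replace (psi 1 w) with ((2 * w) * (- Clog w) + 2 * 0 - 2 * 0 - w)%C by (unfold psi; ring).
      repeat first [assumption | apply (tends_minus ends) | apply (tends_plus ends) | apply (tends_scal ends) | apply (tends_const ends)].
  - apply (tends_ext ends (fun p => 2 * (I1 w (fst p) (snd p) + (ln (fst p) + gamma_e)%R) - 3)%C).
    + revert Hp. apply filter_imp. intros [e T]. cbn [fst snd]. intros He.
      change (Yint (S (S j)) w e T) with (Yint 2 w e T). rewrite Yint_2 by exact He.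
      unfold ppi. ring.
    + replace (psi (S (S j)) w) with (2 * (- Clog w) - 3)%C by (unfold psi; ring).
      apply (tends_minus ends); [now apply (tends_scal ends)|apply (tends_const ends)].
Qed.

(** * The derivative at 0 *)

Lemma dPsum_minus (c : C) (M L N : nat) (f g : nat -> C -> C) :
  dPsum c M L N (fun j w => f j w - g j w)%C = (dPsum c M L N f - dPsum c M L N g)%C.
Proof.
  assert (S1 : forall v, Csum (fun j => bcoef c j * (f j v - g j v))%C M =
    (Csum (fun j => bcoef c j * f j v) M - Csum (fun j => bcoef c j * g j v) M)%C).
  { intros v. rewrite <- Csum_minus. apply Csum_ext. intros; ring. }
  unfold dPsum. rewrite S1. unfold rect.
  rewrite (Csum_ext _ (fun l =>
    Csum (fun n => f 2%nat (pt c l n) - DD c (fun v => Csum (fun j => bcoef c j * f j v) M) (pt c l n)) N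
    - Csum (fun n => g 2%nat (pt c l n) - DD c (fun v => Csum (fun j => bcoef c j * g j v) M) (pt c l n)) N)%C L).
  - rewrite Csum_minus. ring.
  - intros l _. rewrite <- Csum_minus. apply Csum_ext. intros n _. unfold DD. rewrite !S1. ring.
Qed.

Lemma Re_pt_pos (c : C) (l n : nat) : 0 < Re c -> 0 < Re (pt c l n).
Proof. intros Hc. eapply Rlt_le_trans; [|apply Re_pt_ge; lra]. apply lt_0_INR. lia. Qed.

Lemma tends_dPsum {T : Type} (F : (T -> Prop) -> Prop) {FF : Filter F} (c : C) (L N : nat)
  (u : nat -> C -> T -> C) (l : nat -> C -> C) : 0 < Re c ->
  (forall j w, 0 < Re w -> tends F (u j w) (l j w)) ->
  tends F (fun p => dPsum c 3 L N (fun j w => u j w p)) (dPsum c 3 L N l).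
Proof.
  intros Hc H.
  assert (B : forall v, 0 < Re v -> tends F (fun p => Csum (fun j => bcoef c j * u j v p)%C 3) (Csum (fun j => bcoef c j * l j v)%C 3)).
  { intros v Hv. apply (tends_Csum F (fun j p => bcoef c j * u j v p)%C). intros k _. apply (tends_scal F). now apply H. }
  unfold dPsum. apply (tends_plus F).
  - apply B. rewrite re_plus. simpl. lra.
  - unfold rect. apply (tends_Csum F (fun i p => Csum (fun n => u 2%nat (pt c i n) p - DD c (fun v => Csum (fun j => bcoef c j * u j v p) 3) (pt c i n)) N)%C).
    intros i _.
    apply (tends_Csum F (fun n p => u 2%nat (pt c i n) p - DD c (fun v => Csum (fun j => bcoef c j * u j v p) 3) (pt c i n))%C).
    intros n _. assert (Hp := Re_pt_pos c i n Hc). revert Hp. generalize (pt c i n). intros w Hw.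
    apply (tends_minus F); [now apply H|]. unfold DD.
    apply (tends_plus F); [|now apply B].
    apply (tends_minus F); [apply (tends_minus F)|]; apply B; rewrite !re_plus; simpl; lra.
Qed.

Lemma CInt_dPsum (c : C) (L N : nat) (G : nat -> C -> R -> C) (e T : R) : e <= T ->
  (forall j w, Ccont_on (G j w) e T) ->
  Ccont_on (fun t => dPsum c 3 L N (fun j w => G j w t)) e T /\
  dPsum c 3 L N (fun j w => CInt (G j w) e T) = CInt (fun t => dPsum c 3 L N (fun j w => G j w t)) e T.
Proof.
  intros HT HG.
  assert (C1 : forall v, Ccont_on (fun t => Csum (fun j => bcoef c j * G j v t) 3)%C e T).
  { intros v. apply (cont_on_Csum (fun j t => bcoef c j * G j v t)%C). intros k _.
    apply cont_on_mult; [apply cont_on_const|apply HG]. }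
  assert (E1 : forall v, Csum (fun j => bcoef c j * CInt (G j v) e T)%C 3 = CInt (fun t => Csum (fun j => bcoef c j * G j v t) 3)%C e T).
  { intros v. rewrite (CInt_Csum (fun j t => bcoef c j * G j v t)%C); [|exact HT|].
    - apply Csum_ext. intros k _. now rewrite CInt_scal.
    - intros k _. apply cont_on_mult; [apply cont_on_const|apply HG]. }
  assert (C2 : forall w, Ccont_on (fun t => DD c (fun v => Csum (fun j => bcoef c j * G j v t) 3) w)%C e T).
  { intros w. unfold DD. apply cont_on_plus; [apply cont_on_minus; [apply cont_on_minus|]|]; apply C1. }
  assert (E2 : forall w, DD c (fun v => Csum (fun j => bcoef c j * CInt (G j v) e T) 3)%C w =
     CInt (fun t => DD c (fun v => Csum (fun j => bcoef c j * G j v t) 3)%C w) e T).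
  { intros w. unfold DD. rewrite !E1.
    rewrite CInt_plus; [|exact HT|apply cont_on_minus; [apply cont_on_minus|]; apply C1|apply C1].
    rewrite CInt_minus; [|exact HT|apply cont_on_minus; apply C1|apply C1].
    rewrite CInt_minus; [|exact HT|apply C1|apply C1]. reflexivity. }
  set (D := fun l n t => (G 2%nat (pt c l n) t - DD c (fun v => Csum (fun j => bcoef c j * G j v t) 3) (pt c l n))%C).
  assert (C3 : forall l n, Ccont_on (D l n) e T).
  { intros l n. apply cont_on_minus; [apply HG|apply C2]. }
  assert (C4 : forall l, Ccont_on (fun t => Csum (fun n => D l n t) N) e T).
  { intros l. apply (cont_on_Csum (D l)). auto. }
  assert (C5 : Ccont_on (fun t => rect (fun l n => D l n t) L N) e T).
  { apply (cont_on_Csum (fun l t => Csum (fun n => D l n t) N)). auto. }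
  split.
  - exact (cont_on_plus _ _ e T (C1 (c + 1)%C) C5).
  - etransitivity; [|symmetry; exact (CInt_plus _ _ e T HT (C1 (c + 1)%C) C5)].
    unfold dPsum. rewrite E1.
    f_equal. unfold rect.
    rewrite (CInt_Csum (fun l t => Csum (fun n => D l n t) N) e T L HT (fun k _ => C4 k)).
    apply Csum_ext. intros l _. rewrite (CInt_Csum (D l) e T N HT (fun k _ => C3 l k)).
    apply Csum_ext. intros n _. rewrite E2. unfold D.
    rewrite CInt_minus; [reflexivity|exact HT|apply HG|apply C2].
Qed.

(** [ppi j e] is a quadratic polynomial in [w] together with its derivatives. On these the expansion
    of [DD] is exact, so every lattice term vanishes and the divergent parts survive only at
    [c + 1]. *)
Lemma dPsum_ppi (c : C) (L N : nat) (e : R) : 0 < Re c ->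
  dPsum c 3 L N (fun j w => ppi j e w) = Csum (fun j => bcoef c j * ppi j e (c + 1))%C 3.
Proof.
  intros Hc. unfold dPsum, rect.
  rewrite (Csum_ext _ (fun _ => RtoC 0) L); [rewrite Csum_0; ring|].
  intros l _. rewrite (Csum_ext _ (fun _ => RtoC 0)); [apply Csum_0|].
  intros n _. unfold DD, ppi. cbn [Csum]. rewrite bcoef_0, (bcoef_1 c Hc). unfold bm2.
  generalize (pt c l n) (/ RtoC e)%C. intros w i. field. now apply neq_0_Re.
Qed.

(** * The regularized kernel and its bounds for both signs of the argument *)

(* [kernel_reg c t] is [/ t * Dk c t]; the values at negative [s] describe the remainder terms [rterm]. *)
Definition Dk (c : C) (s : R) : C :=
  (/ (Cexp (c * s) - 1) * / (Cexp s - 1) - bm2 c / s ^ 2 - bm1 c / s - b0 c)%C.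

Lemma exp_m1_lower (x : R) : Rabs x * exp (- Rabs x) <= Rabs (exp x - 1).
Proof.
  destruct (Rle_lt_dec 0 x) as [H|H].
  - rewrite !(Rabs_pos_eq x) by exact H. assert (E := exp_ineq1_le x).
    rewrite Rabs_pos_eq by lra. assert (P := exp_pos (- x)).
    assert (Q : exp (- x) <= 1) by (rewrite <- exp_0; apply exp_le; lra). nra.
  - rewrite !(Rabs_left x) by exact H. rewrite Ropp_involutive.
    assert (E := exp_ineq1_le (- x)). assert (P := exp_pos x).
    assert (Q : exp x * exp (- x) = 1) by (rewrite <- exp_plus, Rplus_opp_r; apply exp_0).
    assert (Q' : exp x <= 1) by (rewrite <- exp_0; apply exp_le; lra).
    rewrite Rabs_left1 by lra. nra.
Qed.

(** The distance from 1 is at least the difference of the moduli, which keeps [Cexp (c * t)] away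
    from 1 whatever its phase is. *)
Lemma Cexp_m1_lower (z : C) : Rabs (exp (Re z) - 1) <= Cmod (Cexp z - 1).
Proof.
  rewrite <- Cmod_Cexp. apply Rabs_le.
  assert (A := Cmod_le_add (Cexp z) 1). assert (B := Cmod_le_add 1 (Cexp z)).
  rewrite (Cmod_minus_sym 1) in B. rewrite Cmod_1 in A, B. lra.
Qed.

Lemma Cexp_taylor4 (h : C) : Cmod (Cexp h - 1 - h * (1 + h / 2 + h * h / 6)) <= Cmod h ^ 4 * exp (Cmod h).
Proof.
  replace (Cexp h - 1 - h * (1 + h / 2 + h * h / 6))%C with (Cexp h - Csum (fun k => RtoC (/ INR (Factorial.fact k)) * h ^ k) 4)%C.
  - apply Cexp_taylor.
  - simpl. rewrite Rinv_1. replace (1 + 1)%R with 2 by ring. replace (2 + 1 + 1 + 1 + 1)%R with 6 by ring.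
    rewrite !RtoC_inv by lra. field.
Qed.

(** With [X], [Y] the denominators, [P], [Q] their cubic Taylor polynomials and [Z] the subtracted
    part, [Dk] is (1 - P Q Z - (X Y - P Q) Z) / (X Y). The constants in [Z] are those for which 1 -
    P Q Z is O(s^3); the other part of the numerator is of the same order, and the denominator is at
    least [lo * s ^ 2]. *)
Lemma Dk_bound_near_0 (c : C) : 0 < Re c -> exists K, forall s, s <> 0 -> Rabs s <= 1 -> Cmod (Dk c s) <= K * Rabs s.
Proof.
  intros Hc. assert (Nc : c <> 0%C) by now apply neq_0_Re.
  set (a := Re c) in *.
  (* P Q = c s^2 (1 + u1 s + u2 s^2 + u3 s^3 + u4 s^4) and Z = (1 + al s + be s^2) / (c s^2). In 1 -
     P Q Z the coefficients of s and s^2 cancel, and [r0] to [r3] are those of s^3 to s^6. *)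
  pose (u1 := ((c + 1) / 2)%C). pose (u2 := (c * c / 6 + c / 4 + 1 / 6)%C).
  pose (u3 := ((c * c + c) / 12)%C). pose (u4 := (c * c / 36)%C).
  pose (al := (- (c + 1) / 2)%C). pose (be := (c * c / 12 + c / 4 + 1 / 12)%C).
  pose (r0 := (- (u3 + u2 * al + u1 * be))%C). pose (r1 := (- (u4 + u3 * al + u2 * be))%C).
  pose (r2 := (- (u4 * al + u3 * be))%C). pose (r3 := (- (u4 * be))%C).
  pose (CR := Cmod r0 + Cmod r1 + Cmod r2 + Cmod r3).
  pose (CP := Cmod c * (1 + Cmod c / 2 + Cmod c * Cmod c / 6)).
  pose (CZ := Cmod (bm2 c) + Cmod (bm1 c) + Cmod (b0 c)).
  pose (CX := Cmod c ^ 4 * exp (Cmod c)).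
  pose (lo := a * exp (- a) * exp (- (1))).
  assert (Hlo : 0 < lo) by (unfold lo; repeat apply Rmult_lt_0_compat; try apply exp_pos; exact Hc).
  assert (Gc := Cmod_ge_0 c). assert (E1 := exp_pos 1).
  assert (HCP : 0 <= CP) by (unfold CP; apply Rmult_le_pos; [lra|nra]).
  assert (HCZ : 0 <= CZ).
  { unfold CZ. generalize (Cmod_ge_0 (bm2 c)) (Cmod_ge_0 (bm1 c)) (Cmod_ge_0 (b0 c)). lra. }
  assert (HCX : 0 <= CX) by (unfold CX; apply Rmult_le_pos; [now apply pow_le|apply Rlt_le, exp_pos]).
  exists ((CR + (CX * exp 1 + CP * exp 1) * CZ) / lo).
  intros s Hs Hs1. set (x := Rabs s) in *.
  assert (Hx : 0 < x) by (now apply Rabs_pos_lt).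
  assert (Ns : RtoC s <> 0%C) by now apply RtoC_neq_0.
  set (X := (Cexp (c * s) - 1)%C). set (Y := (Cexp s - 1)%C).
  set (P := (c * s * (1 + c * s / 2 + c * s * (c * s) / 6))%C).
  set (Q := (s * (1 + s / 2 + s * s / 6))%C).
  set (Z := (bm2 c / s ^ 2 + bm1 c / s + b0 c)%C).
  assert (Bs : Cmod s = x) by apply Cmod_R.
  assert (Bcs : Cmod (c * s) = Cmod c * x) by (rewrite Cmod_mult, Bs; reflexivity).
  assert (LX : a * exp (- a) * x <= Cmod X).
  { eapply Rle_trans; [|apply Cexp_m1_lower]. rewrite re_scal_r. fold a.
    eapply Rle_trans; [|apply exp_m1_lower]. rewrite Rabs_mult, (Rabs_pos_eq a) by lra. fold x.
    replace (a * exp (- a) * x) with (a * x * exp (- a)) by ring.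
    apply Rmult_le_compat_l; [nra|]. apply exp_le. nra. }
  assert (LY : exp (- (1)) * x <= Cmod Y).
  { eapply Rle_trans; [|apply Cexp_m1_lower]. rewrite re_RtoC.
    eapply Rle_trans; [|apply exp_m1_lower]. fold x. rewrite Rmult_comm.
    apply Rmult_le_compat_l; [lra|]. apply exp_le. lra. }
  assert (PX : 0 < a * exp (- a) * x) by (repeat apply Rmult_lt_0_compat; try apply exp_pos; lra).
  assert (PY : 0 < exp (- (1)) * x) by (apply Rmult_lt_0_compat; [apply exp_pos|lra]).
  assert (NX : X <> 0%C) by (apply Cmod_gt_0; lra).
  assert (NY : Y <> 0%C) by (apply Cmod_gt_0; lra).
  assert (LXY : lo * (x * x) <= Cmod (X * Y)).
  { rewrite Cmod_mult. replace (lo * (x * x)) with ((a * exp (- a) * x) * (exp (- (1)) * x)) by (unfold lo; ring).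
    apply Rmult_le_compat; lra. }
  assert (UY : Cmod Y <= x * exp 1).
  { eapply Rle_trans; [apply Cexp_taylor1|]. rewrite Bs. apply Rmult_le_compat_l; [lra|apply exp_le; lra]. }
  assert (DX : Cmod (X - P) <= CX * x ^ 4).
  { unfold X, P. eapply Rle_trans; [apply Cexp_taylor4|]. rewrite Bcs. unfold CX.
    rewrite Rpow_mult_distr. replace (Cmod c ^ 4 * exp (Cmod c) * x ^ 4) with (Cmod c ^ 4 * x ^ 4 * exp (Cmod c)) by ring.
    apply Rmult_le_compat_l; [apply Rmult_le_pos; apply pow_le; lra|]. apply exp_le. nra. }
  assert (DY : Cmod (Y - Q) <= exp 1 * x ^ 4).
  { unfold Y, Q. eapply Rle_trans; [apply Cexp_taylor4|]. rewrite Bs, Rmult_comm.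
    apply Rmult_le_compat_r; [apply pow_le; lra|apply exp_le; lra]. }
  assert (UP : Cmod P <= CP * x).
  { unfold P. rewrite Cmod_mult, Bcs. unfold CP.
    replace (Cmod c * (1 + Cmod c / 2 + Cmod c * Cmod c / 6) * x) with (Cmod c * x * (1 + Cmod c / 2 + Cmod c * Cmod c / 6)) by ring.
    apply Rmult_le_compat_l; [nra|].
    eapply Rle_trans; [apply Cmod_triangle|]. eapply Rle_trans; [apply Rplus_le_compat_r, Cmod_triangle|].
    rewrite Cmod_1, Cmod_half. unfold Cdiv. rewrite !Cmod_mult, Cmod_inv_R, Bs by lra.
    assert (M1 : Cmod c * x <= Cmod c) by nra. assert (M2 : 0 <= Cmod c * x) by nra.
    assert (M3 : Cmod c * x * (Cmod c * x) <= Cmod c * Cmod c) by nra. lra. }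
  assert (UZ : Cmod Z <= CZ * / (x * x)).
  { unfold Z, CZ, Cdiv.
    assert (I1' : / x <= / (x * x)) by (apply Rinv_le_contravar; nra).
    assert (I2' : 1 <= / (x * x)) by (rewrite <- Rinv_1; apply Rinv_le_contravar; nra).
    assert (H2 : Cmod (/ s ^ 2) = / (x * x)).
    { rewrite Cmod_inv by now apply Cpow_nz. rewrite Cmod_pow, Bs. f_equal. ring. }
    assert (H1 : Cmod (/ s) = / x) by (rewrite Cmod_inv, Bs by exact Ns; reflexivity).
    eapply Rle_trans; [apply Cmod_triangle|]. eapply Rle_trans; [apply Rplus_le_compat_r, Cmod_triangle|].
    rewrite !Cmod_mult, H1, H2.
    assert (G1 := Cmod_ge_0 (bm1 c)). assert (G0 := Cmod_ge_0 (b0 c)). nra. }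
  assert (Poly : (1 - P * Q * Z)%C = (s ^ 3 * (r0 + r1 * s + r2 * (s * s) + r3 * (s * s * s)))%C).
  { unfold P, Q, Z, r0, r1, r2, r3, u1, u2, u3, u4, al, be, bm2, bm1, b0. field. split; assumption. }
  assert (UPoly : Cmod (1 - P * Q * Z) <= CR * x ^ 3).
  { rewrite Poly, Cmod_mult, Cmod_pow, Bs, Rmult_comm. apply Rmult_le_compat_r; [apply pow_le; lra|].
    eapply Rle_trans; [apply Cmod_triangle|]. eapply Rle_trans; [apply Rplus_le_compat_r, Cmod_triangle|].
    eapply Rle_trans; [apply Rplus_le_compat_r, Rplus_le_compat_r, Cmod_triangle|].
    rewrite !Cmod_mult, Bs. unfold CR.
    assert (G1 := Cmod_ge_0 r1). assert (G2 := Cmod_ge_0 r2). assert (G3 := Cmod_ge_0 r3).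
    assert (x * x <= 1) by nra. assert (x * x * x <= 1) by nra. nra. }
  assert (E : Dk c s = ((1 - P * Q * Z - ((X - P) * Y + P * (Y - Q)) * Z) / (X * Y))%C).
  { unfold Dk. fold X Y. replace (/ X * / Y - bm2 c / s ^ 2 - bm1 c / s - b0 c)%C with (/ X * / Y - Z)%C by (unfold Z; ring).
    field. split; assumption. }
  rewrite E, Cmod_div by now apply Cmult_neq_0.
  assert (Num : Cmod (1 - P * Q * Z - ((X - P) * Y + P * (Y - Q)) * Z) <= (CR + (CX * exp 1 + CP * exp 1) * CZ) * x ^ 3).
  { eapply Rle_trans; [apply Cmod_minus_le|]. rewrite Rmult_plus_distr_r. apply Rplus_le_compat; [exact UPoly|].
    rewrite Cmod_mult.
    apply Rle_trans with ((CX * x ^ 4 * (x * exp 1) + CP * x * (exp 1 * x ^ 4)) * (CZ * / (x * x))).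
    - apply Rmult_le_compat; try apply Cmod_ge_0; [|exact UZ].
      eapply Rle_trans; [apply Cmod_triangle|]. rewrite !Cmod_mult.
      apply Rplus_le_compat; apply Rmult_le_compat; try apply Cmod_ge_0; assumption.
    - right. field. lra. }
  assert (Pos : 0 < lo * (x * x)) by (apply Rmult_lt_0_compat; [exact Hlo|nra]).
  apply Rle_trans with ((CR + (CX * exp 1 + CP * exp 1) * CZ) * x ^ 3 * / (lo * (x * x))).
  - apply Rmult_le_compat; [apply Cmod_ge_0|apply Rlt_le, Rinv_0_lt_compat; lra|exact Num|].
    apply Rinv_le_contravar; assumption.
  - right. field. lra.
Qed.

(** The error integral over all of (0, oo) needs [Dk c (- t) / t] bounded everywhere, not only near
    0. For [t > 1] both exponentials stay away from 1, so [Dk] is bounded and a linear bound holds a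
    fortiori. *)
Lemma Dk_bound_neg (c : C) : 0 < Re c -> exists K, 0 <= K /\ forall t, 0 < t -> Cmod (Dk c (- t)) <= K * t.
Proof.
  intros Hc. destruct (Dk_bound_near_0 c Hc) as [K HK].
  set (a := Re c) in *.
  pose (CZ := Cmod (bm2 c) + Cmod (bm1 c) + Cmod (b0 c)).
  assert (Pa := exp_opp_lt_1 a Hc). assert (P1 := exp_opp_lt_1 1 Rlt_0_1).
  pose (K2 := / (1 - exp (- a)) * / (1 - exp (- (1))) + CZ).
  exists (Rmax 0 (Rmax K K2)). split; [apply Rmax_l|].
  intros t Ht.
  destruct (Rle_lt_dec t 1) as [H1|H1].
  - eapply Rle_trans; [apply HK; [lra|rewrite Rabs_Ropp, Rabs_pos_eq; lra]|].
    rewrite Rabs_Ropp, Rabs_pos_eq by lra. apply Rmult_le_compat_r; [lra|].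
    eapply Rle_trans; [apply (Rmax_l K K2)|apply Rmax_r].
  - assert (LX : 1 - exp (- a) <= Cmod (Cexp (c * (- t)%R) - 1)).
    { eapply Rle_trans; [|apply Cexp_m1_lower]. rewrite re_scal_r. fold a.
      assert (E : exp (a * - t) <= exp (- a)) by (apply exp_le; nra).
      rewrite Rabs_left1 by lra. lra. }
    assert (LY : 1 - exp (- (1)) <= Cmod (Cexp (- t)%R - 1)).
    { eapply Rle_trans; [|apply Cexp_m1_lower]. rewrite re_RtoC.
      assert (E : exp (- t) <= exp (- (1))) by (apply exp_le; lra).
      rewrite Rabs_left1 by lra. lra. }
    assert (NX : (Cexp (c * (- t)%R) - 1)%C <> 0%C) by (apply Cmod_gt_0; lra).
    assert (NY : (Cexp (- t)%R - 1)%C <> 0%C) by (apply Cmod_gt_0; lra).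
    assert (Ns : RtoC (- t) <> 0%C) by (apply RtoC_neq_0; lra).
    assert (B : Cmod (Dk c (- t)) <= K2).
    { unfold Dk.
      eapply Rle_trans; [apply Cmod_minus_le|].
      eapply Rle_trans; [apply Rplus_le_compat_r, Cmod_minus_le|].
      eapply Rle_trans; [apply Rplus_le_compat_r, Rplus_le_compat_r, Cmod_minus_le|].
      assert (H2 : Cmod (/ (- t)%R ^ 2) = / t ^ 2).
      { rewrite Cmod_inv by now apply Cpow_nz. rewrite Cmod_pow, Cmod_R, Rabs_Ropp, Rabs_pos_eq by lra. reflexivity. }
      assert (H3 : Cmod (/ (- t)%R) = / t).
      { rewrite Cmod_inv, Cmod_R, Rabs_Ropp, Rabs_pos_eq by (lra || exact Ns). reflexivity. }
      unfold Cdiv. rewrite !Cmod_mult, H2, H3, (Cmod_inv _ NX), (Cmod_inv _ NY).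
      unfold K2, CZ.
      assert (A1 : / Cmod (Cexp (c * (- t)%R) - 1) * / Cmod (Cexp (- t)%R - 1) <= / (1 - exp (- a)) * / (1 - exp (- (1)))).
      { apply Rmult_le_compat; try (apply Rlt_le, Rinv_0_lt_compat; lra); apply Rinv_le_contravar; lra. }
      assert (I1' := inv_le_1 t H1). assert (I2' : / t ^ 2 <= 1).
      { rewrite <- Rinv_1. apply Rinv_le_contravar; nra. }
      assert (G1 := Cmod_ge_0 (bm1 c)). assert (G2 := Cmod_ge_0 (bm2 c)). nra. }
    apply Rle_trans with (Rmax 0 (Rmax K K2) * 1).
    + rewrite Rmult_1_r. eapply Rle_trans; [exact B|]. eapply Rle_trans; [apply (Rmax_r K K2)|apply Rmax_r].
    + apply Rmult_le_compat_l; [apply Rmax_l|lra].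
Qed.

Lemma Cexp_m1_neq_0 (c : C) (t : R) : 0 < Re c -> t <> 0 -> (Cexp (c * t) - 1)%C <> 0%C.
Proof.
  intros Hc Ht. apply Cmod_gt_0. eapply Rlt_le_trans; [|apply Cexp_m1_lower].
  eapply Rlt_le_trans; [|apply exp_m1_lower]. rewrite re_scal_r.
  apply Rmult_lt_0_compat; [|apply exp_pos]. apply Rabs_pos_lt.
  apply Rmult_integral_contrapositive. split; lra.
Qed.

(* The double geometric series is summed by telescoping. *)
Lemma dPsum_exp (c : C) (L N : nat) (t : R) : 0 < Re c -> 0 < t ->
  dPsum c 3 L N (fun j w => Cexp (- (w * t)) * kap j t)%C =
  (2 * kernel c t + 2 * / t * Dk c (- t) * bdry c (fun w => Cexp (- (w * t))) (L, N))%C.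
Proof.
  intros Hc Ht. assert (Nt : RtoC t <> 0%C) by (apply RtoC_neq_0; lra).
  assert (R1 : 0 < Re 1) by (simpl; lra).
  set (A := fun w => Cexp (- (w * t))). set (X := (Cexp (- (c * t)) - 1)%C). set (Y := (Cexp (- t) - 1)%C).
  assert (NX : X <> 0%C).
  { unfold X. replace (- (c * t))%C with (c * (- t)%R)%C by (rewrite RtoC_opp; ring). apply Cexp_m1_neq_0; lra. }
  assert (NY : Y <> 0%C).
  { unfold Y. replace (- RtoC t)%C with (1 * (- t)%R)%C by (rewrite RtoC_opp; ring). apply Cexp_m1_neq_0; [exact R1|lra]. }
  assert (DDA : forall w, DD c A w = (X * Y * A w)%C).
  { intros w. unfold DD, A, X, Y.
    replace (- ((w + (c + 1)) * t))%C with (- (w * t) + (- (c * t) + - t))%C by ring.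
    replace (- ((w + c) * t))%C with (- (w * t) + - (c * t))%C by ring.
    replace (- ((w + 1) * t))%C with (- (w * t) + - t)%C by ring.
    rewrite !Cexp_add. ring. }
  (* On e^(-w t) the differentiation D acts as - t: [X * Y] is the multiplier of [DD], and [S] is 2
     / t^3 times the truncated series of its reciprocal, with D^2 cleared. Their mismatch is what
     [Dk c (- t)] measures. *)
  pose (S := Csum (fun j => bcoef c j * kap j t)%C 3).
  assert (ES : S = (2 * / t * (bm2 c / t ^ 2 - bm1 c / t + b0 c))%C).
  { unfold S. cbn [Csum]. rewrite bcoef_0, (bcoef_1 c Hc), (bcoef_2 c Hc). unfold kap.
    unfold bm1, bm2. field. split; [now apply neq_0_Re|exact Nt]. }
  assert (ED : Dk c (- t) = (/ X * / Y - (bm2 c / t ^ 2 - bm1 c / t + b0 c))%C).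
  { unfold Dk, X, Y. replace (- (c * t))%C with (c * (- t)%R)%C by (rewrite RtoC_opp; ring).
    rewrite RtoC_opp. 
    replace (bm2 c / (- t) ^ 2)%C with (bm2 c / t ^ 2)%C by (field; exact Nt).
    replace (bm1 c / (- t))%C with (- (bm1 c / t))%C by (field; exact Nt). ring. }
  assert (SA : forall v, Csum (fun j => bcoef c j * (A v * kap j t))%C 3 = (S * A v)%C).
  { intros v. unfold S. rewrite Cmult_comm, <- Csum_scal. apply Csum_ext. intros; ring. }
  assert (ERect : (X * Y * rect (fun l n => A (pt c l n)) L N)%C = (bdry c A (L, N) + A (c + 1))%C).
  { transitivity (rect (fun l n => DD c A (pt c l n)) L N).
    - unfold rect. rewrite <- Csum_scal. apply Csum_ext. intros l _. rewrite <- Csum_scal.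
      apply Csum_ext. intros n _. now rewrite DDA.
    - rewrite rect_DD. reflexivity. }
  assert (EAW : A (c + 1)%C = (X * Y * (/ (Cexp (c * t) - 1) * / (Cexp t - 1)))%C).
  { unfold A, X, Y.
    replace (- ((c + 1) * t))%C with (- (c * t) + - t)%C by ring.
    rewrite Cexp_add, !Cexp_opp.
    assert (N1 := Cexp_m1_neq_0 c t Hc ltac:(lra)). assert (N2 := Cexp_m1_neq_0 1 t R1 ltac:(lra)).
    rewrite Cmult_1_l in N2.
    field. repeat split; auto using Cexp_neq_0. }
  assert (EK : kernel c t = (/ t * (/ (X * Y) * A (c + 1)))%C).
  { rewrite EAW. unfold kernel. 
    assert (N1 := Cexp_m1_neq_0 c t Hc ltac:(lra)). assert (N2 := Cexp_m1_neq_0 1 t R1 ltac:(lra)).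
    rewrite Cmult_1_l in N2. field. repeat split; auto. }
  transitivity (dPsum c 3 L N (fun j w => A w * kap j t)%C); [reflexivity|].
  unfold dPsum. rewrite SA.
  assert (ER : rect (fun l n => A (pt c l n) * kap 2 t - DD c (fun v => Csum (fun j => bcoef c j * (A v * kap j t)) 3) (pt c l n))%C L N =
    ((kap 2 t - X * Y * S) * rect (fun l n => A (pt c l n)) L N)%C).
  { unfold rect. rewrite <- Csum_scal. apply Csum_ext. intros l _. rewrite <- Csum_scal. apply Csum_ext. intros n _.
    assert (EDD : DD c (fun v => Csum (fun j => bcoef c j * (A v * kap j t)) 3)%C (pt c l n) = (S * DD c A (pt c l n))%C).
    { unfold DD. rewrite !SA. ring. }
    rewrite EDD, DDA. ring. }
  transitivity (S * A (c + 1) + (kap 2 t - X * Y * S) * rect (fun l n => A (pt c l n)) L N)%C; [f_equal; exact ER|].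
  replace (rect (fun l n => A (pt c l n)) L N) with (/ (X * Y) * (bdry c A (L, N) + A (c + 1)))%C
    by (rewrite <- ERect; field; auto).
  rewrite EK, ED, ES. unfold kap. field. auto.
Qed.

(** Each of the three corners has at least one index above [n], hence real part at least
    [mu * INR (S n)]. *)
Lemma bdry_exp_bound (c : C) (n : nat) (t : R) : 0 < Re c -> 0 <= t ->
  Cmod (bdry c (fun w => Cexp (- (w * t))) (S n, S n)) <= 3 * exp (- (Rmin 1 (Re c) * INR (S n)) * t).
Proof.
  intros Hc Ht. set (mu := Rmin 1 (Re c)).
  assert (M1 : mu <= 1) by apply Rmin_l. assert (M2 : mu <= Re c) by apply Rmin_r.
  assert (M0 : 0 < mu) by (apply Rmin_pos; lra). assert (Hn := INR_S_ge n).
  assert (B : forall l k, (n < l)%nat \/ (n < k)%nat -> Cmod (Cexp (- (pt c l k * t))) <= exp (- (mu * INR (S n)) * t)).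
  { intros l k Hlk. rewrite Cmod_exp_arg. apply exp_le. apply Rmult_le_compat_r; [exact Ht|].
    apply Ropp_le_contravar. rewrite Re_pt.
    assert (Hl := INR_S_ge l). assert (Hk := INR_S_ge k).
    destruct Hlk as [H|H].
    - assert (INR (S n) <= INR (S l)) by (apply le_INR; lia). nra.
    - assert (INR (S n) <= INR (S k)) by (apply le_INR; lia). nra. }
  unfold bdry. cbn [fst snd].
  eapply Rle_trans; [apply Cmod_minus_le|]. eapply Rle_trans; [apply Rplus_le_compat_r, Cmod_minus_le|].
  assert (B1 := B (S n) (S n) ltac:(lia)). assert (B2 := B (S n) 0%nat ltac:(lia)). assert (B3 := B 0%nat (S n) ltac:(lia)).
  lra.
Qed.

Lemma kernel_cont (c : C) (t : R) : 0 < Re c -> 0 < t -> Ccont (kernel c) t.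
Proof.
  intros Hc Ht. unfold kernel.
  assert (R1 : 0 < Re 1) by (simpl; lra).
  assert (N1 := Cexp_m1_neq_0 c t Hc ltac:(lra)). assert (N2 := Cexp_m1_neq_0 1 t R1 ltac:(lra)).
  rewrite Cmult_1_l in N2.
  assert (E : forall d s, Ccont (fun t : R => Cexp (d * t) - 1)%C s).
  { intros d s. apply cont_minus; [|apply cont_const]. eapply Rder_cont.
    apply (Rder_Cexp (fun t => d * t)%C). apply Rder_mult; [apply Rder_const|apply Rder_id]. }
  apply cont_mult; [apply cont_mult|].
  - apply (cont_inv_id t t Ht). lra.
  - apply (cont_inv (fun t : R => Cexp (c * t) - 1)%C); [apply E|exact N1].
  - apply (cont_inv (fun t : R => Cexp t - 1)%C); [|exact N2].
    apply cont_minus; [|apply cont_const]. eapply Rder_cont. apply (Rder_Cexp (fun t => RtoC t)). apply Rder_id.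
Qed.

Lemma kernel_reg_eq (c : C) (t : R) : kernel_reg c t = (/ t * Dk c t)%C.
Proof. reflexivity. Qed.

Lemma kernel_reg_split (c : C) (t : R) : 0 < t ->
  kernel_reg c t = (kernel c t - bm2 c * (/ t * / t * / t) - bm1 c * (/ t * / t) - b0 c * / t)%C.
Proof.
  intros Ht. assert (Nt : RtoC t <> 0%C) by (apply RtoC_neq_0; lra).
  unfold kernel_reg, kernel. set (X := (/ (Cexp (c * t) - 1))%C). set (Y := (/ (Cexp t - 1))%C).
  field. exact Nt.
Qed.

Lemma kernel_bound (c : C) (t : R) : 0 < Re c -> 1 <= t -> Cmod (kernel c t) <= 2 / Re c * exp (- (1) * t).
Proof.
  intros Hc Ht. set (a := Re c) in *.
  assert (R1 : 0 < Re 1) by (simpl; lra).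
  assert (N1 := Cexp_m1_neq_0 c t Hc ltac:(lra)). assert (N2 := Cexp_m1_neq_0 1 t R1 ltac:(lra)).
  rewrite Cmult_1_l in N2.
  assert (LX : a <= Cmod (Cexp (c * t) - 1)).
  { eapply Rle_trans; [|apply Cexp_m1_lower]. rewrite re_scal_r. fold a. eapply Rle_trans; [|apply Rle_abs].
    assert (E := exp_ineq1_le (a * t)). nra. }
  assert (LY : exp t / 2 <= Cmod (Cexp t - 1)).
  { eapply Rle_trans; [|apply Cexp_m1_lower]. rewrite re_RtoC. eapply Rle_trans; [|apply Rle_abs].
    assert (E := exp_ineq1_le t). lra. }
  assert (Et := exp_pos t).
  unfold kernel. rewrite !Cmod_mult, Cmod_inv_R, !Cmod_inv by (auto; lra).
  replace (2 / a * exp (- (1) * t)) with (1 * / a * / (exp t / 2)).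
  - apply Rmult_le_compat; try (apply Rlt_le, Rinv_0_lt_compat; lra).
    + apply Rmult_le_pos; apply Rlt_le, Rinv_0_lt_compat; lra.
    + apply Rmult_le_compat; try (apply Rlt_le, Rinv_0_lt_compat; lra).
      * rewrite <- Rinv_1. apply Rinv_le_contravar; lra.
      * apply Rinv_le_contravar; lra.
    + apply Rinv_le_contravar; lra.
  - replace (- (1) * t) with (- t) by ring. rewrite exp_Ropp. field. split; lra.
Qed.

(** The integral over [e, 1] of the part b_(-2) / t^3 + b_(-1) / t^2 + b_0 / t subtracted from the
    kernel. *)
Definition expl (c : C) (e : R) : C :=
  (bm2 c * (/ e * / e / 2 - 1 / 2) + bm1 c * (/ e - 1) - b0 c * ln e)%C.

Lemma kernel_int_split (c : C) (e T : R) : 0 < Re c -> 0 < e < 1 -> 1 < T ->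
  CInt (kernel c) e T = (CInt (kernel c) 1 T + CInt (kernel_reg c) e 1 + expl c e)%C.
Proof.
  intros Hc He HT.
  assert (CK : forall a b, 0 < a -> Ccont_on (kernel c) a b) by (intros a b Ha t Ht; apply kernel_cont; lra).
  rewrite <- (CInt_Chasles (kernel c) e 1 T) by (lra || apply CK; lra).
  assert (K1 := cont_inv_id e 1 (proj1 He)).
  pose (g := fun t : R => (bm2 c * (- (/ t * / t / 2)) + bm1 c * (- / t) + b0 c * ln t)%C).
  pose (g' := fun t : R => (bm2 c * (/ t * / t * / t) + bm1 c * (/ t * / t) + b0 c * / t)%C).
  assert (Cg' : Ccont_on g' e 1).
  { apply cont_on_plus; [apply cont_on_plus|]; (apply cont_on_mult; [apply cont_on_const|]); auto using cont_on_mult. }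
  assert (Dg : forall t, e <= t <= 1 -> Rder g t (g' t)).
  { intros t Ht. assert (Nt : RtoC t <> 0%C) by (apply RtoC_neq_0; lra).
    assert (D1 := Rder_inv_id t ltac:(lra)).
    unfold g, g'. eapply Rder_eq.
    - apply Rder_plus; [apply Rder_plus|]; (apply Rder_mult; [apply Rder_const|]).
      + apply Rder_opp. apply (Rder_mult (fun t => / t * / t)%C (fun _ => / 2)%C); [|apply Rder_const].
        apply Rder_mult; exact D1.
      + apply Rder_opp. exact D1.
      + apply (Rder_RtoC ln t (/ t)). apply is_derive_ln. lra.
    - cbv beta. rewrite RtoC_inv by lra. field. exact Nt. }
  assert (E : CInt (kernel c) e 1 = (CInt (kernel_reg c) e 1 + (g 1 - g e))%C).
  { rewrite <- (CInt_derive g g' e 1) by (lra || assumption).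
    rewrite <- CInt_plus.
    - apply CInt_ext; [lra|]. intros t Ht. rewrite kernel_reg_split by lra. unfold g'. ring.
    - lra.
    - intros t Ht. apply (continuous_ext_loc (kernel_reg c) (fun t => kernel c t - g' t)%C t).
      + exists (mkposreal e (proj1 He)). intros s Hs. unfold ball in Hs; simpl in Hs.
        unfold AbsRing_ball, abs, minus, plus, opp in Hs; simpl in Hs. apply Rabs_lt_between in Hs.
        assert (Es : (kernel c s - g' s)%C = kernel_reg c s) by (rewrite kernel_reg_split by lra; unfold g'; ring).
        exact Es.
      + apply cont_minus; [apply kernel_cont; lra|now apply Cg'].
    - exact Cg'. }
  rewrite E. unfold g, expl. rewrite ln_1. field. apply RtoC_neq_0; lra.
Qed.

Lemma kernel_reg_cont (c : C) (t : R) : 0 < Re c -> 0 < t -> Ccont (kernel_reg c) t.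
Proof.
  intros Hc Ht.
  assert (K := cont_inv_id t t Ht t (conj (Rle_refl t) (Rle_refl t))).
  apply (continuous_ext_loc (kernel_reg c) (fun t => kernel c t - bm2 c * (/ t * / t * / t) - bm1 c * (/ t * / t) - b0 c * / t)%C t).
  - exists (mkposreal t Ht). intros s Hs. unfold ball in Hs; simpl in Hs.
    unfold AbsRing_ball, abs, minus, plus, opp in Hs; simpl in Hs. apply Rabs_lt_between in Hs.
    rewrite kernel_reg_split by lra. reflexivity.
  - assert (K2 := cont_mult _ _ _ K K). assert (K3 := cont_mult _ _ _ K2 K).
    apply cont_minus; [apply cont_minus; [apply cont_minus; [apply kernel_cont; assumption|]|]|];
    (apply cont_mult; [apply cont_const|assumption]).
Qed.

(** * The formula for the derivative at 0 *)

Theorem proposition2p2 : forall c : C, 0 < Re c ->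
  (exists (U : C -> Prop) (F : C -> C), zeta_continuation c U F) /\
  ex_RInt_gen (V := C_R_NormedModule) (kernel c)
    (at_point 1) (Rbar_locally p_infty) /\
  ex_RInt_gen (V := C_R_NormedModule) (kernel_reg c)
    (at_right 0) (at_point 1) /\
  forall (U : C -> Prop) (F : C -> C), zeta_continuation c U F ->
    is_C_derive F 0
      (RInt_gen (V := C_R_CompleteNormedModule) (kernel c)
         (at_point 1) (Rbar_locally p_infty)
       + RInt_gen (V := C_R_CompleteNormedModule) (kernel_reg c)
           (at_right 0) (at_point 1)
       - 1 / 2 * bm2 c - bm1 c + b0 c * gamma_e)%C.
Proof.
  intros c Hc. destruct (Hfun_exists c Hc) as [H HP].
  destruct (is_RInt_gen_at_point_infty (kernel c) (2 / Re c) 1) as [Ia [HIa TIa]].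
  { lra. }
  { apply Rdiv_le_0_compat; lra. }
  { intros t Ht. apply kernel_cont; lra. }
  { intros t Ht. now apply kernel_bound. }
  destruct (Dk_bound_near_0 c Hc) as [K HK].
  destruct (is_RInt_gen_at_right_0 (kernel_reg c) K) as [Ib [HIb TIb]].
  { intros t Ht. apply kernel_reg_cont; lra. }
  { intros t Ht. rewrite kernel_reg_eq, Cmod_mult, Cmod_inv_R by lra.
    specialize (HK t ltac:(lra)). rewrite Rabs_pos_eq in HK by lra. specialize (HK ltac:(lra)).
    apply (Rmult_le_reg_l t); [lra|]. rewrite <- Rmult_assoc, Rinv_r, Rmult_1_l by lra. lra. }
  split; [exists (fun _ => True), (zfun H); now apply zfun_continuation|].
  split; [now exists Ia|]. split; [now exists Ib|].
  intros U F HUF.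
  assert (EIa : RInt_gen (V := C_R_CompleteNormedModule) (kernel c) (at_point 1) (Rbar_locally p_infty) = Ia).
  { exact (is_RInt_gen_unique (V := C_R_CompleteNormedModule) _ _ HIa). }
  assert (EIb : RInt_gen (V := C_R_CompleteNormedModule) (kernel_reg c) (at_right 0) (at_point 1) = Ib).
  { exact (is_RInt_gen_unique (V := C_R_CompleteNormedModule) _ _ HIb). }
  rewrite EIa, EIb. clear EIa EIb.
  (* The derivative of [H] at 0. In [2 * expl] minus the [ppi]-terms at [c + 1] everything divergent
     cancels: / e^2, / e and ln e match term by term, and the quadratic terms in [c + 1] cancel
     among themselves. The terms after the integrals are what is left. *)
  pose (V := (2 * (Ia + Ib) - bm2 c - 2 * bm1 c + 2 * b0 c * gamma_e - 3 * b0 c)%C).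
  assert (TV : tends ends (fun p => 2 * CInt (kernel c) (fst p) (snd p) - Csum (fun j => bcoef c j * ppi j (fst p) (c + 1)) 3)%C V).
  { apply (tends_ext ends (fun p => 2 * (CInt (kernel c) 1 (snd p) + CInt (kernel_reg c) (fst p) 1)
       + (- bm2 c - 2 * bm1 c + 2 * b0 c * gamma_e - 3 * b0 c))%C).
    - apply (ends_intro 1 1 (fun e T => (2 * (CInt (kernel c) 1 T + CInt (kernel_reg c) e 1)
       + (- bm2 c - 2 * bm1 c + 2 * b0 c * gamma_e - 3 * b0 c))%C =
       (2 * CInt (kernel c) e T - Csum (fun j => bcoef c j * ppi j e (c + 1)) 3)%C) Rlt_0_1).
      intros e T He HT. rewrite (kernel_int_split c e T Hc He HT).
      cbn [Csum]. rewrite bcoef_0, (bcoef_1 c Hc), (bcoef_2 c Hc). unfold expl, ppi. rewrite RtoC_plus.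
      unfold bm1, bm2. field. split; [apply RtoC_neq_0; lra|now apply neq_0_Re].
    - replace V with (2 * (Ia + Ib) + (- bm2 c - 2 * bm1 c + 2 * b0 c * gamma_e - 3 * b0 c))%C by (unfold V; ring).
      apply (tends_plus ends); [|apply (tends_const ends)]. apply (tends_scal ends). now apply (tends_plus ends). }
  destruct (Dk_bound_neg c Hc) as [KD [KD0 HKD]].
  set (mu := Rmin 1 (Re c)). assert (Hmu : 0 < mu) by (apply Rmin_pos; lra).
  (* For fixed [n] the difference is the limit along [ends] of one integral, bounded uniformly in
     [e] and [T]: the integrand is at most 2 (/ t) (KD t) times three exponentials of rate
     [mu * INR (S n)], whence [6 * KD]. *)
  assert (Err : forall n, Cmod (dPsum c 3 (S n) (S n) psi - V) <= 6 * KD / mu / INR (S n)).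
  { intros n. assert (Hn := INR_S_ge n).
    assert (TZ := tends_dPsum ends c (S n) (S n) (fun j w p => Yint j w (fst p) (snd p) - ppi j (fst p) w)%C psi Hc
      (fun j w Hw => tends_Yint j w Hw)).
    assert (TD := tends_minus ends _ _ _ _ TZ TV).
    replace (dPsum c 3 (S n) (S n) psi - V)%C with (dPsum c 3 (S n) (S n) psi - V - 0)%C by ring.
    apply (tends_bound ends _ _ 0 _ TD). generalize ends_pos. apply filter_imp. intros [e T]. cbn [fst snd]. intros [He HT].
    rewrite dPsum_minus, (dPsum_ppi c _ _ e Hc).
    destruct (CInt_dPsum c (S n) (S n) (fun j w t => Cexp (- (w * t)) * kap j t)%C e T HT
      (fun j w => cont_Yint j w e T He)) as [CD ED].
    unfold Yint. rewrite ED.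
    assert (CK : Ccont_on (kernel c) e T) by (intros t Ht; apply kernel_cont; lra).
    match goal with |- Cmod (?A - ?P - (?W - ?P) - ?z) <= _ => replace (A - P - (W - P) - z)%C with (A - W)%C by ring end.
    rewrite <- CInt_scal by assumption.
    assert (CK2 : Ccont_on (fun t => 2 * kernel c t)%C e T) by (apply cont_on_mult; [apply cont_on_const|exact CK]).
    rewrite <- CInt_minus by assumption.
    assert (Hm : 0 < mu * INR (S n)) by (apply Rmult_lt_0_compat; lra).
    apply Rle_trans with (6 * KD / (mu * INR (S n)) * exp (- (mu * INR (S n)) * e)).
    - apply CInt_exp_le; [exact Hm|lra|lra|now apply cont_on_minus|].
      intros t Ht. rewrite dPsum_exp by lra.
      match goal with |- Cmod (?A + ?B - ?A) <= _ => replace (A + B - A)%C with B by ring end.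
      rewrite !Cmod_mult, Cmod_inv_R, Cmod_R, Rabs_pos_eq by lra.
      assert (Bd := bdry_exp_bound c n t Hc ltac:(lra)). fold mu in Bd.
      replace (6 * KD * exp (- (mu * INR (S n)) * t)) with (2 * / t * (KD * t) * (3 * exp (- (mu * INR (S n)) * t))) by (field; lra).
      assert (It : 0 < / t) by (apply Rinv_0_lt_compat; lra).
      apply Rmult_le_compat; [|apply Cmod_ge_0| |exact Bd].
      + apply Rmult_le_pos; [lra|apply Cmod_ge_0].
      + apply Rmult_le_compat_l; [lra|]. apply HKD. lra.
    - replace (6 * KD / mu / INR (S n)) with (6 * KD / (mu * INR (S n)) * 1) by (field; lra).
      apply Rmult_le_compat_l; [apply Rdiv_le_0_compat; lra|].
      rewrite <- exp_0. apply exp_le. nra. }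
  assert (HD : is_C_derive H 0 V).
  { apply (H_derive_0 c H Hc HP). apply (tends_le eventually _ _ (fun n => 6 * KD / mu / INR (S n))).
    - exists 0%nat. intros n _. apply Err.
    - intros eps He. now apply INR_inv_small. }
  eapply is_C_derive_eq; [exact (continuation_derive_0 c H Hc HP U F V HUF HD)|].
  unfold V. field.
Qed.
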